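(* Let $N$ and $r$ be positive integers and $i \in \{0, 1, \ldots, N-1\}$. Let $K$ be a compact interval contained in $$\Lambda = \Big\{x \in \mathbb{R} : \lim_{n \to \infty} \operatorname{discr}\big(X_{nN+i}(x)\big) \text{ exists and is negative}\Big\}.$$ Assume that $$\lim_{n \to \infty} \frac{a_{(n+1)N+i-1}}{a_{nN+i-1}} = 1.$$ If $(X_{nN+i} : n \in \mathbb{N})$ belongs to $\mathcal{D}_r\big(K, \operatorname{GL}(2, \mathbb{R})\big)$, then there is a positive function $g: K \rightarrow \mathbb{R}$ such that $$\lim_{\substack{n \to \infty\\ n \equiv i \bmod N}} \sup_{x \in K} \Big| a_{n+N-1} \big|p_{n}(x) p_{n+N-1}(x) - p_{n-1}(x) p_{n+N}(x) \big| - g(x) \Big| = 0.$$ Moreover, there is a probability measure $\nu$ on $\mathbb{R}$ such that $(p_n : n \in \mathbb{N}_0)$ are orthonormal in $L^2(\mathbb{R}, \nu)$, which is absolutely continuous on $K$ with the density $$\nu'(x) = \frac{\sqrt{-h(x)}}{2\pi g(x)}, \qquad x \in K,$$ where $$h(x) = \lim_{n \to \infty} \operatorname{discr} \big( X_{nN+i}(x) \big), \qquad x \in K.$$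
   Context: $\mathbb{N}$ is the set of positive integers, $\mathbb{N}_0=\mathbb{N}\cup\{0\}$. $(a_n : n \in \mathbb{N}_0)$ is a sequence of positive numbers and $(b_n : n \in \mathbb{N}_0)$ a sequence of real numbers. For $n\ge 1$ and $x \in \mathbb{R}$, $$B_n(x) = \begin{pmatrix} 0 & 1 \\ -\frac{a_{n-1}}{a_n} & \frac{x-b_n}{a_n} \end{pmatrix}, \qquad X_n(x) = \prod_{j=n}^{n+N-1} B_j(x) = B_{n+N-1}(x) B_{n+N-2}(x)\cdots B_n(x).$$ The polynomials $(p_n)$ are defined by $p_0(x)=1$, $p_1(x)=\frac{x-b_0}{a_0}$ and $a_np_{n+1}(x)+b_np_n(x)+a_{n-1}p_{n-1}(x)=xp_n(x)$ for $n\ge1$. For a $2\times2$ matrix $X$, $\operatorname{discr} X = (\operatorname{tr} X)^2 - 4\det X$. For a compact set $K\subset\mathbb{R}$ and $r\in\mathbb{N}$, a uniformly bounded sequence of continuous mappings $A_n : K\to \operatorname{GL}(2,\mathbb{R})$, $n \geq 1$, belongs to $\mathcal{D}_r(K,\operatorname{GL}(2,\mathbb{R}))$ if for each $j\in\{1,\ldots,r\}$, $$\sum_{n\ge1}\sup_{x\in K}\big\|\Delta^jA_n(x)\big\|^{r/j}<\infty,$$ where $\Delta^0A_n=A_n$ and $\Delta^jA_n=\Delta^{j-1}A_{n+1}-\Delta^{j-1}A_n$. *)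

(* Defs.v *)
From HB Require Import structures.
From mathcomp Require Export all_boot all_order all_algebra.
From mathcomp Require Export all_classical all_reals all_analysis.

Set Implicit Arguments.
Unset Strict Implicit.
Unset Printing Implicit Defensive.

Import Order.TTheory GRing.Theory Num.Theory.
Import numFieldNormedType.Exports.

Local Open Scope classical_set_scope.
Local Open Scope ring_scope.

Section Defs.
Context {R : realType}.

Section Jacobi.
Variables a b : nat -> R.

(* Only meaningful for n >= 1: [transfer_mx 0] reads [a 0] for a_{-1}. *)
Definition transfer_mx (n : nat) (x : R) : 'M[R]_2 :=
  \matrix_(s, t)
    if s == 0 then (if t == 0 then 0 else 1)
    else (if t == 0 then - (a n.-1 / a n) else (x - b n) / a n).

(* Indices decrease from left to right: B_{n+N-1}(x) * ... * B_n(x). *)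
Definition step_mx (N n : nat) (x : R) : 'M[R]_2 :=
  \prod_(j <- rev (index_iota n (n + N))) transfer_mx j x.

Fixpoint orth_poly (n : nat) : {poly R} :=
  match n with
  | 0 => 1
  | n'.+1 =>
    match n' with
    | 0 => (a 0)^-1 *: ('X - (b 0)%:P)
    | n''.+1 =>
      (a n')^-1 *: (('X - (b n')%:P) * orth_poly n' - a n'' *: orth_poly n'')
    end
  end.

Lemma orth_poly_rec (n : nat) (x : R) : a n.+1 != 0 ->
  a n.+1 * (orth_poly n.+2).[x] + b n.+1 * (orth_poly n.+1).[x]
    + a n * (orth_poly n).[x] = x * (orth_poly n.+1).[x].
Proof.
move=> an0.
rewrite -[orth_poly n.+2]/((a n.+1)^-1 *:
  (('X - (b n.+1)%:P) * orth_poly n.+1 - a n *: orth_poly n)).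
rewrite hornerZ mulrA divff// mul1r hornerD hornerN hornerM hornerXsubC hornerZ.
by rewrite mulrBl addrAC subrK subrK.
Qed.

End Jacobi.

Definition discr (X : 'M[R]_2) : R := (\tr X) ^+ 2 - 4 * \det X.

Definition discr_lim (a b : nat -> R) (N i : nat) (x : R) : R :=
  limn (fun n : nat => discr (step_mx a b N (n * N + i) x)).

Definition Lambda (a b : nat -> R) (N i : nat) : set R :=
  [set x | cvgn (fun n : nat => discr (step_mx a b N (n * N + i) x))
           /\ discr_lim a b N i x < 0].

(* Nondegenerate: on a one-point K absolute continuity would amount to the
   absence of an atom, which the hypotheses at that point do not imply. *)
Definition compact_interval (K : set R) : Prop :=
  exists c d : R, c < d /\ K = `[c, d]%classic.

(* Extended-real valued, so that an unbounded function has supremum +oo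
   (the real-valued [sup] would return 0). *)
Definition sup_on (K : set R) (f : R -> R) : \bar R :=
  ereal_sup [set (f x)%:E | x in K].

Fixpoint fdiff (j : nat) (A : nat -> R -> 'M[R]_2) (n : nat) (x : R)
    : 'M[R]_2 :=
  if j is j'.+1 then fdiff j' A n.+1 x - fdiff j' A n x else A n x.

(* The class D_r(K, GL(2, R)); the sequence is (A_n : n >= 1) and the norm is
   the library's max-entry norm. *)
Definition Dclass (r : nat) (K : set R) (A : nat -> R -> 'M[R]_2) : Prop :=
  [/\ forall n : nat, (0 < n)%N -> {within K, continuous (A n)},
      forall (n : nat) (x : R), (0 < n)%N -> K x -> A n x \in unitmx,
      exists M : R,
        forall (n : nat) (x : R), (0 < n)%N -> K x -> `|A n x| <= M
    & forall j : nat, (0 < j <= r)%N ->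
      (\sum_(1 <= n <oo)
         sup_on K (fun x => `|fdiff j A n x|%R) `^ (r%:R / j%:R) < +oo)%E].

Definition orthonormal_L2 (nu : probability (measurableTypeR R) R)
    (p : nat -> {poly R}) : Prop :=
  (forall n : nat, (fun x : R => (p n).[x]) \in Lfun nu 2%:E) /\
  (forall m n : nat,
     (\int[nu]_x ((p m).[x] * (p n).[x])%:E)%E = ((m == n)%:R)%:E).

Definition abs_cont_on (K : set R) (nu : probability (measurableTypeR R) R)
    (f : R -> R) : Prop :=
  [/\ measurable_fun (K : set (measurableTypeR R)) f,
      forall x : R, K x -> 0 <= f x
    & forall E : set (measurableTypeR R), measurable E -> E `<=` K ->
        nu E = (\int[lebesgue_measure]_(x in E) (f x)%:E)%E].

End Defs.

(* Main.v *)
Require Import Defs.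
From HB Require Import structures.
From mathcomp Require Import all_boot all_order all_algebra.
From mathcomp Require Import all_classical all_reals all_analysis.
From mathcomp Require Import ring lra zify qpoly measurable_realfun.
Set Implicit Arguments.
Unset Strict Implicit.
Unset Printing Implicit Defensive.
Import Order.TTheory GRing.Theory Num.Theory.
Import numFieldNormedType.Exports.
Local Open Scope classical_set_scope.
Local Open Scope ring_scope.
From mathcomp Require Import complex.

(** Fix the residue [i] and put [L = n N + i]. The vector [(p_(L-1), p_L)] is moved
    to the next block by the matrix [X_L(x)], and the Turan determinant of the
    statement is, up to sign and a weight, the value at this vector of the
    quadratic form [w |-> det(w, X_L w)], which is definite when the discriminant is
    negative. If [X_L] did not depend on [L], this form would be conserved along
    the orbit up to the factor [det X_L], which the weight [a_(L-1)] compensates.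
    In general one conjugates each [X_L] to a rotation times a scalar. In the new
    coordinates the form is the squared norm, and the new matrices fail to be
    conformal only by the differences of consecutive conjugating matrices: the
    defect has gained one order of smallness and lost one difference. After [r]
    conjugations the hypothesis D_r makes the defect summable, and the weighted
    norms converge as an infinite product, uniformly and to a nonzero limit
    ([energy_converges_conj], [elliptic_energy_converges], [turan_limit]). The
    entries of [X_L] are polynomials of degree at most [N], so by Lagrange
    interpolation ([poly_extend], [Dclass_regular], [discr_limit]) everything that
    is assumed on [K] holds on a larger segment. This gives [g], continuous and
    positive on a neighbourhood of [K].

    For the measure, continue the coefficients periodically after the index [L].
    Let [D] be the trace of the transfer matrix over one period of the continuation,
    [T] its Turan determinant and [U_m] the Chebyshev polynomials. The
    Cayley-Hamilton identity expresses [T U_m(D)] by products of two orthogonal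
    polynomials, so orthogonality evaluates every Gauss quadrature of
    [x ^ j U_m(D) T] with sufficiently many nodes ([quad_chebU]): a function
    [x ^ j h(D) T] is integrated like [h] against the semicircle law if
    [j = N - 1], and to zero for smaller [j]. In a band [D] is strictly monotone,
    and a test function can be written as the sum of such functions
    ([fiber_decomposition]). Hence the quadratures with [M] nodes converge on test
    functions to the integral against [sqrt (4 - D ^ 2) / (2 pi |T|)]
    ([local_law]). When [L] tends to infinity, [4 - D ^ 2] tends to [- h] and [|T|] to
    [g] ([per_disc_limit], [per_turan_limit]), and the density of the theorem
    appears in the limit.

    It remains to produce a measure. Along an ultrafilter that refines the iterated
    limit, first in [M] and then in [L], the quadratures converge as positive
    functionals, and the regularized limit of their distribution functions defines
    a probability measure which has the limiting integrals of polynomials and of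
    compactly supported continuous functions ([limit_measure_poly],
    [limit_measure_test]). The former give orthonormality, because the continued
    coefficients agree with the given ones below [L]; the latter determine the
    measure on [K] ([density_borel]). *)

(** * Orders of smallness and regularity of sequences of functions *)
Section SequenceClasses.
Context {R : realType}.
Implicit Types (rho u : nat -> R) (f g : nat -> R -> R).

Definition summable u : Prop := exists S : R, forall n, \sum_(k < n) u k <= S.

Lemma summable_le u v : (forall n, u n <= v n) -> summable v -> summable u.
Proof.
by move=> uv [S vS]; exists S => n; apply: le_trans (vS n); apply: ler_sum.
Qed.

Lemma summableD u v : summable u -> summable v -> summable (fun n => u n + v n).
Proof.
move=> [S uS] [T vT]; exists (S + T) => n.
by rewrite big_split/=; exact: lerD (uS n) (vT n).
Qed.

Lemma summable_shift u k : (forall n, 0 <= u n) -> summable u ->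
  summable (fun n => u (n + k)%N).
Proof.
move=> u0 [S uS]; exists S => n; apply: le_trans (uS (k + n)%N).
rewrite big_split_ord/= -[leLHS]add0r lerD ?sumr_ge0//.
by apply: ler_sum => i _; rewrite addnC.
Qed.

Lemma summableZ u (c : R) : 0 <= c -> summable u -> summable (fun n => c * u n).
Proof.
move=> c0 [S uS]; exists (c * S) => n; rewrite -mulr_sumr.
exact: ler_wpM2l.
Qed.

Lemma summable_cvg0 u : (forall n, 0 <= u n) -> summable u ->
  u @ \oo --> (0 : R).
Proof.
move=> u0 [S uS]; apply: cvg_series_cvg_0.
apply: nondecreasing_is_cvgn.
  apply/nondecreasing_seqP => n; rewrite /series/= big_nat_recr//=.
  by rewrite lerDl.
by exists S => _ [n _ <-]; rewrite /series/= big_mkord.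
Qed.

Variables (r : nat) (K : set R).
Hypothesis r_gt0 : (0 < r)%N.

(** Size [O(rho_n ^ m)] with [rho] in l^r, uniformly on [K]. Sequences of order
    [m] lie in l^(r/m), and, unlike the spaces l^(r/m), these classes make the
    product rule [order_geM] immediate: the maximum of two such [rho] is again
    in l^r. Order [r] is absolute summability, order [0] boundedness. *)
Definition order_ge (m : nat) (f : nat -> R -> R) : Prop :=
  exists rho : nat -> R, exists C : R,
    [/\ forall n, 0 <= rho n, summable (fun n => rho n ^+ r) &
        forall n x, K x -> `|f n x| <= C * rho n ^+ m].

Lemma order_ge_pos m f : order_ge m f -> exists rho : nat -> R, exists C : R,
    [/\ forall n, 0 <= rho n, summable (fun n => rho n ^+ r), 0 <= C &
        forall n x, K x -> `|f n x| <= C * rho n ^+ m].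
Proof.
move=> [rho [C [r0 rs fr]]]; exists rho, `|C|; split=> // n x Kx.
apply: le_trans (fr n x Kx) _; rewrite ler_wpM2r ?exprn_ge0//.
exact: ler_norm.
Qed.

Lemma order_ge_common m k f g : order_ge m f -> order_ge k g ->
  exists rho : nat -> R, exists C : R,
    [/\ forall n, 0 <= rho n, summable (fun n => rho n ^+ r), 0 <= C,
        forall n x, K x -> `|f n x| <= C * rho n ^+ m &
        forall n x, K x -> `|g n x| <= C * rho n ^+ k].
Proof.
move=> /order_ge_pos[rho [C [r0 rs C0 fr]]] /order_ge_pos[sig [D [s0 ss D0 gr]]].
have m0 n : 0 <= Num.max (rho n) (sig n) by rewrite le_max r0.
exists (fun n => Num.max (rho n) (sig n)), (C + D); split => //.
- apply: summable_le (summableD rs ss) => n /=.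
  by rewrite /Num.max; case: ifP => _; rewrite ?lerDl ?lerDr exprn_ge0.
- exact: addr_ge0.
- move=> n x Kx; apply: le_trans (fr n x Kx) _.
  apply: ler_pM; rewrite ?exprn_ge0// ?lerDl//.
  by apply: lerXn2r; rewrite ?nnegrE// le_max lexx.
- move=> n x Kx; apply: le_trans (gr n x Kx) _.
  apply: ler_pM; rewrite ?exprn_ge0// ?lerDr//.
  by apply: lerXn2r; rewrite ?nnegrE// le_max lexx orbT.
Qed.

Lemma order_geD m f g : order_ge m f -> order_ge m g ->
  order_ge m (fun n x => f n x + g n x).
Proof.
move=> Of Og; have [rho [C [r0 rs C0 fr gr]]] := order_ge_common Of Og.
exists rho, (C + C); split=> // n x Kx.
by apply: le_trans (ler_normD _ _) _; rewrite mulrDl lerD ?fr ?gr.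
Qed.

Lemma order_geM m k f g : order_ge m f -> order_ge k g ->
  order_ge (m + k) (fun n x => f n x * g n x).
Proof.
move=> Of Og; have [rho [C [r0 rs C0 fr gr]]] := order_ge_common Of Og.
exists rho, (C * C); split=> // n x Kx.
by rewrite normrM exprD mulrACA ler_pM ?fr ?gr.
Qed.

Lemma order_ge_ext m f g : (forall n x, K x -> f n x = g n x) ->
  order_ge m f -> order_ge m g.
Proof.
move=> fg [rho [C [r0 rs fr]]]; exists rho, C; split=> // n x Kx.
by rewrite -fg//; exact: fr.
Qed.

Lemma order_ge_shift m k f : order_ge m f -> order_ge m (fun n x => f (n + k)%N x).
Proof.
move=> [rho [C [r0 rs fr]]]; exists (fun n => rho (n + k)%N), C; split => //.
  by apply: (summable_shift (u := fun n => rho n ^+ r)) => // n; exact: exprn_ge0.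
by move=> n x Kx; exact: fr.
Qed.

Lemma order_ge_weaken m f : order_ge m.+1 f -> order_ge m f.
Proof.
move=> /order_ge_pos[rho [C [r0 [S rS] C0 fr]]].
have rle n : rho n <= 1 + S.
  have S0 : 0 <= S by have := rS 0; rewrite big_ord0.
  have [le1|/ltW ge1] := leP (rho n) 1; first by rewrite ler_wpDr.
  have : rho n ^+ r <= S.
    apply: le_trans (rS n.+1); rewrite big_ord_recr/= lerDr.
    by apply: sumr_ge0 => i _; exact: exprn_ge0.
  move=> H; rewrite ler_wpDl//; apply: le_trans H.
  by rewrite -[leLHS]expr1; apply: ler_weXn2l.
exists rho, (C * (1 + S)); split; [by []|by exists S|] => n x Kx.
apply: le_trans (fr n x Kx) _.
by rewrite exprS -mulrA ler_wpM2l// ler_wpM2r ?exprn_ge0.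
Qed.

Lemma order_ge0 m k f : order_ge (m + k) f -> order_ge m f.
Proof. by elim: k => [|k IH]; rewrite ?addn0 ?addnS// => /order_ge_weaken. Qed.

Lemma order_ge_bounded f : order_ge 0 f ->
  exists2 M : R, 0 < M & forall n x, K x -> `|f n x| <= M.
Proof.
move=> /order_ge_pos[rho [C [_ _ C0 fr]]]; exists (C + 1); first by rewrite ltr_wpDl.
move=> n x Kx; apply: le_trans (fr n x Kx) _; rewrite expr0 mulr1.
by rewrite lerDl.
Qed.

Lemma bounded_order_ge f (M : R) :
  (forall n x, K x -> `|f n x| <= M) -> order_ge 0 f.
Proof.
move=> fM; exists (fun=> 0), M; split=> //.
  by exists 0 => n; rewrite big1// => i _; rewrite expr0n; case: r r_gt0.
by move=> n x Kx; rewrite expr0 mulr1 fM.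
Qed.

Lemma order_ge_small m f (eps : R) : order_ge m.+1 f -> 0 < eps ->
  exists n0 : nat, forall n x, (n0 <= n)%N -> K x -> `|f n x| <= eps.
Proof.
move=> Of eps0.
have /order_ge_pos[rho [C [r0 rs C0 fr]]] : order_ge 1 f.
  by apply: (order_ge0 (k := m)); rewrite add1n.
have rr0 n : 0 <= rho n ^+ r by exact: exprn_ge0.
have e1 : 0 < (eps / (C + 1)) ^+ r.
  by rewrite exprn_gt0// divr_gt0// ltr_wpDl.
have /cvgrPdist_lt/(_ _ e1)[n0 _ H] := summable_cvg0 rr0 rs.
exists n0 => n x n0n Kx; apply: le_trans (fr n x Kx) _.
have := H n n0n; rewrite sub0r normrN ger0_norm// => Hn.
have lt1 : rho n <= eps / (C + 1).
  rewrite leNgt; apply/negP => gt1; move: Hn; rewrite ltNge => /negP; apply.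
  by apply: lerXn2r; rewrite ?nnegrE ?r0 ?ltW// divr_gt0// ltr_wpDl.
rewrite expr1; apply: le_trans (ler_wpM2l C0 lt1) _.
rewrite mulrCA ger_pMr// ler_pdivrMr ?ltr_wpDl// mul1r lerDl//.
Qed.

(** The j-th difference has order [m + j] for [j <= J]. With [m = 0] and [J = r]
    this is the condition that defines the class D_r; the shift by [m] records
    the gain from one difference, which the reduction below accumulates. *)
Fixpoint regular (m J : nat) (f : nat -> R -> R) : Prop :=
  if J is J'.+1 then
    order_ge m f /\ regular m.+1 J' (fun n x => f n.+1 x - f n x)
  else order_ge m f.

Lemma regular_order m J f : regular m J f -> order_ge m f.
Proof. by case: J => [|J] // []. Qed.

Lemma regular_diff m J f : regular m J.+1 f ->
  regular m.+1 J (fun n x => f n.+1 x - f n x).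
Proof. by case. Qed.

Lemma regular_ext m J f g : (forall n x, K x -> f n x = g n x) ->
  regular m J f -> regular m J g.
Proof.
elim: J m f g => [|J IH] m f g fg /=; first exact: order_ge_ext.
move=> [Of Rf]; split; first exact: order_ge_ext Of.
by apply: IH Rf => n x Kx; rewrite !fg.
Qed.

Lemma regular_pred m J f : regular m J.+1 f -> regular m J f.
Proof.
elim: J m f => [|J IH] m f; first by case.
by move=> [Of Rf]; split => //; exact: IH.
Qed.

Lemma regular_weaken m J f : regular m.+1 J f -> regular m J f.
Proof.
elim: J m f => [|J IH] m f /=; first exact: order_ge_weaken.
by move=> [Of Rf]; split; [exact: order_ge_weaken|exact: IH].
Qed.

Lemma regular0 m J f : regular m J f -> regular 0 J f.
Proof. by elim: m => // m IH /regular_weaken. Qed.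

Lemma regularD m J f g : regular m J f -> regular m J g ->
  regular m J (fun n x => f n x + g n x).
Proof.
elim: J m f g => [|J IH] m f g /=; first exact: order_geD.
move=> [Of Rf] [Og Rg]; split; first exact: order_geD.
by apply: regular_ext (IH _ _ _ Rf Rg) => n x _; ring.
Qed.

Lemma regular_shift m J k f : regular m J f ->
  regular m J (fun n x => f (n + k)%N x).
Proof.
elim: J m f => [|J IH] m f /=; first exact: order_ge_shift.
move=> [Of Rf]; split; first exact: order_ge_shift.
exact: (IH _ _ Rf).
Qed.

Lemma regularS m J f : regular m J f -> regular m J (fun n x => f n.+1 x).
Proof.
move=> /(@regular_shift _ _ 1); apply: regular_ext => n x _.
by rewrite addn1.
Qed.

Lemma regularM m k J f g : regular m J f -> regular k J g ->
  regular (m + k) J (fun n x => f n x * g n x).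
Proof.
elim: J m k f g => [|J IH] m k f g; first exact: order_geM.
move=> Rf Rg; split.
  by apply: order_geM; [exact: regular_order Rf|exact: regular_order Rg].
have [_ dRf] := Rf; have [_ dRg] := Rg.
have H1 := IH _ _ _ _ dRf (regularS (regular_pred Rg)).
have H2 := IH _ _ _ _ (regular_pred Rf) dRg.
rewrite addnS in H2.
by apply: regular_ext (regularD H1 H2) => n x _; ring.
Qed.

Lemma regularMl m J f g : regular 0 J f -> regular m J g ->
  regular m J (fun n x => f n x * g n x).
Proof. exact: regularM. Qed.

Lemma regular_cst J (c : R) : regular 0 J (fun _ _ => c).
Proof.
have R0 : forall J m, regular m J (fun _ _ => 0).
  elim=> [|J' IH] m /=.
    exists (fun=> 0), 0; split=> //; last by move=> *; rewrite normr0 mul0r.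
    by exists 0 => n; rewrite big1// => i _; rewrite expr0n; case: r r_gt0.
  split; last by rewrite subrr; exact: IH.
  exists (fun=> 0), 0; split=> //; last by move=> *; rewrite normr0 mul0r.
  by exists 0 => n; rewrite big1// => i _; rewrite expr0n; case: r r_gt0.
have Oc : order_ge 0 (fun _ _ => c) by exact: (bounded_order_ge (M := `|c|)).
by case: J => [|J] //=; split => //; rewrite subrr; exact: R0.
Qed.

Lemma regularZ m J f (c : R) : regular m J f ->
  regular m J (fun n x => c * f n x).
Proof. by apply: regularMl; exact: regular_cst. Qed.

Lemma regularN m J f : regular m J f -> regular m J (fun n x => - f n x).
Proof.
by move=> /(@regularZ _ _ _ (-1)); apply: regular_ext => n x _; rewrite mulN1r.
Qed.

Lemma regularB m J f g : regular m J f -> regular m J g ->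
  regular m J (fun n x => f n x - g n x).
Proof. by move=> Rf /regularN; exact: regularD. Qed.

(** The difference of the inverses is the difference of the sequence times two
    inverses, so that induction on [J] applies; the square root below is treated
    in the same way, through the sum of two square roots. *)
Lemma regularV J f (d : R) : 0 < d -> (forall n x, K x -> d <= `|f n x|) ->
  regular 0 J f -> regular 0 J (fun n x => (f n x)^-1).
Proof.
move=> d0 fd.
have f0 n x : K x -> f n x != 0.
  by move=> Kx; rewrite -normr_gt0 (lt_le_trans d0)// fd.
have O0 : order_ge 0 (fun n x => (f n x)^-1).
  apply: (bounded_order_ge (M := d^-1)) => n x Kx; rewrite normfV.
  by rewrite lef_pV2 ?fd// posrE ?normr_gt0 ?f0.
elim: J => [|J IH] // Rf; split => //.
have [_ dRf] := Rf.
have RV := IH (regular_pred Rf).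
have := regularM (regularM (regularN dRf) RV) (regularS RV).
rewrite !addn0; apply: regular_ext => n x Kx.
have := f0 n x Kx; have := f0 n.+1 x Kx => h1 h2; field.
by rewrite h1 h2.
Qed.

Lemma regular_sqrt J f (d : R) : 0 < d -> (forall n x, K x -> d <= f n x) ->
  regular 0 J f -> regular 0 J (fun n x => Num.sqrt (f n x)).
Proof.
move=> d0 fd.
have fpos n x : K x -> 0 < Num.sqrt (f n x).
  by move=> Kx; rewrite sqrtr_gt0 (lt_le_trans d0)// fd.
have fge n x : K x -> Num.sqrt d <= Num.sqrt (f n x).
  by move=> Kx; apply: ler_wsqrtr; exact: fd.
have O0 : order_ge 0 f -> order_ge 0 (fun n x => Num.sqrt (f n x)).
  move=> /order_ge_bounded[M M0 fM].
  apply: (bounded_order_ge (M := Num.sqrt M)) => n x Kx.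
  rewrite ger0_norm ?sqrtr_ge0//; apply: ler_wsqrtr.
  exact: le_trans (ler_norm _) (fM _ _ Kx).
elim: J => [|J IH]; first exact: O0.
move=> Rf; split; first exact: O0 (regular_order Rf).
have [_ dRf] := Rf; have RV := IH (regular_pred Rf).
have RS := regularD (regularS RV) RV.
have sd : 0 < Num.sqrt d by rewrite sqrtr_gt0.
have RI : regular 0 J (fun n x => (Num.sqrt (f n.+1 x) + Num.sqrt (f n x))^-1).
  apply: (regularV sd) RS => n x Kx.
  rewrite ger0_norm ?addr_ge0 ?sqrtr_ge0//.
  by rewrite ler_wpDl ?fge ?sqrtr_ge0.
have := regularM dRf RI; rewrite addn0; apply: regular_ext => n x Kx.
have sE k : Num.sqrt (f k x) ^+ 2 = f k x.
  by rewrite sqr_sqrtr// (le_trans (ltW d0))// fd.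
rewrite -{1}(sE n.+1) -{1}(sE n) subr_sqr mulfK//.
by rewrite gt_eqF// addr_gt0// fpos.
Qed.

End SequenceClasses.

(** * Orbits of slowly varying elliptic matrices *)
Section ConformalReduction.
Context {R : realType}.
Variables (r : nat) (K : set R).
Hypothesis r_gt0 : (0 < r)%N.
Implicit Types (f g E : nat -> R -> R).

Definition ucvg f (l : R -> R) : Prop := forall eps : R, 0 < eps ->
  exists n0, forall n x, (n0 <= n)%N -> K x -> `|f n x - l x| <= eps.

Lemma ucauchy_ucvg f :
  (forall eps : R, 0 < eps -> exists n0, forall n x, (n0 <= n)%N -> K x ->
     `|f n x - f n0 x| <= eps) ->
  exists l, ucvg f l.
Proof.
move=> cf.
have cvgf x : K x -> cvgn (fun n => f n x).
  move=> Kx; apply/cauchy_cvgP/cauchy_exP => e e0.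
  have [n0 H] := cf (e / 2) (divr_gt0 e0 (ltr0n _ 2)).
  exists (f n0 x); exists n0 => // n /= n0n.
  rewrite /ball/= distrC (le_lt_trans (H n x n0n Kx))//.
  by rewrite ltr_pdivrMr// ltr_pMr// ltr1n.
exists (fun x => limn (fun n => f n x)) => eps eps0.
have e3 : 0 < eps / 3 by rewrite divr_gt0.
have [n0 H] := cf _ e3.
exists n0 => n x n0n Kx.
have /cvgrPdist_lt/(_ _ e3)[k _ Hk] := cvgf x Kx.
have /= L := Hk (maxn k n0) (leq_maxl _ _).
have Hm := H (maxn k n0) x (leq_maxr _ _) Kx.
have Hn := H n x n0n Kx.
move: L Hm Hn; set l := limn _; rewrite !ler_norml ltr_norml => /andP[? ?] /andP[? ?] /andP[? ?].
by apply/andP; split; lra.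
Qed.

(** The properties of the limit that the proof needs: it has no zero, and it is
    bounded, which makes the convergence uniform in ratio as well. *)
Definition nonzero_ulimit f : Prop := exists l : R -> R, exists M : R,
  ucvg f l /\ forall x, K x -> l x != 0 /\ `|l x| <= M.

Lemma nonzero_ulimit_shift f k :
  nonzero_ulimit (fun n => f (n + k)%N) -> nonzero_ulimit f.
Proof.
move=> [l [M [fl lM]]]; exists l, M; split=> // eps /fl[n0 H].
exists (n0 + k)%N => n x nk Kx.
have kn : (k <= n)%N by apply: leq_trans nk; exact: leq_addl.
by have := H (n - k)%N x; rewrite subnK//; apply => //; rewrite leq_subRL// addnC.
Qed.

Lemma nonzero_ulimit_ratio f g :
  (forall eps : R, 0 < eps -> exists n0, forall n x, (n0 <= n)%N -> K x ->
     `|f n x - g n x| <= eps * `|f n x|) ->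
  nonzero_ulimit f -> nonzero_ulimit g.
Proof.
move=> fg [l [M [fl lM]]]; exists l, `|M|; split; last first.
  by move=> x /lM[l0 lx]; split=> //; apply: le_trans lx (ler_norm _).
move=> eps eps0.
have [n1 H1] := fl (Num.min 1 (eps / 2)) ltac:(by rewrite lt_min ltr01 divr_gt0).
have p0 : 0 < eps / 2 / (`|M| + 1) by rewrite !divr_gt0// ltr_wpDl.
have [n2 H2] := fg _ p0.
exists (maxn n1 n2) => n x; rewrite geq_max => /andP[n1n n2n] Kx.
have := H1 n x n1n Kx; rewrite le_min => /andP[fl1 fl2].
have fM : `|f n x| <= `|M| + 1.
  have -> : f n x = l x + (f n x - l x) by ring.
  apply: le_trans (ler_normD _ _) _; apply: lerD => //.
  by have [_ lx] := lM x Kx; apply: le_trans lx (ler_norm _).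
rewrite (splitr eps) -[X in `|X|](subrKA (f n x)) addrC.
apply: le_trans (ler_normD _ _) _; apply: lerD => //.
rewrite distrC; apply: le_trans (H2 n x n2n Kx) _.
apply: le_trans (ler_wpM2l (ltW p0) fM) _.
by rewrite divfK// gt_eqF// ltr_wpDl.
Qed.

Lemma nonzero_ulimit_ratioV f g :
  (forall eps : R, 0 < eps -> exists n0, forall n x, (n0 <= n)%N -> K x ->
     `|f n x - g n x| <= eps * `|g n x|) ->
  nonzero_ulimit f -> nonzero_ulimit g.
Proof.
move=> fg; apply: nonzero_ulimit_ratio => eps eps0.
have [n0 H] := fg (Num.min (1 / 2) (eps / 2))
  ltac:(by rewrite lt_min !divr_gt0).
exists n0 => n x n0n Kx; have Hn := H n x n0n Kx.
have m1 : Num.min (1 / 2) (eps / 2) <= 1 / 2 :> R by rewrite ge_min lexx.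
have m2 : Num.min (1 / 2) (eps / 2) <= eps / 2 :> R by rewrite ge_min lexx orbT.
have g2 : `|g n x| <= 2 * `|f n x|.
  have : `|g n x| - `|f n x| <= 1 / 2 * `|g n x|.
    apply: le_trans (lerB_dist _ _) _; rewrite distrC; apply: le_trans Hn _.
    exact: ler_wpM2r.
  by move=> ?; lra.
apply: le_trans Hn _; apply: le_trans (ler_wpM2r (normr_ge0 _) m2) _.
have /(ler_wpM2l (ltW (divr_gt0 eps0 (ltr0n _ 2)))) := g2.
by move=> H'; apply: le_trans H' _; rewrite mulrA divfK.
Qed.

Lemma summable_tail (u : nat -> R) : (forall n, 0 <= u n) -> summable u ->
  forall eps : R, 0 < eps ->
    exists n0, forall n1 n, (n0 <= n1)%N -> \sum_(n1 <= k < n) u k <= eps.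
Proof.
move=> u0 [S uS] eps eps0.
have : cvgn (series u).
  apply: nondecreasing_is_cvgn.
    apply/nondecreasing_seqP => n; rewrite /series/= big_nat_recr//=.
    by rewrite lerDl.
  by exists S => _ [n _ <-]; rewrite /series/= big_mkord.
move=> /cauchy_cvgP/cauchy_seriesP/(_ _ eps0)[[P Q]] /= [[p _ Pp] [q _ Qq]] H.
exists (maxn p q) => n1 n; rewrite geq_max => /andP[pn qn].
have [nn1|n1n] := leqP n n1; first by rewrite big_geq// ltW.
have := H (n1, n); rewrite /= => H1; apply: le_trans (ler_norm _) _.
by apply/ltW/H1; split; [exact: Pp|apply: Qq => /=; exact: leq_trans qn (ltnW n1n)].
Qed.

(** The estimate [est] compares [P] with its value at a fixed index, relatively to
    that value; this makes [P] a uniform Cauchy sequence and keeps its limit away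
    from zero. *)
Lemma product_ulimit P (eta : nat -> R -> R) (sigma : nat -> R) :
  (forall n, 0 <= sigma n) -> summable sigma ->
  (forall n x, K x -> P n.+1 x = P n x * (1 + eta n x)) ->
  (forall n x, K x -> `|eta n x| <= sigma n) ->
  (forall n x, K x -> P n x != 0) ->
  (forall n, exists M : R, forall x, K x -> `|P n x| <= M) ->
  nonzero_ulimit P.
Proof.
move=> s0 ss PS es P0 Pb.
have est n1 : (forall n, \sum_(n1 <= k < n) sigma k <= 1 / 4) ->
    forall k x, K x -> `|P (n1 + k)%N x - P n1 x| <=
      2 * (\sum_(n1 <= j < (n1 + k)%N) sigma j) * `|P n1 x|.
  move=> S4; elim=> [|k IH] x Kx; first by rewrite addn0 subrr normr0 mulr_ge0//
    mulr_ge0// sumr_ge0.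
  rewrite addnS PS// big_nat_recr ?leq_addr//=.
  have -> : P (n1 + k)%N x * (1 + eta (n1 + k)%N x) - P n1 x =
     (P (n1 + k)%N x - P n1 x) + P (n1 + k)%N x * eta (n1 + k)%N x by ring.
  apply: le_trans (ler_normD _ _) _; rewrite mulrDr mulrDl; apply: lerD.
    exact: IH.
  rewrite normrM mulrC.
  have P2 : `|P (n1 + k)%N x| <= 2 * `|P n1 x|.
    have -> : P (n1 + k)%N x = (P (n1 + k)%N x - P n1 x) + P n1 x by ring.
    apply: le_trans (ler_normD _ _) _; rewrite mulr2n mulrDl mul1r lerD2r.
    apply: le_trans (IH x Kx) _; rewrite ler_piMl//.
    by have := S4 (n1 + k)%N; lra.
  apply: le_trans (ler_pM (normr_ge0 _) (normr_ge0 _) (es _ _ Kx) P2) _.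
  by rewrite mulrCA mulrA.
have [n0 Hn0] := summable_tail s0 ss (ltac:(by rewrite divr_gt0) : 0 < 1 / 4 :> R).
have [M0 M0P] := Pb n0.
have S4 n1 : (n0 <= n1)%N -> forall n, \sum_(n1 <= k < n) sigma k <= 1 / 4.
  by move=> n01 n; exact: Hn0.
have est0 k x (Kx : K x) : `|P (n0 + k)%N x - P n0 x| <= 1 / 2 * `|P n0 x|.
  apply: le_trans (est n0 (S4 _ (leqnn _)) k x Kx) _; apply: ler_wpM2r => //.
  by have := S4 n0 (leqnn _) (n0 + k)%N; lra.
have PM n x : (n0 <= n)%N -> K x -> `|P n x| <= 2 * `|M0|.
  move=> n0n Kx; have := est0 (n - n0)%N x Kx; rewrite subnKC// => H.
  have H0 := M0P x Kx; have := ler_norm M0.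
  have := lerB_dist (P n x) (P n0 x); have := normr_ge0 (P n0 x).
  by move: H H0; lra.
have [l Pl] : exists l, ucvg P l.
  apply: ucauchy_ucvg => eps eps0.
  have d0 : 0 < eps / (4 * (`|M0| + 1)) by rewrite divr_gt0// mulr_gt0// ltr_wpDl.
  have [n2 Hn2] := summable_tail s0 ss d0.
  exists (maxn n0 n2) => n x nn Kx.
  have := est (maxn n0 n2) (S4 _ (leq_maxl _ _)) (n - maxn n0 n2)%N x Kx.
  rewrite subnKC// => H; apply: le_trans H _.
  have T := Hn2 (maxn n0 n2) n (leq_maxr _ _).
  have T2 := PM (maxn n0 n2) x (leq_maxl _ _) Kx.
  have T0 : 0 <= \sum_(maxn n0 n2 <= j < n) sigma j by rewrite sumr_ge0.
  apply: le_trans (ler_pM _ _ (ler_wpM2l (ler0n _ 2) T) T2) _ => //.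
    by rewrite mulr_ge0.
  have -> : 2%:R * (eps / (4 * (`|M0| + 1))) * (2 * `|M0|) =
    eps * (`|M0| / (`|M0| + 1)).
    by field; rewrite gt_eqF// ltr_wpDl.
  by rewrite ger_pMr// ler_pdivrMr ?ltr_wpDl// mul1r lerDl.
exists l, (2 * `|M0| + 1); split=> // x Kx; split.
  have Pn0 : 0 < `|P n0 x| by rewrite normr_gt0 P0.
  have e0 : 0 < `|P n0 x| / 4 by rewrite divr_gt0.
  have [n1 Hn1] := Pl _ e0.
  have := Hn1 (n0 + n1)%N x (leq_addl _ _) Kx => H1.
  have H2 := est0 n1 x Kx.
  apply/negP => /eqP lx; move: H1; rewrite lx subr0 => H1.
  have := lerB_dist (P n0 x) (P (n0 + n1)%N x); rewrite distrC.
  by move: H1 H2 Pn0; lra.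
have [n1 Hn1] := Pl 1 ltr01.
have H1 := Hn1 (n0 + n1)%N x (leq_addl _ _) Kx.
have H2 := PM (n0 + n1)%N x (leq_addr _ _) Kx.
have := lerB_dist (l x) (P (n0 + n1)%N x); rewrite distrC.
by move: H1 H2; lra.
Qed.

(** The discriminant of the matrix [[a, b], [c, d]]. *)
Definition discr2 (a b c d : R) : R := (d - a) ^+ 2 + 4 * b * c.

(** The form [w |-> det(w, A w)] of the matrix [A = [[a, b], [c, d]]] at
    [w = (u, v)]. It is invariant under [A] up to the factor [det A], which the
    weight [tau] compensates along an orbit; the division by the square root of
    the discriminant makes it independent of the normalization of [A]. *)
Definition energy (a b c d u v tau : R) : R :=
  tau * (c * u ^+ 2 + (d - a) * (u * v) - b * v ^+ 2)
    / Num.sqrt (- discr2 a b c d).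

(** A matrix [[a, b], [c, d]] is a rotation times a scalar exactly if [d = a] and
    [c = - b]; in that case the energy is half of the squared norm. *)
Lemma energy_near_conformal (a b c d u v tau M k : R) :
  0 < k -> k <= c -> c <= M -> `|d - a| <= M -> k <= Num.sqrt (- discr2 a b c d) ->
  `|energy a b c d u v tau - tau * (u ^+ 2 + v ^+ 2) / 2| <=
  ((M + 4 * M) / k + 3) / k * (`|d - a| + `|b + c|) *
     `|tau * (u ^+ 2 + v ^+ 2) / 2|.
Proof.
rewrite /energy; set s := Num.sqrt _ => k0 kc cM eM ks.
have s0 : 0 < s by exact: lt_le_trans ks.
have c0 : 0 < c by exact: lt_le_trans kc.
have M0 : 0 <= M by apply: le_trans cM; exact: ltW.
have s2 : s ^+ 2 = - discr2 a b c d.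
  rewrite sqr_sqrtr//; have := s0; rewrite /s => s0'.
  by rewrite leNgt; apply/negP => /ltW H; move: s0'; rewrite ler0_sqrtr// ltxx.
have e0 := normr_ge0 (d - a); have f0 := normr_ge0 (b + c).
set e := d - a in e0 eM *; set f := b + c in f0 *.
have sc : `|2 * c - s| <= (M * `|e| + 4 * M * `|f|) / k.
  have E : (2 * c - s) * (2 * c + s) = e ^+ 2 + 4 * c * f.
    have -> : (2 * c - s) * (2 * c + s) = 4 * c ^+ 2 - s ^+ 2 by ring.
    by rewrite s2 /discr2 /e /f; ring.
  have p0 : 0 < 2 * c + s by rewrite addr_gt0// mulr_gt0.
  rewrite ler_pdivlMr//.
  apply: (@le_trans _ _ (`|2 * c - s| * (2 * c + s))).
    by apply: ler_wpM2l => //; rewrite ler_wpDl// mulr_ge0// ltW.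
  rewrite -[X in _ * X](gtr0_norm p0) -normrM E.
  apply: le_trans (ler_normD _ _) _; apply: lerD.
    by rewrite normrX expr2; exact: ler_wpM2r.
  rewrite !normrM (gtr0_norm c0) ger0_norm//.
  by apply: ler_wpM2r => //; apply: ler_wpM2l.
have -> : tau * (c * u ^+ 2 + e * (u * v) - b * v ^+ 2) / s -
    tau * (u ^+ 2 + v ^+ 2) / 2 =
  tau / 2 * (((2 * c - s) * u ^+ 2 + 2 * e * (u * v) + (2 * c - 2 * f - s) * v ^+ 2) / s).
  by rewrite /f; field; rewrite gt_eqF.
have -> : tau * (u ^+ 2 + v ^+ 2) / 2 = tau / 2 * (u ^+ 2 + v ^+ 2) by ring.
have w0 : 0 <= u ^+ 2 + v ^+ 2 by rewrite addr_ge0// sqr_ge0.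
rewrite 2!(normrM (tau / 2)) (ger0_norm w0) [leRHS]mulrCA.
apply: ler_wpM2l; first exact: normr_ge0.
rewrite normrM.
rewrite normfV (gtr0_norm s0) ler_pdivrMr//.
have A1 : `|(2 * c - s) * u ^+ 2 + 2 * e * (u * v) + (2 * c - 2 * f - s) * v ^+ 2| <=
   (`|2 * c - s| + `|e| + 2 * `|f|) * (u ^+ 2 + v ^+ 2).
  have -> : (2 * c - s) * u ^+ 2 + 2 * e * (u * v) + (2 * c - 2 * f - s) * v ^+ 2
    = (2 * c - s) * (u ^+ 2 + v ^+ 2) + e * (2 * (u * v)) - 2 * f * v ^+ 2 by ring.
  apply: le_trans (ler_normB _ _) _; rewrite [leRHS]mulrDl; apply: lerD.
    apply: le_trans (ler_normD _ _) _; rewrite [leRHS]mulrDl; apply: lerD.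
      by rewrite normrM (ger0_norm w0).
    rewrite normrM; apply: ler_wpM2l => //; rewrite ler_norml.
    have := sqr_ge0 (u + v); have := sqr_ge0 (u - v); rewrite sqrrB sqrrD mulr2n.
    by move=> H1 H2; apply/andP; split; lra.
  rewrite (normrM _ (v ^+ 2)) (normrM 2) normr_nat (ger0_norm (sqr_ge0 v)).
  by apply: ler_wpM2l; rewrite ?mulr_ge0// lerDr sqr_ge0.
apply: le_trans A1 _; rewrite [leRHS]mulrAC; apply: ler_wpM2r => //.
have cM' : `|2 * c - s| + `|e| + 2 * `|f| <= ((M + 4 * M) / k + 3) * (`|e| + `|f|).
  have Mk : 0 <= M / k by rewrite divr_ge0// ltW.
  have T : (M * `|e| + 4 * M * `|f|) / k = M / k * `|e| + 4 * (M / k) * `|f| by ring.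
  have T2 : ((M + 4 * M) / k + 3) * (`|e| + `|f|) =
     M / k * `|e| + 4 * (M / k) * `|f| + 4 * (M / k * `|e|) + M / k * `|f| +
       3 * `|e| + 3 * `|f| by ring.
  have := mulr_ge0 Mk e0; have := mulr_ge0 Mk f0.
  by rewrite T2; move: sc; rewrite T; lra.
apply: le_trans cM' _.
have -> : ((M + 4 * M) / k + 3) / k * (`|e| + `|f|) * s =
  ((M + 4 * M) / k + 3) * (`|e| + `|f|) * (s / k) by ring.
rewrite ler_peMr//; last by rewrite ler_pdivlMr// mul1r.
apply: mulr_ge0; last exact: addr_ge0.
have M4 : 0 <= (M + 4 * M) / k.
  by apply: divr_ge0; rewrite ?(ltW k0)// addr_ge0// mulr_ge0.
by apply: addr_ge0.
Qed.

Definition orbit a b c d (u v tau : nat -> R -> R) : Prop :=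
  [/\ forall n x, K x -> u n.+1 x = a n x * u n x + b n x * v n x,
      forall n x, K x -> v n.+1 x = c n x * u n x + d n x * v n x,
      forall n x, K x -> tau n.+1 x * (a n x * d n x - b n x * c n x) = tau n x,
      forall n x, K x -> tau n x != 0 /\ u n x ^+ 2 + v n x ^+ 2 != 0 &
      forall n, exists M : R, forall x, K x ->
        [/\ `|u n x| <= M, `|v n x| <= M & `|tau n x| <= M]].

Lemma orbit_shift a b c d u v tau k : orbit a b c d u v tau ->
  orbit (fun n => a (n + k)%N) (fun n => b (n + k)%N) (fun n => c (n + k)%N)
        (fun n => d (n + k)%N) (fun n => u (n + k)%N) (fun n => v (n + k)%N)
        (fun n => tau (n + k)%N).
Proof.
move=> [h1 h2 h3 h4 h5]; split=> [n x Kx|n x Kx|n x Kx|n x Kx|n].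
- exact: h1.
- exact: h2.
- exact: h3.
- exact: h4.
- exact: h5.
Qed.

(** Convergence of the energy when the entries are [J] times regular and the
    defect of conformality, [d - a] and [b + c], already has order [m]. *)
Definition energy_converges m J : Prop := forall a b c d u v tau (k : R),
  [/\ regular r K 0 J a, regular r K 0 J b, regular r K 0 J c & regular r K 0 J d] ->
  regular r K m J (fun n x => d n x - a n x) ->
  regular r K m J (fun n x => b n x + c n x) ->
  0 < k ->
  (forall n x, K x -> k <= c n x /\
     k <= Num.sqrt (- discr2 (a n x) (b n x) (c n x) (d n x))) ->
  orbit a b c d u v tau ->
  nonzero_ulimit
   (fun n x => energy (a n x) (b n x) (c n x) (d n x) (u n x) (v n x) (tau n x)).

Lemma energy_ratio (m : nat) a b c d u v tau (k : R) :
  [/\ order_ge r K 0 a, order_ge r K 0 b, order_ge r K 0 c & order_ge r K 0 d] ->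
  order_ge r K m.+1 (fun n x => d n x - a n x) ->
  order_ge r K m.+1 (fun n x => b n x + c n x) ->
  0 < k ->
  (forall n x, K x -> k <= c n x /\
     k <= Num.sqrt (- discr2 (a n x) (b n x) (c n x) (d n x))) ->
  forall eps : R, 0 < eps -> exists n0, forall n x, (n0 <= n)%N -> K x ->
    `|energy (a n x) (b n x) (c n x) (d n x) (u n x) (v n x) (tau n x) -
      tau n x * (u n x ^+ 2 + v n x ^+ 2) / 2| <=
    eps * `|tau n x * (u n x ^+ 2 + v n x ^+ 2) / 2|.
Proof.
move=> [Oa Ob Oc Od] Oe Of k0 H eps eps0.
have [M1 M10 cM] := order_ge_bounded Oc.
have [M2 M20 eM] := order_ge_bounded (order_ge0 r_gt0 (k := m.+1) (m := 0) Oe).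
pose M := M1 + M2.
pose C := ((M + 4 * M) / k + 3) / k.
have M0 : 0 < M by exact: addr_gt0.
have C0 : 0 < C.
  rewrite /C divr_gt0// ltr_wpDl// divr_ge0 ?(ltW k0)//.
  by rewrite addr_ge0// ?mulr_ge0// ltW.
have e0 : 0 < eps / (2 * C) by rewrite divr_gt0// mulr_gt0.
have [n1 H1] := order_ge_small r_gt0 Oe e0.
have [n2 H2] := order_ge_small r_gt0 Of e0.
exists (maxn n1 n2) => n x; rewrite geq_max => /andP[n1n n2n] Kx.
have [kc ks] := H n x Kx.
apply: le_trans (energy_near_conformal (M := M) _ _ _ k0 kc _ _ ks) _.
- apply: le_trans (ler_norm _) _; apply: le_trans (cM n x Kx) _.
  by rewrite lerDl ltW.
- by apply: le_trans (eM n x Kx) _; rewrite lerDr ltW.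
- apply: ler_wpM2r => //; rewrite -/C.
  apply: le_trans (ler_wpM2l (ltW C0) (lerD (H1 n x n1n Kx) (H2 n x n2n Kx))) _.
  by have -> : C * (eps / (2 * C) + eps / (2 * C)) = eps by field; rewrite gt_eqF.
Qed.

Lemma det_ge (a b c d k : R) : 0 < k -> k <= Num.sqrt (- discr2 a b c d) ->
  k ^+ 2 / 4 <= a * d - b * c.
Proof.
move=> k0 ks.
have s0 := lt_le_trans k0 ks.
have d0 : 0 <= - discr2 a b c d.
  by rewrite leNgt; apply/negP => /ltW H; move: s0; rewrite ler0_sqrtr// ltxx.
have : k ^+ 2 <= - discr2 a b c d.
  by rewrite -(sqr_sqrtr d0); apply: lerXn2r; rewrite ?nnegrE ?(ltW k0) ?(ltW s0).
rewrite /discr2 => H; have := sqr_ge0 (a + d).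
have -> : a * d - b * c = ((a + d) ^+ 2 - ((d - a) ^+ 2 + 4 * b * c)) / 4 by field.
by move=> ?; lra.
Qed.

(** A conformal matrix multiplies the squared norm by its determinant. *)
Lemma norm_defect (a b c d u v M : R) :
  `|a| <= M -> `|b| <= M -> `|c| <= M -> `|d| <= M ->
  `|(a * u + b * v) ^+ 2 + (c * u + d * v) ^+ 2
     - (a * d - b * c) * (u ^+ 2 + v ^+ 2)| <=
  6 * M * (`|d - a| + `|b + c|) * (u ^+ 2 + v ^+ 2).
Proof.
move=> aM bM cM dM.
have M0 : 0 <= M by apply: le_trans aM.
have e0 := normr_ge0 (d - a); have f0 := normr_ge0 (b + c).
have -> : (a * u + b * v) ^+ 2 + (c * u + d * v) ^+ 2
     - (a * d - b * c) * (u ^+ 2 + v ^+ 2) =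
   (c * (b + c) - a * (d - a)) * u ^+ 2 + (b * (b + c) + d * (d - a)) * v ^+ 2
   + (a * (b + c) + c * (d - a)) * (2 * (u * v)) by ring.
have B (x y z : R) : `|x| <= M -> `|y| <= M ->
   `|x * (b + c) + y * (d - a)| * `|z| <= M * (`|d - a| + `|b + c|) * `|z|.
  move=> xM yM; apply: ler_wpM2r => //; apply: le_trans (ler_normD _ _) _.
  by rewrite !normrM addrC mulrDr; apply: lerD; apply: ler_wpM2r.
have uv : `|2 * (u * v)| <= u ^+ 2 + v ^+ 2.
  rewrite ler_norml; have := sqr_ge0 (u + v); have := sqr_ge0 (u - v).
  by rewrite sqrrB sqrrD mulr2n => H1 H2; apply/andP; split; lra.
set T := M * _ in B *.
have T0 : 0 <= M * (`|d - a| + `|b + c|) by rewrite mulr_ge0// addr_ge0.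
have aM' : `|- a| <= M by rewrite normrN.
have B1 := B c (- a) (u ^+ 2) cM aM'; have B2 := B b d (v ^+ 2) bM dM.
have B3 := B a c (2 * (u * v)) aM cM.
rewrite mulNr (ger0_norm (sqr_ge0 u)) in B1; rewrite (ger0_norm (sqr_ge0 v)) in B2.
apply: le_trans (ler_normD _ _) _.
apply: (@le_trans _ _ (T * (u ^+ 2) + T * v ^+ 2 + T * (u ^+ 2 + v ^+ 2))).
  apply: lerD.
    apply: le_trans (ler_normD _ _) _.
    rewrite (normrM _ (u ^+ 2)) (normrM _ (v ^+ 2)).
    by rewrite (ger0_norm (sqr_ge0 u)) (ger0_norm (sqr_ge0 v)); exact: lerD.
  by rewrite normrM; apply: le_trans B3 _; apply: ler_wpM2l.
have -> : 6 * M * (`|d - a| + `|b + c|) = 6 * T by rewrite /T; ring.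
have := mulr_ge0 T0 (sqr_ge0 u); have := mulr_ge0 T0 (sqr_ge0 v); rewrite -/T.
by move=> ? ?; lra.
Qed.

Lemma nonzero_ulimit_half f : nonzero_ulimit f ->
  nonzero_ulimit (fun n x => f n x / 2).
Proof.
move=> [l [M [fl lM]]]; exists (fun x => l x / 2), M; split.
  move=> eps /fl[n0 H]; exists n0 => n x n0n Kx; rewrite -mulrBl normrM.
  apply: le_trans (H n x n0n Kx); rewrite ler_piMr// ger0_norm//.
  by rewrite invf_le1// ler1n.
move=> x /lM[l0 lx]; split; first by rewrite mulf_neq0// invr_eq0.
apply: le_trans lx; rewrite normrM ler_piMr// ger0_norm//.
by rewrite invf_le1// ler1n.
Qed.

(** With a summable defect, the weighted squared norms of an orbit have
    consecutive ratios [1 + O(rho_n ^ r)], hence converge as an infinite product;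
    the energy is asymptotic to them. *)
Lemma energy_converges_base : energy_converges r 0.
Proof.
move=> a b c d u v tau k [Oa Ob Oc Od] Oe Of k0 H [hu hv ht hn hb].
rewrite /= in Oa Ob Oc Od Oe Of.
have [r' rE] : exists r', r = r'.+1 by case: r r_gt0 => // r' _; exists r'.
have Oe' := Oe; have Of' := Of.
rewrite {2}rE in Oe'; rewrite {2}rE in Of'.
(* It suffices to treat half of the weighted squared norm. *)
apply: (nonzero_ulimit_ratioV (f := fun n x =>
   tau n x * (u n x ^+ 2 + v n x ^+ 2) / 2)).
  move=> eps eps0.
  have p0 : 0 < Num.min (1 / 2) (eps / 2) by rewrite lt_min !divr_gt0.
  have [n0 Hn0] := energy_ratio u v tau (And4 Oa Ob Oc Od) Oe' Of' k0 H p0.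
  exists n0 => n x n0n Kx; have := Hn0 n x n0n Kx.
  set X := energy _ _ _ _ _ _ _; set Y := tau n x * _ / 2 => XY.
  have m1 : Num.min (1 / 2) (eps / 2) <= 1 / 2 :> R by rewrite ge_min lexx.
  have m2 : Num.min (1 / 2) (eps / 2) <= eps / 2 :> R by rewrite ge_min lexx orbT.
  have YX : `|Y| <= 2 * `|X|.
    have : `|Y| - `|X| <= 1 / 2 * `|Y|.
      apply: le_trans (lerB_dist _ _) _; rewrite distrC; apply: le_trans XY _.
      exact: ler_wpM2r.
    by move=> ?; lra.
  rewrite distrC; apply: le_trans XY _.
  apply: le_trans (ler_wpM2r (normr_ge0 _) m2) _.
  have /(ler_wpM2l (ltW (divr_gt0 eps0 (ltr0n _ 2)))) := YX.
  by move=> H'; apply: le_trans H' _; rewrite mulrA divfK.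
apply: nonzero_ulimit_half.
have [Ma Ma0 aM] := order_ge_bounded Oa; have [Mb Mb0 bM] := order_ge_bounded Ob.
have [Mc Mc0 cM] := order_ge_bounded Oc; have [Md Md0 dM] := order_ge_bounded Od.
pose M := Ma + Mb + Mc + Md.
have M0 : 0 < M by rewrite !addr_gt0.
have [rho [C [rho0 rhos C0 er fr]]] := order_ge_common Oe Of.
pose det n x := a n x * d n x - b n x * c n x.
have det0 n x : K x -> k ^+ 2 / 4 <= det n x.
  by move=> Kx; apply: det_ge => //; have [] := H n x Kx.
have k2 : 0 < k ^+ 2 / 4 by rewrite divr_gt0// exprn_gt0.
pose w n x := u n x ^+ 2 + v n x ^+ 2.
pose eta n x := w n.+1 x / (det n x * w n x) - 1.
pose D := 6 * M * (C + C) / (k ^+ 2 / 4).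
have D0 : 0 <= D by rewrite !mulr_ge0 ?invr_ge0 ?addr_ge0 ?(ltW k2)// ltW.
have wpos n x : K x -> 0 < w n x.
  move=> Kx; rewrite lt_neqAle addr_ge0 ?sqr_ge0// andbT eq_sym.
  by have [] := hn n x Kx.
apply: (product_ulimit (eta := eta) (sigma := fun n => D * rho n ^+ r)).
- by move=> n; rewrite mulr_ge0// exprn_ge0.
- exact: summableZ.
- move=> n x Kx; rewrite /eta [1 + _]addrC subrK -(ht n x Kx).
  rewrite -/(w n x) -/(w n.+1 x) -/(det n x).
  rewrite -(mulrA (tau _ _)) -mulrA [_ * (w n.+1 x / _)]mulrC divfK//.
  rewrite mulf_neq0// gt_eqF ?wpos//.
  exact: lt_le_trans (det0 n x Kx).
- move=> n x Kx; have dn := lt_le_trans k2 (det0 n x Kx); have wn := wpos n x Kx.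
  have -> : eta n x = (w n.+1 x - det n x * w n x) / (det n x * w n x).
    by rewrite /eta; field; rewrite !gt_eqF.
  rewrite normrM normfV (gtr0_norm (mulr_gt0 dn wn)) ler_pdivrMr ?mulr_gt0//.
  rewrite /w hu// hv//.
  apply: le_trans (norm_defect (M := M) _ _ _ _ _ _) _.
  + apply: le_trans (aM n x Kx) _; rewrite /M; lra.
  + apply: le_trans (bM n x Kx) _; rewrite /M; lra.
  + apply: le_trans (cM n x Kx) _; rewrite /M; lra.
  + apply: le_trans (dM n x Kx) _; rewrite /M; lra.
  rewrite -/(w n x) [leRHS]mulrA; apply: ler_wpM2r; first exact: ltW.
  have ef := lerD (er n x Kx) (fr n x Kx).
  apply: le_trans (ler_wpM2l _ ef) _; first by rewrite mulr_ge0// ltW.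
  have -> : 6 * M * (C * rho n ^+ r + C * rho n ^+ r) =
     D * rho n ^+ r * (k ^+ 2 / 4).
    by rewrite /D; field; rewrite gt_eqF.
  by apply: ler_wpM2l (det0 n x Kx); rewrite mulr_ge0// exprn_ge0.
- by move=> n x Kx; have [t0 w0] := hn n x Kx; rewrite mulf_neq0.
- move=> n; have [B HB] := hb n; exists (B * (B ^+ 2 + B ^+ 2)) => x Kx.
  have [uB vB tB] := HB x Kx; have B0 : 0 <= B by exact: le_trans tB.
  rewrite normrM; apply: ler_pM => //; apply: le_trans (ler_normD _ _) _.
  by rewrite !normrX; apply: lerD; apply: lerXn2r.
Qed.

(** The matrix [C = [[1, be], [0, ga]]], with [be] and [ga] as below, conjugates
    [A] to a rotation times a scalar, so that the energy is half of a squared norm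
    in the new coordinates. *)
Lemma energy_conj (a b c d u v tau : R) (s := Num.sqrt (- discr2 a b c d)) :
  c != 0 -> 0 < s ->
  energy a b c d u v tau =
    tau / (s / (2 * c)) *
      ((u + (d - a) / (2 * c) * v) ^+ 2 + (s / (2 * c) * v) ^+ 2) / 2.
Proof.
move=> c0 s0; have s2 : s ^+ 2 = - discr2 a b c d.
  rewrite sqr_sqrtr// leNgt; apply/negP => /ltW H.
  by move: s0; rewrite /s ler0_sqrtr// ltxx.
have bE : b = - (s ^+ 2 + (d - a) ^+ 2) / (4 * c).
  by rewrite s2 /discr2; field.
rewrite /energy -/s; move: s s0 bE {s2} => s s0 ->.
by field; rewrite c0 gt_eqF.
Qed.

(** In the coordinates [C_n w_n] the step matrix is [C_(n+1) A_n C_n^-1], namely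
    the conformal matrix [C_n A_n C_n^-1] perturbed by [C_(n+1) - C_n] only;
    [ep] and [ze] are the entries of this perturbation. *)
Lemma conj_orbit (a b c d u v s be1 ga1 : R) :
  c != 0 -> 0 < s -> s ^+ 2 = - discr2 a b c d ->
  let be := (d - a) / (2 * c) in let ga := s / (2 * c) in
  let ep := (be1 - be) / ga in let ze := (ga1 - ga) / ga in
  let u1 := u + be * v in let v1 := ga * v in
  (a * u + b * v) + be1 * (c * u + d * v) =
    ((a + d) / 2 + ep * s / 2) * u1 + (- s / 2 + ep * (a + d) / 2) * v1 /\
  ga1 * (c * u + d * v) = (1 + ze) * s / 2 * u1 + (1 + ze) * (a + d) / 2 * v1.
Proof.
move=> c0 s0 s2 be ga ep ze u1 v1.
have bE : b = - (s ^+ 2 + (d - a) ^+ 2) / (4 * c).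
  by rewrite s2 /discr2; field.
rewrite /ep /ze /u1 /v1 /be /ga bE.
by split; field; rewrite c0 gt_eqF.
Qed.

Lemma conj_det (a b c d s ga1 ep : R) :
  c != 0 -> 0 < s -> s ^+ 2 = - discr2 a b c d ->
  let ga := s / (2 * c) in let ze := (ga1 - ga) / ga in
  ((a + d) / 2 + ep * s / 2) * ((1 + ze) * (a + d) / 2) -
  (- s / 2 + ep * (a + d) / 2) * ((1 + ze) * s / 2) =
  (a * d - b * c) * ga1 / ga.
Proof.
move=> c0 s0 s2 ga ze.
have bE : b = - (s ^+ 2 + (d - a) ^+ 2) / (4 * c).
  by rewrite s2 /discr2; field.
by rewrite /ze /ga bE; field; rewrite c0 gt_eqF.
Qed.

(** Conjugation to conformal matrices trades one difference of the entries for one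
    order of smallness of the defect. The energy does not change, because up to
    normalization it is the only form invariant under [A]. *)
Lemma energy_converges_conj m J : energy_converges m.+1 J ->
  forall a b c d u v tau (k : R),
  let s n x := Num.sqrt (- discr2 (a n x) (b n x) (c n x) (d n x)) in
  let be n x := (d n x - a n x) / (2 * c n x) in
  let ga n x := s n x / (2 * c n x) in
  [/\ regular r K 0 J a, regular r K 0 J b, regular r K 0 J c & regular r K 0 J d] ->
  0 < k ->
  (forall n x, K x -> k <= `|c n x| /\ k <= s n x) ->
  regular r K m.+1 J (fun n x => be n.+1 x - be n x) ->
  regular r K m.+1 J (fun n x => ga n.+1 x - ga n x) ->
  orbit a b c d u v tau ->
  nonzero_ulimit
   (fun n x => energy (a n x) (b n x) (c n x) (d n x) (u n x) (v n x) (tau n x)).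
Proof.
move=> conv a b c d u v tau k s be ga [Ra Rb Rc Rd] k0 H Rbe Rga orb.
have c0 n x : K x -> c n x != 0.
  by move=> Kx; have [kc _] := H n x Kx; rewrite -normr_gt0 (lt_le_trans k0).
have ks n x : K x -> k <= s n x by move=> Kx; have [] := H n x Kx.
have s0 n x : K x -> 0 < s n x by move=> Kx; exact: lt_le_trans (ks n x Kx).
have s2 n x : K x -> s n x ^+ 2 = - discr2 (a n x) (b n x) (c n x) (d n x).
  move=> Kx; rewrite sqr_sqrtr// leNgt; apply/negP => /ltW H'.
  by have := s0 n x Kx; rewrite /s ler0_sqrtr// ltxx.
have ga0 n x : K x -> ga n x != 0.
  by move=> Kx; rewrite mulf_neq0 ?invr_eq0 ?mulf_neq0 ?c0// gt_eqF ?s0.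
have Rs : regular r K 0 J s.
  apply: (regular_sqrt r_gt0 (d := k ^+ 2)); first exact: exprn_gt0.
    move=> n x Kx; rewrite -s2//; apply: lerXn2r; rewrite ?ks// nnegrE.
      exact: ltW.
    exact/ltW/s0.
  apply: regularN => //; apply: regularD => //.
    have Re := regularB r_gt0 Rd Ra.
    by apply: regular_ext (regularMl Re Re) => n x _; rewrite expr2.
  by apply: regularMl => //; exact: regularZ.
have RsV : regular r K 0 J (fun n x => (s n x)^-1).
  by apply: (regularV r_gt0 k0) Rs => n x Kx; rewrite gtr0_norm ?s0 ?ks.
have RcV : regular r K 0 J (fun n x => (c n x)^-1).
  by apply: (regularV r_gt0 k0) Rc => n x Kx; have [] := H n x Kx.
have RgaV : regular r K 0 J (fun n x => (ga n x)^-1).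
  apply: regular_ext (regularMl (regularZ r_gt0 2 Rc) RsV) => n x Kx.
  by rewrite /ga invf_div.
have Rgb : regular r K 0 J ga.
  apply: regular_ext (regularMl (regularZ r_gt0 (1 / 2) Rs) RcV) => n x Kx.
  by rewrite /ga; field; rewrite c0.
have Rbb : regular r K 0 J be.
  apply: regular_ext (regularMl (regularZ r_gt0 (1 / 2) (regularB r_gt0 Rd Ra)) RcV) => n x Kx.
  by rewrite /be; field; rewrite c0.
have Rt := regularD Ra Rd.
pose ep n x := (be n.+1 x - be n x) / ga n x.
pose ze n x := (ga n.+1 x - ga n x) / ga n x.
have Rep : regular r K m.+1 J ep.
  by apply: regular_ext (regularMl RgaV Rbe) => n x _; rewrite mulrC.
have Rze : regular r K m.+1 J ze.
  by apply: regular_ext (regularMl RgaV Rga) => n x _; rewrite mulrC.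
pose a1 n x := (a n x + d n x) / 2 + ep n x * s n x / 2.
pose b1 n x := - s n x / 2 + ep n x * (a n x + d n x) / 2.
pose c1 n x := (1 + ze n x) * s n x / 2.
pose d1 n x := (1 + ze n x) * (a n x + d n x) / 2.
have Rep0 := regular0 r_gt0 Rep; have Rze0 := regular0 r_gt0 Rze.
have R1z := regularD (regular_cst K r_gt0 J 1) Rze0.
have Ra1 : regular r K 0 J a1.
  apply: regular_ext (regularD (regularZ r_gt0 (1 / 2) Rt)
    (regularMl Rep0 (regularZ r_gt0 (1 / 2) Rs))) => n x _; rewrite /a1; ring.
have Rb1 : regular r K 0 J b1.
  apply: regular_ext (regularD (regularZ r_gt0 (- (1 / 2)) Rs)
    (regularMl Rep0 (regularZ r_gt0 (1 / 2) Rt))) => n x _; rewrite /b1; ring.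
have Rc1 : regular r K 0 J c1.
  apply: regular_ext (regularMl R1z (regularZ r_gt0 (1 / 2) Rs)) => n x _.
  by rewrite /c1; ring.
have Rd1 : regular r K 0 J d1.
  apply: regular_ext (regularMl R1z (regularZ r_gt0 (1 / 2) Rt)) => n x _.
  by rewrite /d1; ring.
have Re1 : regular r K m.+1 J (fun n x => d1 n x - a1 n x).
  apply: regular_ext (regularB r_gt0 (regularMl (regularZ r_gt0 (1 / 2) Rt) Rze)
    (regularMl (regularZ r_gt0 (1 / 2) Rs) Rep)) => n x _; rewrite /a1 /d1; ring.
have Rf1 : regular r K m.+1 J (fun n x => b1 n x + c1 n x).
  apply: regular_ext (regularD (regularMl (regularZ r_gt0 (1 / 2) Rt) Rep)
    (regularMl (regularZ r_gt0 (1 / 2) Rs) Rze)) => n x _; rewrite /b1 /c1; ring.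
(* The new matrices are uniformly elliptic only from some index on: ze and the
   defect must first become small. *)
pose k1 := k / 4.
have k10 : 0 < k1 by rewrite divr_gt0.
have k14 : 0 < k1 / 4 by rewrite divr_gt0.
have [n1 Hn1] := order_ge_small r_gt0 (regular_order Rze)
  (ltac:(by rewrite divr_gt0) : 0 < 1 / 2 :> R).
have [n2 Hn2] := order_ge_small r_gt0 (regular_order Re1) k14.
have [n3 Hn3] := order_ge_small r_gt0 (regular_order Rf1) k14.
pose n0 := maxn n1 (maxn n2 n3).
have c1k n x : (n0 <= n)%N -> K x -> k1 <= c1 n x.
  rewrite !geq_max => /andP[h1 _] Kx; have := Hn1 n x h1 Kx; rewrite ler_norml.
  move=> /andP[z _]; have := ks n x Kx => ksx.
  have z2 : 1 / 2 <= 1 + ze n x by lra.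
  rewrite /c1 /k1; have := ler_pM _ (ltW k0) z2 ksx; move=> /(_ ltac:(by lra)).
  by move=> ?; lra.
have s1k n x : (n0 <= n)%N -> K x ->
    k1 <= Num.sqrt (- discr2 (a1 n x) (b1 n x) (c1 n x) (d1 n x)).
  move=> h Kx; have kc := c1k n x h Kx; move: h.
  rewrite !geq_max => /and3P[_ h2 h3].
  have := Hn2 n x h2 Kx; have := Hn3 n x h3 Kx.
  rewrite !ler_norml => /andP[f1 f2] /andP[e1 e2].
  rewrite -[leLHS](ger0_norm (ltW k10)) -sqrtr_sqr; apply: ler_wsqrtr.
  rewrite /discr2.
  have -> : b1 n x = (b1 n x + c1 n x) - c1 n x by ring.
  move: (d1 n x - a1 n x) (b1 n x + c1 n x) e1 e2 f1 f2 => e f e1 e2 f1 f2.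
  move: (c1 n x) kc => g kc.
  have E2 : e ^+ 2 <= (k1 / 4) ^+ 2.
    rewrite -(real_normK (num_real e)); apply: lerXn2r; rewrite ?nnegrE ?(ltW k14)//.
    by rewrite ler_norml e1 e2.
  have g0 : 0 <= g by apply: le_trans kc; exact: ltW.
  have F : f * g <= g * g / 4.
    by rewrite mulrAC; apply: ler_wpM2r => //; lra.
  have G : k1 * k1 <= g * g by apply: ler_pM => //; exact: ltW.
  have E2' : (k1 / 4) ^+ 2 = k1 * k1 / 16 by field.
  have -> : - (e ^+ 2 + 4 * (f - g) * g) = 4 * (g * g) - 4 * (f * g) - e ^+ 2 by ring.
  have := mulr_ge0 g0 g0; rewrite expr2; rewrite E2' in E2.
  by lra.
pose u1 n x := u n x + be n x * v n x.
pose v1 n x := ga n x * v n x.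
pose tau1 n x := tau n x / ga n x.
have orb1 : orbit a1 b1 c1 d1 u1 v1 tau1.
  move: orb => [hu hv ht hn hb]; split.
  - move=> n x Kx; rewrite /u1 hu// hv//.
    have [E _] := conj_orbit (u n x) (v n x) (be n.+1 x) (ga n.+1 x)
      (c0 n x Kx) (s0 n x Kx) (s2 n x Kx).
    exact: E.
  - move=> n x Kx; rewrite /v1 hv//.
    have [_ E] := conj_orbit (u n x) (v n x) (be n.+1 x) (ga n.+1 x)
      (c0 n x Kx) (s0 n x Kx) (s2 n x Kx).
    exact: E.
  - move=> n x Kx.
    have E := conj_det (ga n.+1 x) (ep n x) (c0 n x Kx) (s0 n x Kx) (s2 n x Kx).
    rewrite /= in E; rewrite /tau1 -(ht n x Kx) /a1 /b1 /c1 /d1 /ze /ga E.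
    rewrite -/(ga n x) -/(ga n.+1 x).
    have := ga0 n x Kx; have := ga0 n.+1 x Kx.
    by move: (ga n x) (ga n.+1 x) => g g' h h'; field; rewrite h h'.
  - move=> n x Kx; have [t0 w0] := hn n x Kx; split.
      by rewrite mulf_neq0 ?invr_eq0 ?ga0.
    apply: contraNneq w0 => /eqP.
    rewrite paddr_eq0 ?sqr_ge0// !sqrf_eq0 => /andP[/eqP hu1 /eqP hv1].
    have v0 : v n x = 0.
      by move: hv1 => /eqP; rewrite mulf_eq0 (negPf (ga0 n x Kx))/= => /eqP.
    move: hu1; rewrite /u1 v0 mulr0 addr0 => ->.
    by rewrite expr0n addr0.
  - move=> n; have [B HB] := hb n.
    have [G1 _ G1P] := order_ge_bounded (regular_order Rgb).
    have [G2 _ G2P] := order_ge_bounded (regular_order RgaV).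
    have [G3 _ G3P] := order_ge_bounded (regular_order Rbb).
    exists (`|B| + `|G3| * `|B| + `|G1| * `|B| + `|B| * `|G2|) => x Kx.
    have [uB vB tB] := HB x Kx.
    have BB := ler_norm B.
    have uB' := le_trans uB BB; have vB' := le_trans vB BB; have tB' := le_trans tB BB.
    have g1 := le_trans (G1P n x Kx) (ler_norm _).
    have g2 := le_trans (G2P n x Kx) (ler_norm _).
    have g3 := le_trans (G3P n x Kx) (ler_norm _).
    have p0 := normr_ge0 B.
    have p1 := mulr_ge0 (normr_ge0 G3) p0; have p2 := mulr_ge0 (normr_ge0 G1) p0.
    have p3 := mulr_ge0 p0 (normr_ge0 G2).
    split.
    + apply: le_trans (ler_normD _ _) _; rewrite normrM.
      have := ler_pM (normr_ge0 _) (normr_ge0 _) g3 vB'; lra.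
    + rewrite normrM.
      have := ler_pM (normr_ge0 _) (normr_ge0 _) g1 vB'; lra.
    + rewrite normrM.
      have := ler_pM (normr_ge0 _) (normr_ge0 _) tB' g2; lra.
have EE n x : K x -> energy (a n x) (b n x) (c n x) (d n x) (u n x) (v n x) (tau n x) =
    tau1 n x * (u1 n x ^+ 2 + v1 n x ^+ 2) / 2.
  by move=> Kx; rewrite energy_conj ?c0// s0.
apply: (@nonzero_ulimit_shift _ n0).
have Rsh mm f : regular r K mm J f -> regular r K mm J (fun n => f (n + n0)%N).
  exact: regular_shift.
have bnd n x : K x -> k1 <= c1 (n + n0)%N x /\ k1 <= Num.sqrt (- discr2
    (a1 (n + n0)%N x) (b1 (n + n0)%N x) (c1 (n + n0)%N x) (d1 (n + n0)%N x)).
  by move=> Kx; split; [apply: c1k|apply: s1k]; rewrite ?leq_addl.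
have C1 := conv _ _ _ _ _ _ _ _ (And4 (Rsh _ _ Ra1) (Rsh _ _ Rb1) (Rsh _ _ Rc1)
   (Rsh _ _ Rd1)) (Rsh _ _ Re1) (Rsh _ _ Rf1) k10 bnd (orbit_shift n0 orb1).
apply: nonzero_ulimit_ratioV C1 => eps eps0.
have [N0 HN0] := energy_ratio (fun n => u1 (n + n0)%N) (fun n => v1 (n + n0)%N)
  (fun n => tau1 (n + n0)%N)
  (And4 (regular_order (Rsh _ _ Ra1)) (regular_order (Rsh _ _ Rb1))
        (regular_order (Rsh _ _ Rc1)) (regular_order (Rsh _ _ Rd1)))
  (regular_order (Rsh _ _ Re1)) (regular_order (Rsh _ _ Rf1)) k10 bnd eps0.
exists N0 => n x Nn Kx.
by rewrite EE//; exact: HN0.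
Qed.

(** If the defect has order [m], then so have [be] and [ga - 1], since
    [ga ^ 2 - 1 = - ((d - a) ^ 2 + 4 c (b + c)) / (2 c) ^ 2]; hence their
    differences have order [m + 1]. *)
Lemma energy_converges_step m J : (0 < m)%N -> energy_converges m.+1 J ->
  energy_converges m J.+1.
Proof.
move=> m0 conv a b c d u v tau k [Ra Rb Rc Rd] Re Rf k0 H orb.
pose s n x := Num.sqrt (- discr2 (a n x) (b n x) (c n x) (d n x)).
have c0 n x : K x -> 0 < c n x.
  by move=> Kx; have [kc _] := H n x Kx; exact: lt_le_trans kc.
have ks n x : K x -> k <= s n x by move=> Kx; have [] := H n x Kx.
have s0 n x : K x -> 0 < s n x by move=> Kx; exact: lt_le_trans (ks n x Kx).
have s2 n x : K x -> s n x ^+ 2 = - discr2 (a n x) (b n x) (c n x) (d n x).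
  move=> Kx; rewrite sqr_sqrtr// leNgt; apply/negP => /ltW H'.
  by have := s0 n x Kx; rewrite /s ler0_sqrtr// ltxx.
have Re0 := regular0 r_gt0 Re; have Rf0 := regular0 r_gt0 Rf.
have RcV : regular r K 0 J.+1 (fun n x => (c n x)^-1).
  by apply: (regularV r_gt0 k0) Rc => n x Kx; have [kc _] := H n x Kx;
    rewrite gtr0_norm ?c0.
have Rs : regular r K 0 J.+1 s.
  apply: (regular_sqrt r_gt0 (d := k ^+ 2)); first exact: exprn_gt0.
    move=> n x Kx; rewrite -s2//; apply: lerXn2r; rewrite ?ks// nnegrE.
      exact: ltW.
    exact/ltW/s0.
  apply: regularN => //; apply: regularD => //.
    by apply: regular_ext (regularMl Re0 Re0) => n x _; rewrite expr2.
  by apply: regularMl => //; exact: regularZ.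
have R2 : regular r K 0 J.+1 (fun n x => (s n x + 2 * c n x)^-1).
  apply: (regularV r_gt0 k0).
    move=> n x Kx; rewrite gtr0_norm ?addr_gt0 ?mulr_gt0 ?s0 ?c0//.
    by rewrite ler_wpDr ?ks// mulr_ge0// ltW// c0.
  by apply: regularD => //; exact: regularZ.
have Rbe : regular r K m J.+1 (fun n x => (d n x - a n x) / (2 * c n x)).
  apply: regular_ext (regularMl (regularZ r_gt0 (1 / 2) RcV) Re) => n x Kx.
  by field; rewrite gt_eqF ?c0.
have Rga : regular r K m J.+1 (fun n x => s n x / (2 * c n x) - 1).
  have Rn : regular r K m J.+1
      (fun n x => - (d n x - a n x) ^+ 2 - 4 * c n x * (b n x + c n x)).
    apply: regular_ext (regularB r_gt0 (regularMl (regularN r_gt0 Re0) Re)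
       (regularMl (regularZ r_gt0 4 Rc) Rf)) => n x _; ring.
  apply: regular_ext (regularMl (regularMl (regularZ r_gt0 (1 / 2) RcV) R2) Rn) => n x Kx.
  have := s2 n x Kx; have := s0 n x Kx; have := c0 n x Kx.
  rewrite /discr2; move: (s n x) => t h1 h2 ht.
  have -> : - (d n x - a n x) ^+ 2 - 4 * c n x * (b n x + c n x) = t ^+ 2 - 4 * c n x ^+ 2.
    by rewrite ht; ring.
  field; rewrite !gt_eqF// addr_gt0// mulr_gt0//.
apply: (energy_converges_conj conv (k := k) _ k0 _ _ _ orb).
- by split; exact: regular_pred.
- move=> n x Kx; have [kc ks'] := H n x Kx; split => //.
  by rewrite gtr0_norm ?c0.
- by have := regular_diff Rbe.
- apply: regular_ext (regular_diff Rga) => n x _.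
  by rewrite /s; ring.
Qed.

Lemma energy_converges_all J m : (0 < m)%N -> (m + J)%N = r -> energy_converges m J.
Proof.
elim: J m => [|J IH] m m0; first by rewrite addn0 => ->; exact: energy_converges_base.
by rewrite addnS -addSn => mJ; apply: energy_converges_step => //; exact: IH.
Qed.

(** The first conjugation needs no smallness at all: it produces a defect of
    order [1] from a regular sequence, and [r - 1] further ones make the defect
    summable. *)
Lemma elliptic_energy_converges a b c d u v tau (k : R) :
  [/\ regular r K 0 r a, regular r K 0 r b, regular r K 0 r c & regular r K 0 r d] ->
  0 < k ->
  (forall n x, K x -> k <= `|c n x| /\
     k <= Num.sqrt (- discr2 (a n x) (b n x) (c n x) (d n x))) ->
  orbit a b c d u v tau ->
  nonzero_ulimit
   (fun n x => energy (a n x) (b n x) (c n x) (d n x) (u n x) (v n x) (tau n x)).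
Proof.
have [J rJ] : exists J, r = J.+1 by case: r r_gt0 => // r' _; exists r'.
rewrite {2 4 6 8}rJ => -[Ra Rb Rc Rd] k0 H orb.
have conv : energy_converges 1 J by apply: energy_converges_all => //; rewrite add1n.
pose s n x := Num.sqrt (- discr2 (a n x) (b n x) (c n x) (d n x)).
have ks n x : K x -> k <= s n x by move=> Kx; have [] := H n x Kx.
have s0 n x : K x -> 0 < s n x by move=> Kx; exact: lt_le_trans (ks n x Kx).
have s2 n x : K x -> s n x ^+ 2 = - discr2 (a n x) (b n x) (c n x) (d n x).
  move=> Kx; rewrite sqr_sqrtr// leNgt; apply/negP => /ltW H'.
  by have := s0 n x Kx; rewrite /s ler0_sqrtr// ltxx.
have c0 n x : K x -> c n x != 0.
  by move=> Kx; have [kc _] := H n x Kx; rewrite -normr_gt0 (lt_le_trans k0).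
have Re := regularB r_gt0 Rd Ra.
have RcV : regular r K 0 J.+1 (fun n x => (c n x)^-1).
  by apply: (regularV r_gt0 k0) Rc => n x Kx; have [] := H n x Kx.
have Rs : regular r K 0 J.+1 s.
  apply: (regular_sqrt r_gt0 (d := k ^+ 2)); first exact: exprn_gt0.
    move=> n x Kx; rewrite -s2//; apply: lerXn2r; rewrite ?ks// nnegrE.
      exact: ltW.
    exact/ltW/s0.
  apply: regularN => //; apply: regularD => //.
    by apply: regular_ext (regularMl Re Re) => n x _; rewrite expr2.
  by apply: regularMl => //; exact: regularZ.
apply: (energy_converges_conj conv (k := k) _ k0 H _ _ orb).
- by split; exact: regular_pred.
- have : regular r K 0 J.+1 (fun n x => (d n x - a n x) / (2 * c n x)).
    apply: regular_ext (regularMl (regularZ r_gt0 (1 / 2) RcV) Re) => n x Kx.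
    by field; rewrite c0.
  by move=> /regular_diff.
- have : regular r K 0 J.+1 (fun n x => s n x / (2 * c n x)).
    apply: regular_ext (regularMl (regularZ r_gt0 (1 / 2) RcV) Rs) => n x Kx.
    by field; rewrite c0.
  by move=> /regular_diff.
Qed.

End ConformalReduction.

(** * Transfer matrices as polynomial matrices *)
Section TransferPolynomials.
Context {R : realType}.
Implicit Types (a b : nat -> R) (w : {poly R} * {poly R}).

(** [N] steps of the three-term recurrence from index [n], applied to a pair of
    polynomials [(p_(n-1), p_n)]; on the coordinate vectors this gives the entries
    of the [N]-step transfer matrix as polynomials. *)
Fixpoint transport a b (n : nat) w (N : nat) : {poly R} * {poly R} :=
  if N is N'.+1 then
    let w' := transport a b n w N' in
    (w'.2, (a (n + N')%N)^-1 *: (('X - (b (n + N')%N)%:P) * w'.2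
                              - a (n + N')%N.-1 *: w'.1))
  else w.

Definition entry a b n N (s t : 'I_2) : {poly R} :=
  let w := transport a b n (if t == 0 then (1, 0) else (0, 1)) N in
  if s == 0 then w.1 else w.2.

Lemma transport_lin a b n N w :
  transport a b n w N =
    (entry a b n N 0 0 * w.1 + entry a b n N 0 1 * w.2,
     entry a b n N 1 0 * w.1 + entry a b n N 1 1 * w.2).
Proof.
elim: N => [|N IH]; rewrite /entry/=.
  by rewrite !mul1r !mul0r addr0 add0r; case: w.
rewrite IH /entry/=; congr pair.
set e00 := (transport _ _ _ (1, 0) _).1; set e10 := (transport _ _ _ (1, 0) _).2.
set e01 := (transport _ _ _ (0, 1) _).1; set e11 := (transport _ _ _ (0, 1) _).2.
rewrite -!mul_polyC; ring.
Qed.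

Lemma transport_orth_poly a b n N : (0 < n)%N ->
  transport a b n (orth_poly a b n.-1, orth_poly a b n) N =
  (orth_poly a b (n + N).-1, orth_poly a b (n + N)).
Proof.
case: n => // n _; elim: N => [|N IH]; first by rewrite addn0.
by rewrite [LHS]/= IH !addnS !addSn.
Qed.

Lemma big_ord2 (V : nmodType) (F : 'I_2 -> V) : \sum_(i < 2) F i = F 0 + F 1.
Proof.
rewrite big_ord_recl big_ord1; congr (_ + F _); exact: val_inj.
Qed.

Lemma ord2P (q : 'I_2) : q = 0 \/ q = 1.
Proof. by case: q => -[|[|]]// ?; [left|right]; exact: val_inj. Qed.

Lemma step_mxS a b N n x :
  step_mx a b N.+1 n x = transfer_mx a b (n + N) x *m step_mx a b N n x.
Proof.
rewrite /step_mx addnS /index_iota subSn ?leq_addr// addKn.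
by rewrite -(addn1 N) iotaD rev_cat/= big_cons.
Qed.

Lemma step_mxE a b N n x s t : step_mx a b N n x s t = (entry a b n N s t).[x].
Proof.
elim: N s t => [|N IH] s t.
  rewrite /step_mx addn0 /index_iota subnn/= big_nil /entry/= mxE.
  by case: (ord2P s) => ->; case: (ord2P t) => ->; rewrite /= hornerE.
rewrite step_mxS mxE big_ord2 !IH !mxE /= /entry/=.
case: (ord2P s) => ->; rewrite /=; first by rewrite mul0r add0r mul1r.
by rewrite !hornerE/=; ring.
Qed.

Lemma entry_det a b n N : (0 < n)%N -> (forall k, a k != 0) ->
  entry a b n N 0 0 * entry a b n N 1 1 - entry a b n N 0 1 * entry a b n N 1 0
  = (a n.-1 / a (n + N).-1)%:P.
Proof.
move=> n0 a0; elim: N => [|N IH].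
  by rewrite /entry/= addn0 divff// mulr0 subr0 mul1r.
have -> : (a n.-1 / a (n + N.+1).-1)%:P =
   (a (n + N).-1 / a (n + N)%N)%:P * (a n.-1 / a (n + N).-1)%:P.
  by rewrite -polyCM addnS/=; congr polyC; field; rewrite !a0.
rewrite -IH /entry/=.
set e00 := (transport _ _ _ (1, 0) _).1; set e10 := (transport _ _ _ (1, 0) _).2.
set e01 := (transport _ _ _ (0, 1) _).1; set e11 := (transport _ _ _ (0, 1) _).2.
by rewrite -!mul_polyC polyCM; ring.
Qed.

Lemma size_transport_step a b m (y z : {poly R}) (k : nat) :
  (size y <= k.+1)%N -> (size z <= k)%N ->
  (size ((a m)^-1 *: (('X - (b m)%:P) * z - a m.-1 *: y)) <= k.+1)%N.
Proof.
move=> sy sz; apply: leq_trans (size_scale_leq _ _) _.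
apply: leq_trans (size_polyD _ _) _; rewrite geq_max size_polyN.
apply/andP; split; last exact: leq_trans (size_scale_leq _ _) sy.
apply: leq_trans (size_polyMleq _ _) _; rewrite size_XsubC.
by rewrite addSn add1n/= ltnS.
Qed.

Lemma size_entry_col0 a b n N :
  (size (entry a b n N 1%R 0%R) <= N)%N /\ (size (entry a b n N 0%R 0%R) <= maxn 1 N)%N.
Proof.
elim: N => [|N [IH1 IH2]]; first by rewrite /entry/= size_poly0 size_poly1.
split; last by apply: leq_trans IH1 _; rewrite leq_max leqnSn orbT.
rewrite {1}/entry/=; apply: size_transport_step => //.
by apply: leq_trans IH2 _; rewrite geq_max leqnSn.
Qed.

Lemma size_entry_col1 a b n N :
  [/\ (size (entry a b n N 0%R 1%R) <= N)%N, (size (entry a b n N 1%R 1%R) <= N.+1)%N &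
     (entry a b n N 1 1)`_N = \prod_(k < N) (a (n + k)%N)^-1].
Proof.
elim: N => [|N [IH1 IH2 IH3]].
  by rewrite /entry/= size_poly0 size_poly1 big_ord0 coef1.
split; first exact: IH2.
  rewrite {1}/entry/=; apply: size_transport_step; last exact: IH2.
  by apply: leq_trans IH1 _; rewrite !leqW.
rewrite big_ord_recr/= -IH3 {1}/entry/= coefZ mulrC; congr (_ * _).
rewrite coefB coefZ mulrBl coefB coefXM/= coefCM.
rewrite (nth_default 0 (s := (transport a b n (0,1) N).1)); last exact: leqW.
rewrite mulr0 subr0 [X in _ - _ * X]nth_default ?mulr0 ?subr0//.
Qed.

(** The bounded degree is what lets information pass from one interval to all
    intervals. *)
Lemma size_entry a b n N s t : (size (entry a b n N s t) <= N.+1)%N.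
Proof.
have [h1 h2] := size_entry_col0 a b n N; have [h3 h4 _] := size_entry_col1 a b n N.
case: (ord2P s) => ->; case: (ord2P t) => -> //.
- by apply: leq_trans h2 _; rewrite geq_max/= leqnSn.
- exact: leqW.
- exact: leqW.
Qed.

End TransferPolynomials.

(** * Extension of the hypotheses to larger intervals *)
Section PolynomialExtension.
Context {R : realType}.
Implicit Types (p q : {poly R}) (c d : R).

Lemma poly_bounded p c d : exists2 B : R, 0 <= B &
  forall x, c <= x <= d -> `|p.[x]| <= B.
Proof.
exists (\sum_(i < size p) `|p`_i| * (`|c| + `|d|) ^+ i).
  by apply: sumr_ge0 => i _; rewrite mulr_ge0// exprn_ge0// addr_ge0.
move=> x /andP[cx xd]; rewrite horner_coef.
apply: le_trans (ler_norm_sum _ _ _) _; apply: ler_sum => i _.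
rewrite normrM normrX; apply: ler_wpM2l => //; apply: lerXn2r.
- by rewrite nnegrE.
- by rewrite nnegrE addr_ge0.
have := ler_norm c; have := ler_norm d; have := ler_norm (- c).
have := ler_norm (- d); rewrite !normrN ler_norml => ? ? ? ?.
by apply/andP; split; lra.
Qed.

Definition node c d (k : nat) : R := c + (d - c) / k.+1%:R.

Lemma node_inj c d : c < d -> injective (node c d).
Proof.
move=> cd i j /addrI /mulfI; rewrite gt_eqF ?subr_gt0// => /(_ isT) /invr_inj.
by move=> /eqP; rewrite eqr_nat => /eqP[].
Qed.

Lemma node_in c d k : c < d -> c <= node c d k <= d.
Proof.
move=> cd; have cd0 : 0 < d - c by rewrite subr_gt0.
rewrite /node lerDl divr_ge0 ?(ltW cd0)//=.
by rewrite -lerBrDl ler_pdivrMr// ler_peMr ?ler1n// ltW.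
Qed.

(** By Lagrange interpolation at [n + 1] points of the smaller interval. *)
Lemma poly_extend n c d c' d' : c < d -> exists2 C : R, 0 <= C &
  forall p (M : R), (size p <= n.+1)%N ->
    (forall x, c <= x <= d -> `|p.[x]| <= M) ->
    forall x, c' <= x <= d' -> `|p.[x]| <= C * M.
Proof.
move=> cd; pose l (i : 'I_n.+1) := (tnth (lagrange n.+1 (node c d)) i : {poly R}).
have Bex (i : 'I_n.+1) : exists B : R, 0 <= B /\ forall x, c' <= x <= d' -> `|(l i).[x]| <= B.
  by have [B B0 HB] := poly_bounded (l i) c' d'; exists B.
have [B HB] := choice Bex.
exists (\sum_i B i); first by apply: sumr_ge0 => i _; have [] := HB i.
move=> p M sp pM x xcd.
rewrite (lagrange_gen (n := n.+1) (ltn0Sn _) (node_inj cd) sp) horner_sum.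
apply: le_trans (ler_norm_sum _ _ _) _; rewrite mulr_suml; apply: ler_sum => i _.
rewrite hornerM hornerC normrM mulrC.
have [Bi0 HBi] := HB i.
by apply: ler_pM => //; [exact: HBi|apply: pM; exact: node_in].
Qed.

(** Only the convergence at [n + 1] points is used, and the limit polynomial does
    not depend on the interval: the discriminants converge uniformly on a
    neighbourhood of [K], and there the endpoints of [K] are interior points. *)
Lemma poly_pointwise_ucvg n c d (p : nat -> {poly R}) : c < d ->
  (forall k, (size (p k) <= n.+1)%N) ->
  (forall x, c <= x <= d -> cvgn (fun k => (p k).[x])) ->
  exists q : {poly R}, forall c' d',
    ucvg `[c', d']%classic (fun k x => (p k).[x]) (fun x => q.[x]).
Proof.
move=> cd sp cvgp; pose l (i : 'I_n.+1) := (tnth (lagrange n.+1 (node c d)) i : {poly R}).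
pose y (i : 'I_n.+1) := limn (fun k => (p k).[node c d i]).
exists (\sum_i (y i)%:P * l i) => c' d' eps eps0.
have Bex (i : 'I_n.+1) : exists B : R, 0 <= B /\ forall x, c' <= x <= d' -> `|(l i).[x]| <= B.
  by have [B B0 HB] := poly_bounded (l i) c' d'; exists B.
have [B HB] := choice Bex.
pose S := \sum_i B i + 1.
have S0 : 0 < S.
  by rewrite /S ltr_wpDl//; apply: sumr_ge0 => i _; have [] := HB i.
have N (i : 'I_n.+1) : exists N, forall k, (N <= k)%N ->
    `|(p k).[node c d i] - y i| <= eps / S.
  have /cvgrPdist_lt/(_ _ (divr_gt0 eps0 S0))[N _ H] := cvgp _ (node_in i cd).
  by exists N => k Nk; rewrite distrC; apply/ltW/H.
have [M HM] := choice N.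
exists (\max_i M i)%N => k x Mk /=; rewrite in_itv/= => xcd.
rewrite {1}(lagrange_gen (n := n.+1) (ltn0Sn _) (node_inj cd) (sp k)).
rewrite !horner_sum -sumrB; apply: le_trans (ler_norm_sum _ _ _) _.
apply: (@le_trans _ _ (\sum_i eps / S * B i)).
  apply: ler_sum => i _; rewrite !hornerM !hornerC -mulrBl normrM.
  have [Bi0 HBi] := HB i; apply: ler_pM => //; last exact: HBi.
  by apply: HM; apply: leq_trans Mk; exact: leq_bigmax.
rewrite -mulr_sumr mulrAC ler_pdivrMr//; apply: ler_wpM2l; first exact: ltW.
by rewrite /S lerDl.
Qed.

End PolynomialExtension.

Section DclassExtension.
Context {R : realType}.
Implicit Types (a b : nat -> R).

Fixpoint pdiff (j : nat) (P : nat -> {poly R}) (n : nat) : {poly R} :=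
  if j is j'.+1 then pdiff j' P n.+1 - pdiff j' P n else P n.

Lemma size_pdiff j (P : nat -> {poly R}) m : (forall n, (size (P n) <= m)%N) ->
  forall n, (size (pdiff j P n) <= m)%N.
Proof.
move=> sP; elim: j => [|j IH] n //=.
by apply: leq_trans (size_polyD _ _) _; rewrite size_polyN geq_max !IH.
Qed.

Lemma pdiffSr j P n : pdiff j.+1 P n = pdiff j (fun n => P n.+1 - P n) n.
Proof. by elim: j n => [//|j IH] n; rewrite [RHS]/= -!IH. Qed.

Lemma regular_pdiff (r : nat) K m J (P : nat -> {poly R}) :
  (forall j, (j <= J)%N -> order_ge r K (m + j) (fun n x => (pdiff j P n).[x])) ->
  regular r K m J (fun n x => (P n).[x]).
Proof.
elim: J m P => [|J IH] m P H; first by have := H 0 isT; rewrite addn0.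
split; first by have := H 0 isT; rewrite addn0.
have : regular r K m.+1 J (fun n x => (P n.+1 - P n).[x]).
  apply: (IH m.+1 (fun n => P n.+1 - P n)) => j jJ; have := H j.+1 jJ.
  rewrite addnS -addSn; apply: order_ge_ext => n x _.
  by rewrite pdiffSr.
by apply: regular_ext => n x _; rewrite hornerD hornerN.
Qed.

Lemma mx_norm_entry (A : 'M[R]_2) s t : `|A s t| <= `|A|.
Proof.
rewrite /Num.norm/= mx_normrE.
exact: (le_bigmax (0 : R) (fun ij : 'I_2 * 'I_2 => `|A ij.1 ij.2|) (s, t)).
Qed.

Lemma fdiff_entry j a b N i n x s t :
  fdiff j (fun n => step_mx a b N (n * N + i)) n x s t =
  (pdiff j (fun n => entry a b (n * N + i) N s t) n).[x].
Proof.
elim: j n => [|j IH] n /=; first exact: step_mxE.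
by rewrite hornerD hornerN -!IH !mxE.
Qed.

Lemma pdiff_shift j (P : nat -> {poly R}) n : pdiff j (fun n => P n.+1) n = pdiff j P n.+1.
Proof. by elim: j n => [|j IH] n //=; rewrite !IH. Qed.

(** The iterated differences are polynomials of degree at most [N] too, so their
    suprema on the two intervals are comparable. The l^r sequence for the j-th
    difference is the j-th root of its supremum. *)
Lemma Dclass_regular a b N r i c d c' d' s t : (0 < r)%N -> c < d ->
  Dclass r `[c, d]%classic (fun n => step_mx a b N (n * N + i)) ->
  regular r `[c', d']%classic 0 r
    (fun n x => (entry a b (n.+1 * N + i) N s t).[x]).
Proof.
move=> r0 cd [_ _ [M HM] HD].
pose P n := entry a b (n * N + i) N s t.
have [C C0 HC] := poly_extend N c' d' cd.
have sP j n : (size (pdiff j P n) <= N.+1)%N.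
  by apply: size_pdiff => {}n; exact: size_entry.
apply: (regular_pdiff (P := fun n => P n.+1)) => j jr; rewrite add0n.
case: j jr => [|j] jr.
  apply: (bounded_order_ge r0 (M := C * M)) => n x /=; rewrite in_itv/=.
  apply: HC; first exact: (sP 0%N).
  move=> y ycd; rewrite -step_mxE; apply: le_trans (mx_norm_entry _ _ _) _.
  by apply: HM => //=; rewrite in_itv.
have := HD j.+1 jr; set p := (r%:R / _).
pose sg n := sup_on `[c, d]%classic
   (fun x => `|fdiff j.+1 (fun n => step_mx a b N (n * N + i)) n x|%R).
rewrite -/(sg _) => Hs.
have p0 : 0 < p by rewrite divr_gt0 ?ltr0n.
have cK : `[c, d]%classic c by rewrite /= in_itv/= lexx ltW.
have sg_ge n x : c <= x <= d ->
  (`|fdiff j.+1 (fun n => step_mx a b N (n * N + i)) n x|%R%:E <= sg n)%E.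
  by move=> xcd; apply: ereal_sup_ubound; exists x => //=; rewrite in_itv.
have sg0 n : (0 <= sg n)%E.
  by apply: le_trans (sg_ge n c _); rewrite ?lee_fin// lexx ltW.
have pge n : (0 <= sg n `^ p)%E by exact: poweR_ge0.
have part k : (\sum_(1 <= n < k) sg n `^ p < +oo)%E.
  by apply: le_lt_trans Hs; apply: nneseries_lim_ge.
have sgfin n : (0 < n)%N -> sg n \is a fin_num.
  move=> n0; rewrite ge0_fin_numE//; apply: (lty_poweRy (r := p)); first by rewrite gt_eqF.
  have : (sg n `^ p <= \sum_(1 <= k < n.+1) sg k `^ p)%E.
    by rewrite big_nat_recr//= leeDr// sume_ge0.
  by move=> h; exact: le_lt_trans h (part n.+1).
pose u n := fine (sg n.+1).
have uE n : sg n.+1 = (u n)%:E by rewrite fineK// sgfin.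
have u0 n : 0 <= u n by rewrite fine_ge0.
exists (fun n => u n `^ j.+1%:R^-1), C; split.
- by move=> n; exact: powR_ge0.
- set T := (\sum_(_ <= _ <oo) _)%E in Hs.
  have Tfin : T \is a fin_num.
    by rewrite ge0_fin_numE//; apply: nneseries_ge0 => n _ _; exact: poweR_ge0.
  exists (fine T) => k; rewrite -lee_fin fineK//.
  apply: le_trans (nneseries_lim_ge (u_ := fun n => (sg n `^ p)%E) (P := xpredT) k.+1 _) => //.
  rewrite big_add1/= big_mkord -sumEFin le_eqVlt; apply/orP; left; apply/eqP.
  apply: eq_bigr => n _; rewrite uE poweR_EFin; congr EFin.
  by rewrite -powR_mulrn ?powR_ge0// -powRrM mulrC.
move=> n x; rewrite /= in_itv/= => xcd.
rewrite -[pdiff j _ _ - _]/(pdiff j.+1 (fun n => P n.+1) n) (pdiff_shift j.+1).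
apply: HC xcd => // y ycd.
rewrite -powR_mulrn ?powR_ge0// -powRrM mulVf ?pnatr_eq0// powRr1//.
rewrite -fdiff_entry -lee_fin -uE; apply: le_trans (sg_ge n.+1 y ycd).
by rewrite lee_fin; exact: mx_norm_entry.
Qed.

End DclassExtension.

(** * Orthogonal polynomials and Gauss quadrature *)
Section ChristoffelDarboux.
Variable S : comNzRingType.
Variables (A B P Q : nat -> S) (z w : S).

(** Over any commutative ring, so that the identity below can be used for
    polynomials, for their values, and at complex points. *)
Definition jacobi_sol (P : nat -> S) (z : S) : Prop :=
  A 0 * P 1 = (z - B 0) * P 0 /\
  forall n, A n.+1 * P n.+2 = (z - B n.+1) * P n.+1 - A n * P n.

Lemma christoffel_darboux n : jacobi_sol P z -> jacobi_sol Q w ->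
  (z - w) * \sum_(j < n.+1) P j * Q j = A n * (P n.+1 * Q n - P n * Q n.+1).
Proof.
move=> [P0 PS] [Q0 QS]; elim: n => [|n IH].
  have -> : A 0 * (P 1 * Q 0 - P 0 * Q 1) = A 0 * P 1 * Q 0 - P 0 * (A 0 * Q 1).
    by ring.
  by rewrite big_ord1 P0 Q0; ring.
have -> : A n.+1 * (P n.+2 * Q n.+1 - P n.+1 * Q n.+2) =
  A n.+1 * P n.+2 * Q n.+1 - P n.+1 * (A n.+1 * Q n.+2) by ring.
by rewrite big_ord_recr/= mulrDr IH PS QS; ring.
Qed.

End ChristoffelDarboux.

Local Arguments orth_poly : simpl never.

Section OrthogonalPolynomials.
Context {R : realType}.
Variables a b : nat -> R.
Hypothesis a_gt0 : forall n, 0 < a n.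
Local Notation p := (orth_poly a b).

Let a0 n : a n != 0. Proof. by rewrite gt_eqF. Qed.

Lemma orth_polyS n :
  p n.+2 = (a n.+1)^-1 *: (('X - (b n.+1)%:P) * p n.+1 - a n *: p n).
Proof. by []. Qed.

Lemma orth_poly_jacobi : jacobi_sol (fun n => (a n)%:P) (fun n => (b n)%:P) p 'X.
Proof.
split=> [|n].
  by rewrite mul_polyC scalerA divff// scale1r mulr1.
by rewrite orth_polyS !mul_polyC scalerA divff// scale1r.
Qed.

Lemma orth_poly_jacobi_at x : jacobi_sol a b (fun n => (p n).[x]) x.
Proof.
split=> [|n]; first by rewrite /= !hornerE/= divff// mul1r.
have := orth_poly_rec b x (a0 n.+1); set p2 := (p n.+2).[x] => H.
by rewrite mulrBl -H; ring.
Qed.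

Lemma orth_poly_jacobi_cst x : jacobi_sol (fun n => (a n)%:P) (fun n => (b n)%:P)
  (fun n => ((p n).[x])%:P) x%:P.
Proof.
have [h0 h] := orth_poly_jacobi_at x; split=> [|n].
  by rewrite -polyCM h0 polyCM polyCB.
by rewrite -polyCM h polyCB !polyCM polyCB.
Qed.

Lemma size_orth_poly n : size (p n) = n.+1 /\ lead_coef (p n) = \prod_(k < n) (a k)^-1.
Proof.
elim: n {-2}n (leqnn n) => [|m IH] [|[|n]] //.
- by move=> _; rewrite size_poly1 lead_coef1 big_ord0.
- by move=> _; rewrite size_poly1 lead_coef1 big_ord0.
- move=> _; rewrite big_ord1 /= size_scale ?invr_eq0// size_XsubC.
  by rewrite lead_coefZ lead_coefXsubC mulr1.
move=> nm; have [s1 l1] := IH n.+1 nm; have [s0 _] := IH n (ltnW nm).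
have s2 : size (('X - (b n.+1)%:P) * p n.+1) = n.+3.
  by rewrite size_monicM ?monicXsubC -?size_poly_gt0 ?s1// size_XsubC.
have lt : (size (- (a n *: p n))%R < size (('X - (b n.+1)%:P) * p n.+1)%R)%N.
  by rewrite size_polyN s2 size_scale// s0 ltnS leqW.
rewrite orth_polyS size_scale ?invr_eq0// size_polyDl// s2; split=> //.
rewrite lead_coefZ lead_coefDl// lead_coef_monicM ?monicXsubC// l1.
by rewrite [RHS]big_ord_recr/= mulrC.
Qed.

Definition kernel (n : nat) (x y : R) : R := \sum_(j < n) (p j).[x] * (p j).[y].

Lemma kernel_gt0 n x : 0 < kernel n.+1 x x.
Proof.
rewrite /kernel big_ord_recl [p _]/(1 : {poly R}) hornerE mulr1 ltr_pwDl//.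
by apply: sumr_ge0 => j _; rewrite -expr2 sqr_ge0.
Qed.

Lemma kernelE n x y : (x - y) * kernel n.+1 x y =
  a n * ((p n.+1).[x] * (p n).[y] - (p n).[x] * (p n.+1).[y]).
Proof.
exact: christoffel_darboux (orth_poly_jacobi_at x) (orth_poly_jacobi_at y).
Qed.

(** The polynomial identity at a formal first variable, differentiated. *)
Lemma kernel_confluent n x : kernel n.+1 x x =
  a n * ((p n.+1)^`().[x] * (p n).[x] - (p n)^`().[x] * (p n.+1).[x]).
Proof.
have E : ('X - x%:P) * (\sum_(j < n.+1) (p j).[x] *: p j) =
    a n *: ((p n).[x] *: p n.+1 - (p n.+1).[x] *: p n).
  have := christoffel_darboux n orth_poly_jacobi (orth_poly_jacobi_cst x).
  have -> : \sum_(j < n.+1) (p j).[x] *: p j = \sum_(j < n.+1) p j * ((p j).[x])%:P.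
    by apply: eq_bigr => j _; rewrite mulrC mul_polyC.
  by move=> ->; rewrite -!mul_polyC; ring.
have : (('X - x%:P) * \sum_(j < n.+1) (p j).[x] *: p j)^`().[x] =
   (a n *: ((p n).[x] *: p n.+1 - (p n.+1).[x] *: p n))^`().[x] by rewrite E.
rewrite derivM derivXsubC mul1r hornerD hornerM hornerXsubC subrr mul0r addr0.
rewrite derivZ hornerZ derivB !derivZ hornerD hornerN !hornerZ => H.
rewrite [_^`().[x] * _]mulrC [(p n)^`().[x] * _]mulrC -H horner_sum.
by apply: eq_bigr => j _; rewrite hornerZ.
Qed.

Lemma jacobi_sol_morph (S T : comNzRingType) (f : {rmorphism S -> T}) A B P z :
  jacobi_sol A B P z -> jacobi_sol (f \o A) (f \o B) (f \o P) (f z).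
Proof.
move=> [h0 h]; split=> [|n] /=; first by rewrite -!rmorphM h0 rmorphM rmorphB.
by rewrite -!rmorphM h rmorphB !rmorphM rmorphB.
Qed.

(** Christoffel-Darboux at [z] and its conjugate: the right-hand side vanishes at
    a root, whereas the sum on the left is at least [1]. *)
Lemma orth_poly_roots_real n (z : R[i]) :
  root (map_poly (real_complex R) (p n.+1)) z -> z \is Num.real.
Proof.
set rc := real_complex R => rz.
have rcr x : rc x \is Num.real by apply/complex_realP; exists x.
pose ev w (q : {poly R}) := (map_poly rc q).[w].
have evz w (q : {poly R}) : ev w q = horner_eval w (map_poly rc q) by [].
have evC q : ev z^* q = (ev z q)^*.
  rewrite /ev -horner_map/= -map_poly_comp; congr (_.[_]); apply: eq_map_poly => x /=.
  by apply/esym/CrealP.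
have J w : jacobi_sol (rc \o a) (rc \o b) (fun n => ev w (p n)) w.
  have := jacobi_sol_morph (horner_eval w \o map_poly rc) orth_poly_jacobi.
  rewrite /= horner_evalE map_polyX hornerX => -[h0 h]; split=> [|k].
    move: h0; rewrite /= !horner_evalE !map_polyC !hornerC => ->; congr (_ * _).
    by rewrite /ev -[p 0]/(1%:P : {poly R}) map_polyC hornerC.
  by have := h k; rewrite /= !horner_evalE !map_polyC !hornerC.
have := christoffel_darboux n (J z) (J z^*); rewrite !evC.
have -> : ev z (p n.+1) = 0 by apply/rootP.
rewrite conjC0 mul0r mulr0 subr0 mulr0 => /eqP; rewrite mulf_eq0 => /orP[|].
  by rewrite subr_eq0 eq_sym => /eqP zz; apply/CrealP.
rewrite big_ord_recl gt_eqF// ltr_pwDl//.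
  have e1 w : ev w (p (@ord0 n)) = 1.
    by rewrite /ev -[p _]/(1%:P : {poly R}) map_polyC hornerC.
  by rewrite !e1 mulr1.
by apply: sumr_ge0 => j _; rewrite evC; exact: mul_conjC_ge0.
Qed.

(** The roots are real by the above, and simple because the confluent kernel is
    positive. *)
Lemma orth_poly_nodes M : exists rs : seq R,
  [/\ uniq rs, size rs = M & forall x, x \in rs -> root (p M) x].
Proof.
case: M => [|n]; first by exists [::].
have [sp _] := size_orth_poly n.+1.
set rc := real_complex R.
have [rC rCE] := closed_field_poly_normal (map_poly rc (p n.+1)).
have pC0 : map_poly rc (p n.+1) != 0 by rewrite map_poly_eq0 -size_poly_gt0 sp.
have lC0 : lead_coef (map_poly rc (p n.+1)) != 0 by rewrite lead_coef_eq0.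
have rr z : z \in rC -> z = rc (Re z).
  move=> zr; have : z \is Num.real.
    apply: (@orth_poly_roots_real n); rewrite rCE rootZ// root_prod_XsubC//.
  by case/complex_realP => k ->.
pose rs := map (@Re R) rC.
have rCs : rC = map rc rs.
  rewrite -map_comp -[LHS]map_id; apply/eq_in_map => z zr.
  by rewrite /= -rr.
have pE : p n.+1 = lead_coef (p n.+1) *: \prod_(x <- rs) ('X - x%:P).
  apply: (map_poly_inj rc); rewrite rCE rCs map_polyZ rmorph_prod big_map/=.
  rewrite lead_coef_map; congr (_ *: _).
  by apply: eq_bigr => x _; rewrite rmorphB/= map_polyX map_polyC.
have rt x : x \in rs -> root (p n.+1) x.
  move=> xr; rewrite pE rootZ ?lead_coef_eq0 -?size_poly_gt0 ?sp//.
  by rewrite root_prod_XsubC.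
have ss : size rs = n.+1.
  have := sp; rewrite {1}pE size_scale ?lead_coef_eq0 -?size_poly_gt0 ?sp//.
  by rewrite size_prod_XsubC => -[].
exists rs; split=> //.
apply/negPn/negP => nu.
have [x xr [q qE]] : exists2 x, x \in rs &
    exists q, \prod_(x <- rs) ('X - x%:P) = ('X - x%:P) * (('X - x%:P) * q).
  clear -nu; elim: rs nu => // x rs IH /=; rewrite negb_and negbK => /orP[xrs|].
    exists x; first by rewrite mem_head.
    exists (\prod_(y <- rem x rs) ('X - y%:P)).
    by rewrite big_cons (perm_big _ (perm_to_rem xrs)) big_cons.
  move=> /IH[y yrs [q qE]]; exists y; first by rewrite in_cons yrs orbT.
  by exists (('X - x%:P) * q); rewrite big_cons qE; ring.
have d0 : (p n.+1)^`().[x] = 0.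
  rewrite pE qE derivZ derivM hornerZ hornerD !hornerM hornerXsubC subrr.
  by rewrite derivM hornerD !hornerM hornerXsubC subrr !(mul0r, mulr0, addr0).
have := kernel_confluent n x; rewrite d0 (rootP (rt x xr)) mul0r mulr0 subr0 mulr0.
by move=> k0; have := kernel_gt0 n x; rewrite k0 ltxx.
Qed.

Definition nodes M : seq R := projT1 (cid (orth_poly_nodes M)).

Lemma nodesP M : [/\ uniq (nodes M), size (nodes M) = M &
  forall x, x \in nodes M -> root (p M) x].
Proof. by rewrite /nodes; case: cid. Qed.

(** The Gauss quadrature with [M] nodes, which is the spectral measure of the
    truncated Jacobi matrix; the weights are the Christoffel numbers. *)
Definition quad (M : nat) (F : R -> R) : R :=
  \sum_(x <- nodes M) F x / kernel M x x.

Lemma quadD M F G : quad M (fun x => F x + G x) = quad M F + quad M G.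
Proof. by rewrite -big_split; apply: eq_bigr => x _; rewrite mulrDl. Qed.

Lemma quadZ M (c : R) F : quad M (fun x => c * F x) = c * quad M F.
Proof. by rewrite /quad mulr_sumr; apply: eq_bigr => x _; rewrite mulrA. Qed.

Lemma quad_sum M n (F : 'I_n -> R -> R) :
  quad M (fun x => \sum_(i < n) F i x) = \sum_(i < n) quad M (F i).
Proof.
by rewrite /quad exchange_big; apply: eq_bigr => x _; rewrite mulr_suml.
Qed.

Lemma quad_le M F G : (forall x, x \in nodes M -> F x <= G x) -> quad M F <= quad M G.
Proof.
move=> FG; rewrite /quad big_seq [leRHS]big_seq; apply: ler_sum => x xM.
apply: ler_wpM2r; last exact: FG.
case: M {FG xM} => [|M]; first by rewrite /kernel big_ord0 invr0.
by rewrite invr_ge0 ltW// kernel_gt0.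
Qed.

Lemma quad_eq M F G : (forall x, x \in nodes M -> F x = G x) -> quad M F = quad M G.
Proof.
by move=> FG; rewrite /quad big_seq [RHS]big_seq; apply: eq_bigr => x /FG ->.
Qed.

(** By Christoffel-Darboux the values of [p_0, ..., p_(M-1)] at the nodes form,
    after normalization, a matrix with orthonormal rows; its columns are then
    orthonormal too. *)
Lemma quad_orth M j l : (j < M)%N -> (l < M)%N ->
  quad M (fun x => (p j).[x] * (p l).[x]) = (j == l)%:R.
Proof.
case: M => // n jM lM.
have [un sn rn] := nodesP n.+1.
pose x (i : 'I_n.+1) := (nodes n.+1)`_i.
have xin i : x i \in nodes n.+1 by rewrite mem_nth ?sn.
have x0 i : (p n.+1).[x i] = 0 by apply/rootP/rn.
pose V : 'M[R]_n.+1 := \matrix_(i, j) (p j).[x i].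
pose W : 'M[R]_n.+1 := \matrix_(i, j) ((p j).[x i] / kernel n.+1 (x i) (x i)).
have WV : W *m V^T = 1%:M.
  apply/matrixP => i k; rewrite !mxE.
  have -> : \sum_j0 W i j0 * V^T j0 k = kernel n.+1 (x i) (x k) / kernel n.+1 (x i) (x i).
    rewrite /kernel mulr_suml; apply: eq_bigr => j0 _; rewrite !mxE; ring.
  have [->|ik] := eqVneq i k; first by rewrite divff// gt_eqF// kernel_gt0.
  have := kernelE n (x i) (x k); rewrite !x0 mul0r mulr0 subrr mulr0 => /eqP.
  rewrite mulf_eq0 subr_eq0 => /orP[|/eqP ->]; last by rewrite mul0r.
  by rewrite nth_uniq ?sn// => /eqP/val_inj ik'; rewrite ik' eqxx in ik.
have /matrixP/(_ (Ordinal jM) (Ordinal lM)) := mulmx1C WV.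
rewrite !mxE -val_eqE /= => <-.
rewrite /quad (big_nth 0) big_mkord sn; apply: eq_bigr => i _; rewrite !mxE/=.
by rewrite -/(x i); ring.
Qed.

(** The value of the last coefficient gives the leading moments exactly. *)
Lemma poly_expand n (q : {poly R}) : (size q <= n)%N ->
  exists c : nat -> R, q = \sum_(k < n) c k *: p k /\
     forall m, n = m.+1 -> c m = q`_m * \prod_(k < m) a k.
Proof.
elim: n q => [|n IH] q sq.
  exists (fun=> 0); split=> //; rewrite big_ord0; apply/eqP.
  by rewrite -size_poly_eq0 -leqn0.
have [sp lp] := size_orth_poly n.
pose e := q`_n * \prod_(k < n) a k.
have pn : (p n)`_n = \prod_(k < n) (a k)^-1 by rewrite -lp lead_coefE sp.
have sq' : (size (q - e *: p n)%R <= n)%N.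
  apply/leq_sizeP => j; rewrite leq_eqVlt => /orP[/eqP <-|nj].
    rewrite coefB coefZ pn /e -mulrA -big_split/=.
    rewrite big1 ?mulr1 ?subrr// => k _; exact: divff.
  rewrite coefB coefZ (nth_default 0 (leq_trans sq nj)) nth_default ?sp//.
  by rewrite mulr0 subr0.
have [c [qc _]] := IH _ sq'.
exists (fun k => if k == n then e else c k); split.
  rewrite big_ord_recr/= eqxx -[LHS](subrK (e *: p n)) qc; congr (_ + _).
  by apply: eq_bigr => k _; rewrite ltn_eqF.
by move=> m [<-]; rewrite eqxx.
Qed.

Lemma quad_one M : (0 < M)%N -> quad M (fun=> 1) = 1.
Proof.
move=> M0; rewrite -[RHS](quad_orth M0 M0); apply: quad_eq => x _.
by rewrite !hornerE.
Qed.

(** The recurrence at an index where [p_j(x)] is maximal in absolute value. *)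
Lemma node_bound (B : R) M x : (forall n, a n <= B) -> (forall n, `|b n| <= B) ->
  x \in nodes M -> `|x| <= 3 * B.
Proof.
move=> aB bB xM; case: M xM => [|M] xM.
  by have [_ sn _] := nodesP 0; rewrite (size0nil sn) in xM.
have [_ _ rn] := nodesP M.+1.
have /rootP xr := rn x xM.
have B0 : 0 < B by exact: lt_le_trans (a_gt0 0) (aB 0%N).
have [h0 h] := orth_poly_jacobi_at x.
pose i := [arg max_(j > (ord0 : 'I_M.+1)) `|(p j).[x]|]%O.
have imax (j : nat) : (j < M.+1)%N -> `|(p j).[x]| <= `|(p i).[x]|.
  by move=> jM; rewrite /i; case: Order.TotalTheory.arg_maxP => // k _ /(_ (Ordinal jM) isT).
have imax' (j : nat) : (j < M.+2)%N -> `|(p j).[x]| <= `|(p i).[x]|.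
  rewrite ltnS leq_eqVlt => /orP[/eqP ->|]; last exact: imax.
  by rewrite xr normr0.
have pi0 : 0 < `|(p i).[x]|.
  by apply: lt_le_trans (imax 0%N isT); rewrite !hornerE normr1.
have nb (k j : nat) : (j < M.+2)%N -> `|a k * (p j).[x]| <= B * `|(p i).[x]|.
  move=> jM; rewrite normrM (gtr0_norm (a_gt0 k)); apply: ler_pM => //.
    exact/ltW/a_gt0.
  exact: imax'.
have bb k j : (j < M.+2)%N -> `|b k * (p j).[x]| <= B * `|(p i).[x]|.
  by move=> jM; rewrite normrM; apply: ler_pM => //; exact: imax'.
rewrite -(ler_pM2r pi0) -normrM.
have := ltn_ord i; case: (nat_of_ord i) nb bb pi0 => [|k] nb bb pi0 iM.
  have -> : x * (p 0).[x] = a 0 * (p 1).[x] + b 0 * (p 0).[x] by rewrite h0; ring.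
  apply: le_trans (ler_normD _ _) _.
  have := nb 0%N 1%N isT; have := bb 0%N 0%N isT; have := mulr_gt0 B0 pi0.
  by move=> ? ? ?; lra.
have -> : x * (p k.+1).[x] = a k.+1 * (p k.+2).[x] + b k.+1 * (p k.+1).[x] + a k * (p k).[x].
  by rewrite h; ring.
apply: le_trans (ler_normD _ _) _.
have := ler_normD (a k.+1 * (p k.+2).[x]) (b k.+1 * (p k.+1).[x]).
have := nb k.+1 k.+2 iM; have := bb k.+1 k.+1 (leqW iM).
have := nb k k (ltnW (leqW iM)).
by move=> ? ? ? ?; lra.
Qed.

End OrthogonalPolynomials.

(** * Eventually periodic coefficients *)
Section EventuallyPeriodic.
Context {R : realType}.
Variables a b : nat -> R.
Hypothesis a_gt0 : forall n, 0 < a n.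
Local Notation p := (orth_poly a b).
Local Notation quad := (quad b a_gt0).

Lemma quad_poly_orth M k (q : {poly R}) : (size q <= k.+1)%N -> (k < M)%N ->
  quad M (fun x => q.[x] * (p k).[x]) = q`_k * \prod_(i < k) a i.
Proof.
move=> sq kM; have [c [qc ck]] := poly_expand b a_gt0 sq.
rewrite -(ck k erefl) (@quad_eq _ _ _ _ _ _
  (fun x => \sum_(i < k.+1) c i * ((p i).[x] * (p k).[x]))); last first.
  move=> x _; rewrite {1}qc horner_sum mulr_suml; apply: eq_bigr => i _.
  by rewrite hornerZ mulrA.
rewrite quad_sum big_ord_recr/= quadZ quad_orth// eqxx mulr1.
rewrite big1 ?add0r// => i _; rewrite quadZ quad_orth ?ltn_eqF ?mulr0//.
exact: ltn_trans kM.
Qed.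

Variables l N : nat.
Hypothesis N_gt0 : (0 < N)%N.
Hypothesis a_per : forall j, (l <= j)%N -> a (j + N)%N = a j.
Hypothesis b_per : forall j, (l < j)%N -> b (j + N)%N = b j.

Let a0 n : a n != 0. Proof. by rewrite gt_eqF. Qed.

Let a_perk k j : (l <= j)%N -> a (j + k * N)%N = a j.
Proof.
elim: k => [|k IH] lj; first by rewrite addn0.
by rewrite mulSn addnCA addnC a_per ?IH// (leq_trans lj)// leq_addr.
Qed.

Let b_perk k j : (l < j)%N -> b (j + k * N)%N = b j.
Proof.
elim: k => [|k IH] lj; first by rewrite addn0.
by rewrite mulSn addnCA addnC b_per ?IH// (leq_trans lj)// leq_addr.
Qed.

Lemma transport_per k w M :
  transport a b (l.+1 + k * N) w M = transport a b l.+1 w M.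
Proof.
elim: M => [|M IH] //=; rewrite IH.
have -> : (l.+1 + k * N + M = (l.+1 + M) + k * N)%N by rewrite addnAC.
rewrite a_perk ?b_perk ?addSn ?ltnS ?leq_addr//; last by rewrite -addSn leqW// leq_addr.
by rewrite addnAC a_perk// leq_addr.
Qed.

Local Notation E := (entry a b l.+1 N).
(** The discriminant of the period: the trace of the transfer matrix over one
    period, whose determinant is [1]. *)
Definition disc_poly : {poly R} := E 0 0 + E 1 1.
Local Notation D := disc_poly.
Let y k := p (l + k * N)%N.
Let z k := p (l.+1 + k * N)%N.

Lemma per_step k : y k.+1 = E 0 0 * y k + E 0 1 * z k /\
                   z k.+1 = E 1 0 * y k + E 1 1 * z k.
Proof.
have := @transport_orth_poly _ a b (l.+1 + k * N) N isT.
rewrite transport_per transport_lin /y /z addSn/= => -[-> ->].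
by rewrite mulSn; split; congr p; lia.
Qed.

Lemma per_det : E 0 0 * E 1 1 - E 0 1 * E 1 0 = 1.
Proof.
by rewrite entry_det//= a_per// divff.
Qed.

(** The Cayley-Hamilton identity for the transfer matrix of one period. *)
Lemma per_rec k : y k.+2 = D * y k.+1 - y k /\ z k.+2 = D * z k.+1 - z k.
Proof.
have [h1 h2] := per_step k; have [h3 h4] := per_step k.+1.
rewrite h3 h4 h1 h2 /disc_poly; have e := per_det.
by split; rewrite -[X in _ - X]mul1r -e; ring.
Qed.

(** Up to sign and weight, the determinant of [(p_l, p_(l+1))] and of the vector
    that the transfer matrix of the period makes of it. *)
Definition turan_poly : {poly R} :=
  a l *: (p l.+1 * p (l + N)%N - p l * p (l.+1 + N)%N).
Local Notation T := turan_poly.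

End EventuallyPeriodic.

Section ChebyshevU.
Context {R : realType}.

(** Chebyshev polynomials of the second kind in the variable [2 cos theta]: the
    powers of a matrix with determinant [1] and trace [y] are expressed by their
    values at [y]. *)
Fixpoint chebU (m : nat) : {poly R} :=
  match m with
  | 0 => 1
  | m'.+1 => match m' with 0 => 'X | m''.+1 => 'X * chebU m' - chebU m'' end
  end.

Lemma chebUS m : chebU m.+2 = 'X * chebU m.+1 - chebU m.
Proof. by []. Qed.

Lemma chebU_ind (P : nat -> Prop) : P 0%N -> P 1%N ->
  (forall m, P m -> P m.+1 -> P m.+2) -> forall m, P m.
Proof.
move=> P0 P1 PS m; suff : P m /\ P m.+1 by case.
by elim: m => [|m [h1 h2]]; split=> //; exact: PS.
Qed.

Lemma size_chebU m : size (chebU m) = m.+1 /\ chebU m \is monic.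
Proof.
elim/chebU_ind: m => [||m [s0 m0] [s1 m1]].
- by rewrite size_poly1 monic1.
- by rewrite size_polyX monicX.
have s2 : size ('X * chebU m.+1) = m.+3.
  by rewrite size_monicM ?monicX -?size_poly_gt0 ?s1// size_polyX.
have lt : (size (- chebU m)%R < size ('X * chebU m.+1)%R)%N.
  by rewrite size_polyN s0 s2 ltnS leqW.
rewrite chebUS; split; first by rewrite size_polyDl.
by rewrite monicE lead_coefDl// lead_coef_monicM ?monicX//; rewrite -monicE.
Qed.

Lemma chebU_expand n (q : {poly R}) : (size q <= n)%N ->
  exists c : nat -> R, q = \sum_(k < n) c k *: chebU k.
Proof.
elim: n q => [|n IH] q sq.
  exists (fun=> 0); rewrite big_ord0; apply/eqP.
  by rewrite -size_poly_eq0 -leqn0.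
have [sp mp] := size_chebU n.
have pn : (chebU n)`_n = 1 by move: mp; rewrite monicE lead_coefE sp => /eqP.
have sq' : (size (q - q`_n *: chebU n)%R <= n)%N.
  apply/leq_sizeP => j; rewrite leq_eqVlt => /orP[/eqP <-|nj].
    by rewrite coefB coefZ pn mulr1 subrr.
  rewrite coefB coefZ (nth_default 0 (leq_trans sq nj)) [(chebU n)`_j]nth_default ?sp//.
  by rewrite mulr0 subr0.
have [c qc] := IH _ sq'.
exists (fun k => if k == n then q`_n else c k).
rewrite big_ord_recr/= eqxx -[LHS](subrK (q`_n *: chebU n)) qc; congr (_ + _).
by apply: eq_bigr => k _; rewrite ltn_eqF.
Qed.

End ChebyshevU.

Section PeriodicQuadrature.
Context {R : realType}.
Variables a b : nat -> R.
Hypothesis a_gt0 : forall n, 0 < a n.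
Local Notation p := (orth_poly a b).
Local Notation quad := (quad b a_gt0).
Variables l N : nat.
Hypothesis N_gt0 : (0 < N)%N.
Hypothesis a_per : forall j, (l <= j)%N -> a (j + N)%N = a j.
Hypothesis b_per : forall j, (l < j)%N -> b (j + N)%N = b j.
Local Notation D := (disc_poly a b l N).
Local Notation T := (turan_poly a b l N).

(** Both sides satisfy the recurrence of [per_rec]. *)
Lemma turan_chebU m : T * (chebU m \Po D) =
  a l *: (p l.+1 * p (l + m.+1 * N)%N - p l * p (l.+1 + m.+1 * N)%N).
Proof.
have R_ := per_rec a_gt0 N_gt0 a_per b_per.
elim/chebU_ind: m => [||m h0 h1].
- by rewrite comp_polyC mulr1 mul1n.
- rewrite comp_polyX /turan_poly -!mul_polyC.
  have [-> ->] := R_ 0%N; rewrite !mul1n !mul0n !addn0; ring.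
rewrite chebUS comp_polyB comp_polyM comp_polyX mulrBr.
have -> : T * (D * (chebU m.+1 \Po D)) = D * (T * (chebU m.+1 \Po D)) by ring.
rewrite h0 h1; have [-> ->] := R_ m.+1; rewrite -!mul_polyC; ring.
Qed.

(** The key computation. By [turan_chebU] the integrand is a difference of products
    of a polynomial of low degree with an orthogonal polynomial of high degree, and
    only for [m = 0] and [j = N - 1] does the degree of the former reach the index
    of the latter. *)
Lemma quad_chebU m j M : (j < N)%N -> (l.+1 + m.+1 * N < M)%N ->
  quad M (fun x => x ^+ j * (chebU m).[D.[x]] * T.[x]) =
  ((m == 0%N) && (j == N.-1))%:R * \prod_(i < N) a (l + i)%N.
Proof.
move=> jN lM.
have sp n : size (p n) = n.+1 by have [] := size_orth_poly b a_gt0 n.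
have sX n : (size ('X^j * p n)%R <= n.+1 + j)%N.
  apply: leq_trans (size_polyMleq _ _) _.
  by rewrite size_polyXn sp addSn/= addnC.
have Nm : (N <= m.+1 * N)%N by rewrite leq_pmull.
pose F x := ('X^j * p l.+1).[x] * (p (l + m.+1 * N)%N).[x].
pose G x := ('X^j * p l).[x] * (p (l.+1 + m.+1 * N)%N).[x].
rewrite (@quad_eq _ _ _ _ _ _ (fun x => a l * F x + - a l * G x)); last first.
  move=> x _; rewrite /F /G -mulrA [_ * T.[x]]mulrC -horner_comp -hornerM turan_chebU.
  move: (p l.+1) (p (l + _)) (p l) (p (l.+1 + _)) => q1 q2 q3 q4.
  rewrite !(hornerM, hornerZ, hornerD, hornerN, hornerXn).
  by move: (x ^+ j) => t; ring.
have H1 : (size ('X^j * p l.+1)%R <= (l + m.+1 * N).+1)%N.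
  by rewrite (leq_trans (sX _))//; lia.
have H2 : (size ('X^j * p l)%R <= (l.+1 + m.+1 * N).+1)%N.
  by rewrite (leq_trans (sX _))//; lia.
rewrite quadD !quadZ (quad_poly_orth b a_gt0 H1); last by lia.
rewrite (quad_poly_orth b a_gt0 H2)//.
rewrite [('X^j * p l)`_ _]nth_default; last first.
  by rewrite (leq_trans (sX _))//; lia.
rewrite mul0r mulr0 addr0 coefXnM ifN -?leqNgt; last lia.
have [/andP[/eqP -> /eqP jE]|mj] := boolP ((m == 0%N) && (j == N.-1)).
  rewrite mul1n mul1r.
  have [_ lp] := size_orth_poly b a_gt0 l.+1.
  have -> : (l + N - j = l.+1)%N by lia.
  have -> : (p l.+1)`_l.+1 = \prod_(k < l.+1) (a k)^-1 by rewrite -lp lead_coefE sp.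
  have -> : (l + N = l.+1 + N.-1)%N by lia.
  rewrite big_split_ord/= [X in _ * X]mulrA -big_split/=.
  have -> : \prod_(i < l.+1) ((a i)^-1 * a i) = 1.
    by rewrite big1// => k _; rewrite mulVf// gt_eqF.
  rewrite mul1r.
  have [N' ->] : exists N', N = N'.+1 by exists N.-1; lia.
  rewrite [RHS]big_ord_recl addn0; congr (_ * _); apply: eq_bigr => k _.
  by rewrite /= /bump /= addnA addn1.
rewrite mul0r nth_default ?mul0r ?mulr0// sp.
move: mj; rewrite negb_and => /orP[m0|j0].
  have : (2 * N <= m.+1 * N)%N by rewrite leq_mul2r ltnS lt0n m0 orbT.
  by lia.
have : (j.+1 < N)%N by move: j0 => /eqP; lia.
by lia.
Qed.

End PeriodicQuadrature.

(** * Signs inside the bands *)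
Section DiscriminantMonotone.
Context {R : realType}.
Variables a b : nat -> R.
Hypothesis a_gt0 : forall n, 0 < a n.

(** Differentiate the recurrence in [x]: each step adds one square to the Wronskian
    of a solution and its derivative, which is therefore a definite form in the
    initial values. *)
Lemma transport_wronskian n u0 u1 N x (w := transport a b n (u0%:P, u1%:P)) :
  a (n + N).-1 * ((w N).2^`().[x] * (w N).1.[x] - (w N).1^`().[x] * (w N).2.[x]) =
  \sum_(k < N) (w k).2.[x] ^+ 2.
Proof.
elim: N => [|N IH]; first by rewrite big_ord0 /w /= !derivC !horner0 !mul0r subrr mulr0.
rewrite big_ord_recr/= -IH addnS/=.
rewrite /w; case: (transport a b n _ N) => y z /=.
rewrite derivZ derivB derivM derivXsubC derivZ !hornerE/=.
move: z^`().[x] y^`().[x] z.[x] y.[x] => z1 y1 z0 y0.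
by field; rewrite gt_eqF.
Qed.

(** The trace of a product of two traceless matrices which both come from definite
    quadratic forms does not vanish; its sign is that of the off-diagonal entry. *)
Lemma elliptic_trace_sign (e00 e01 e10 e11 al be ga : R) :
  (e00 - e11) ^+ 2 + 4 * e01 * e10 < 0 -> 0 <= al -> 0 < ga ->
  be ^+ 2 <= 4 * al * ga ->
  0 < e01 * (al * e01 - ga * e10 - (e00 - e11) * be / 2).
Proof.
move=> ell al0 ga0 be2.
have m0 : e01 * e10 < 0 by have := sqr_ge0 (e00 - e11); lra.
have P0 : 0 < e01 * (al * e01 - ga * e10).
  have -> : e01 * (al * e01 - ga * e10) = al * e01 ^+ 2 + ga * (- (e01 * e10)) by ring.
  apply: ltr_wpDl; first by rewrite mulr_ge0 ?sqr_ge0.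
  by rewrite mulr_gt0// oppr_gt0.
set P := al * e01 - ga * e10 in P0 *; set r := (e00 - e11) * be / 2.
suff : `|e01 * r| < e01 * P by rewrite ltr_norml => /andP[_ ?]; lra.
have [be0|be0] := eqVneq be 0; first by rewrite /r be0 !(mulr0, mul0r) normr0.
have b2 : 0 < be ^+ 2 by rewrite lt_neqAle sqr_ge0 andbT eq_sym sqrf_eq0.
have e012 : 0 < e01 ^+ 2.
  by rewrite lt_neqAle sqr_ge0 andbT eq_sym sqrf_eq0; apply: contraTneq m0 => ->;
    rewrite mul0r ltxx.
rewrite -(ltr_pXn2r (n := 2)) ?nnegrE ?(ltW P0)// real_normK ?num_real//.
rewrite !exprMn ltr_pM2l//.
have h0 : 4 * al * ga * (- (e01 * e10)) <= P ^+ 2.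
  have -> : P ^+ 2 = (al * e01 + ga * e10) ^+ 2 + 4 * al * ga * (- (e01 * e10)).
    by rewrite /P; ring.
  by rewrite lerDr sqr_ge0.
have h1 : be ^+ 2 * (- (e01 * e10)) <= 4 * al * ga * (- (e01 * e10)).
  by apply: ler_wpM2r => //; rewrite oppr_ge0 ltW.
have h2 : (e00 - e11) ^+ 2 * be ^+ 2 < - 4 * (e01 * e10) * be ^+ 2.
  by rewrite ltr_pM2r//; lra.
have -> : (e00 - e11) ^+ 2 * be ^+ 2 * 2^-1 ^+ 2 = (e00 - e11) ^+ 2 * be ^+ 2 / 4.
  by field.
by move: h0 h1 h2; move: (e01 * e10) (P ^+ 2) => t w; lra.
Qed.

(** In a band the discriminant is strictly monotone: its derivative is a trace as
    in [elliptic_trace_sign], the second form being given by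
    [transport_wronskian]. *)
Lemma disc_deriv_sign n N x (E := entry a b n N) :
  (0 < N)%N -> (0 < n)%N ->
  ((E 0 0).[x] - (E 1 1).[x]) ^+ 2 + 4 * (E 0 1).[x] * (E 1 0).[x] < 0 ->
  E 0 0 * E 1 1 - E 0 1 * E 1 0 = 1 ->
  0 < (E 0 1).[x] * (E 0 0 + E 1 1)^`().[x].
Proof.
move=> N0 n0 ell det1.
have ddet : (E 0 0 * E 1 1 - E 0 1 * E 1 0)^`().[x] = 0 by rewrite det1 -polyC1 derivC horner0.
have det1x : (E 0 0).[x] * (E 1 1).[x] - (E 0 1).[x] * (E 1 0).[x] = 1.
  by have := congr1 (horner^~ x) det1; rewrite !(hornerE, hornerM).
move: ddet; rewrite derivB !derivM !(hornerD, hornerN, hornerM).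
have W (u0 u1 : R) : a (n + N).-1 *
   (((E 1 0)^`().[x] * u0 + (E 1 1)^`().[x] * u1) * ((E 0 0).[x] * u0 + (E 0 1).[x] * u1)
   - ((E 0 0)^`().[x] * u0 + (E 0 1)^`().[x] * u1) * ((E 1 0).[x] * u0 + (E 1 1).[x] * u1))
   = \sum_(k < N) ((transport a b n (u0%:P, u1%:P) k).2).[x] ^+ 2.
  rewrite -transport_wronskian transport_lin -/E /=.
  rewrite !derivD !derivM !derivC !mulr0 !addr0 !(hornerD, hornerM, hornerC).
  by [].
pose al := (E 1 0)^`().[x] * (E 0 0).[x] - (E 0 0)^`().[x] * (E 1 0).[x].
pose ga := (E 1 1)^`().[x] * (E 0 1).[x] - (E 0 1)^`().[x] * (E 1 1).[x].
pose be := (E 1 0)^`().[x] * (E 0 1).[x] + (E 1 1)^`().[x] * (E 0 0).[x]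
  - (E 0 0)^`().[x] * (E 1 1).[x] - (E 0 1)^`().[x] * (E 1 0).[x].
have q0 u0 u1 : 0 <= al * u0 ^+ 2 + be * (u0 * u1) + ga * u1 ^+ 2.
  rewrite -(pmulr_rge0 _ (a_gt0 (n + N).-1)).
  have -> : al * u0 ^+ 2 + be * (u0 * u1) + ga * u1 ^+ 2 =
   ((E 1 0)^`().[x] * u0 + (E 1 1)^`().[x] * u1) * ((E 0 0).[x] * u0 + (E 0 1).[x] * u1)
   - ((E 0 0)^`().[x] * u0 + (E 0 1)^`().[x] * u1) * ((E 1 0).[x] * u0 + (E 1 1).[x] * u1).
    by rewrite /al /be /ga; ring.
  by rewrite W sumr_ge0// => k _; rewrite sqr_ge0.
have al0 : 0 <= al by have := q0 1 0; rewrite expr1n expr0n !mulr0 !addr0 mulr1.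
have ga0 : 0 < ga.
  rewrite -(pmulr_rgt0 _ (a_gt0 (n + N).-1)).
  have := W 0 1; rewrite !mulr0 !add0r !mulr1 => ->.
  have [N' ->] : exists N', N = N'.+1 by exists N.-1; rewrite prednK.
  rewrite big_ord_recl/= hornerC expr1n ltr_pwDl// sumr_ge0// => k _.
  by rewrite sqr_ge0.
have be2 : be ^+ 2 <= 4 * al * ga.
  have := q0 (2 * ga) (- be).
  have -> : al * (2 * ga) ^+ 2 + be * (2 * ga * - be) + ga * (- be) ^+ 2 =
     ga * (4 * al * ga - be ^+ 2) by ring.
  by rewrite pmulr_rge0// subr_ge0.
rewrite derivD hornerD.
have := elliptic_trace_sign ell al0 ga0 be2.
rewrite /al /be /ga.
move: (E 0 0)^`().[x] (E 0 1)^`().[x] (E 1 0)^`().[x] (E 1 1)^`().[x] det1x.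
move: (E 0 0).[x] (E 0 1).[x] (E 1 0).[x] (E 1 1).[x].
move=> e00 e01 e10 e11 d00 d01 d10 d11 det' H ddet.
have T : d10 * e01 = d00 * e11 + e00 * d11 - d01 * e10 by move: ddet; lra.
move: H; set e := (X in 0 < _ * X -> _).
have -> : e = (d00 + d11) * (e00 * e11 - e01 * e10) +
    (d10 * e01 - (d00 * e11 + e00 * d11 - d01 * e10)) * (e00 + e11) / 2.
  by rewrite /e; field.
by rewrite det' T subrr !mul0r addr0 mulr1.
Qed.

Lemma orth_poly_no_common_root n x :
  (orth_poly a b n).[x] ^+ 2 + (orth_poly a b n.+1).[x] ^+ 2 != 0.
Proof.
apply/negP; rewrite paddr_eq0 ?sqr_ge0// !sqrf_eq0 => /andP[/eqP h0 /eqP h1].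
have := kernel_confluent b a_gt0 n x; rewrite h0 h1 !mulr0 subrr mulr0 => k0.
by have := kernel_gt0 a b n x; rewrite k0 ltxx.
Qed.

(** In a band the Turan determinant is a definite quadratic form in
    [(p_l, p_(l+1))], and consecutive orthogonal polynomials have no common
    root. *)
Lemma turan_sign l N x (E := entry a b l.+1 N) :
  ((E 0 0).[x] - (E 1 1).[x]) ^+ 2 + 4 * (E 0 1).[x] * (E 1 0).[x] < 0 ->
  0 < (E 0 1).[x] * (turan_poly a b l N).[x].
Proof.
move=> ell; have nr := orth_poly_no_common_root l x.
have := @transport_orth_poly _ a b l.+1 N isT.
rewrite transport_lin addSn /= -/E /turan_poly => -[<- <-].
move: nr; move: (orth_poly a b l) (orth_poly a b l.+1) => y z.
rewrite !(hornerZ, hornerD, hornerM, hornerN) => nr.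
move: (E 0 0).[x] (E 0 1).[x] (E 1 0).[x] (E 1 1).[x] y.[x] z.[x] ell nr.
move=> e00 e01 e10 e11 u v ell nr.
have -> : e01 * (a l * (v * (e00 * u + e01 * v) - u * (e10 * u + e11 * v))) =
  a l * ((e01 * v + (e00 - e11) / 2 * u) ^+ 2 +
         u ^+ 2 * (- ((e00 - e11) ^+ 2 + 4 * e01 * e10) / 4)) by field.
apply: mulr_gt0 => //.
have [u0|u0] := eqVneq u 0.
  have v0 : v != 0 by apply: contraNneq nr => ->; rewrite u0 expr0n addr0.
  rewrite u0 expr0n mul0r mulr0 !addr0 lt_neqAle sqr_ge0 andbT eq_sym sqrf_eq0.
  rewrite mulf_neq0//; apply: contraTneq ell => ->.
  by rewrite mulr0 mul0r addr0 -leNgt sqr_ge0.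
rewrite ltr_wpDl ?sqr_ge0// mulr_gt0//; last by rewrite divr_gt0// oppr_gt0.
by rewrite lt_neqAle sqr_ge0 andbT eq_sym sqrf_eq0.
Qed.

End DiscriminantMonotone.

(** * Approximation by polynomials *)
Section Weierstrass.
Context {R : realType}.

Lemma uniform_continuity (f : R -> R) (A : set R) : compact A -> continuous f ->
  forall eps : R, 0 < eps -> exists2 delta : R, 0 < delta &
    forall x y, A x -> `|x - y| < delta -> `|f x - f y| <= eps.
Proof.
move=> cA cf eps eps0.
have := (proj1 (compact_near_coveringP A)) cA R (at_right 0)
  (fun (d : R) x => forall y, `|x - y| < d -> `|f x - f y| <= eps) _.
case=> [x Ax|e /= e0 H].
  have e2 : 0 < eps / 2 by rewrite divr_gt0.
  have /cvgrPdist_lt/(_ _ e2)/nbhs_ballP[eta /= eta0 H] := cf x.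
  exists (ball x (eta / 2), [set d | 0 < d < eta / 2]) => /=.
    split; first by apply: nbhsx_ballx; rewrite divr_gt0.
    exists (eta / 2); first by rewrite /= divr_gt0.
    move=> z /=; rewrite sub0r normrN => zl z0; rewrite z0/=.
    by rewrite (le_lt_trans (ler_norm _) zl).
  case=> x' d /= [bx /andP[d0 dl]] y xy.
  have h1 : `|f x - f x'| < eps / 2.
    by apply: H; apply: lt_le_trans bx _; rewrite ler_pdivrMr// ler_peMr ?ler1n// ltW.
  have h2 : `|f x - f y| < eps / 2.
    apply: H; rewrite /ball/= -(subrKA x'); apply: le_lt_trans (ler_normD _ _) _.
    by rewrite [ltRHS]splitr ltrD// (lt_trans xy).
  rewrite -(subrKA (f x)); apply: le_trans (ler_normD _ _) _.
  by rewrite (distrC (f x')) [leRHS]splitr lerD// ltW.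
exists (e / 2); first by rewrite divr_gt0.
move=> x y Ax xy; apply: (H (e / 2)) => //=.
  rewrite sub0r normrN gtr0_norm ?divr_gt0// ltr_pdivrMr// ltr_pMr// ltr1n//.
by rewrite divr_gt0.
Qed.

(** The Bernstein polynomial as an expectation under the binomial law with success
    probability ['X]: the recursion conditions on the first trial, and makes
    positivity and the moments direct inductions. *)
Fixpoint bernstein (n : nat) (phi : nat -> R) : {poly R} :=
  if n is n'.+1 then
    'X * bernstein n' (phi \o S) + (1 - 'X) * bernstein n' phi
  else (phi 0%N)%:P.

Lemma bernstein_le n phi psi t : 0 <= t <= 1 ->
  (forall k, (k <= n)%N -> phi k <= psi k) ->
  (bernstein n phi).[t] <= (bernstein n psi).[t].
Proof.
move=> /andP[t0 t1]; elim: n phi psi => [|n IH] phi psi H /=.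
  by rewrite !hornerC H.
rewrite !(hornerD, hornerM, hornerX, hornerN, hornerC) lerD//.
  by apply: ler_wpM2l => //; apply: IH => k kn; exact: H.
apply: ler_wpM2l; first by rewrite subr_ge0.
by apply: IH => k kn; apply: H; exact: leqW.
Qed.

Lemma bernsteinD n phi psi t :
  (bernstein n (fun k => phi k + psi k)).[t] =
  (bernstein n phi).[t] + (bernstein n psi).[t].
Proof.
elim: n phi psi => [|n IH] phi psi /=; first by rewrite !hornerC.
rewrite !(hornerD, hornerM, hornerX, hornerN, hornerC).
rewrite [bernstein n ((fun _ => _) \o _)](_ : _ =
  bernstein n (fun k => (phi \o S) k + (psi \o S) k))//.
by rewrite !IH; ring.
Qed.

Lemma bernsteinZ n (c : R) phi t :
  (bernstein n (fun k => c * phi k)).[t] = c * (bernstein n phi).[t].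
Proof.
elim: n phi => [|n IH] phi /=; first by rewrite !hornerC.
rewrite !(hornerD, hornerM, hornerX, hornerN, hornerC).
rewrite [bernstein n ((fun _ => _) \o _)](_ : _ =
  bernstein n (fun k => c * (phi \o S) k))//.
by rewrite !IH; ring.
Qed.

Lemma bernstein_cst n (c : R) t : (bernstein n (fun=> c)).[t] = c.
Proof.
elim: n => [|n IH] /=; first by rewrite hornerC.
rewrite !(hornerD, hornerM, hornerX, hornerN, hornerC).
by rewrite [(fun=> c) \o S](_ : _ = (fun=> c))// !IH; ring.
Qed.

Lemma bernstein_variance n (c t : R) :
  (bernstein n (fun k => (k%:R - c) ^+ 2)).[t] =
  n%:R * t * (1 - t) + (n%:R * t - c) ^+ 2.
Proof.
elim: n c => [|n IH] c /=; first by rewrite hornerC !mul0r !add0r.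
rewrite !(hornerD, hornerM, hornerX, hornerN, hornerC).
rewrite [(fun _ => _) \o S](_ : _ = (fun k => (k%:R - (c - 1)) ^+ 2)); last first.
  by apply/funext => k /=; rewrite -natr1; congr (_ ^+ 2); ring.
by rewrite !IH -natr1; ring.
Qed.

(** Chebyshev's inequality: on the event of a large deviation the error is bounded
    by a multiple of the variance, elsewhere by uniform continuity. *)
Lemma weierstrass_approximation (f : R -> R) (B : R) : 0 < B -> continuous f ->
  forall eps : R, 0 < eps -> exists q : {poly R},
    forall x, `|x| <= B -> `|f x - q.[x]| <= eps.
Proof.
move=> B0 cf eps eps0.
have e2 : 0 < eps / 2 by rewrite divr_gt0.
have [d d0 Hd] := uniform_continuity (@segment_compact R (- B) B) cf e2.
have [M [M0 HM]] : exists M : R, 0 < M /\ forall x, `|x| <= B -> `|f x| <= M.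
  have cf' : {within `[(- B), B], continuous f} by exact: continuous_subspaceT.
  have BB : - B <= B by lra.
  have [u _ Hu] := EVT_max BB cf'.
  have [v _ Hv] := EVT_min BB cf'.
  exists (`|f u| + `|f v| + 1); split.
    by rewrite ltr_wpDl// addr_ge0.
  move=> x; rewrite ler_norml => xB.
  have xI : x \in `[(- B), B] by rewrite in_itv.
  have := Hu x xI; have := Hv x xI; have := ler_norm (f u).
  have := ler_norm (- f v); rewrite normrN ler_norml => h1 h2 h3 h4.
  have := normr_ge0 (f u); have := normr_ge0 (f v) => h5 h6.
  by apply/andP; split; lra.
pose C := 2 * M * (2 * B) ^+ 2 / d ^+ 2.
have C0 : 0 < C by rewrite divr_gt0 ?exprn_gt0// !mulr_gt0// exprn_gt0// mulr_gt0.
have [n nC] : exists n : nat, C / n.+1%:R <= eps / 2.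
  exists (Num.truncn (C / (eps / 2))).
  rewrite ler_pdivrMr// mulrC -ler_pdivrMr//.
  by apply/ltW/truncnS_gt.
pose t x := (x + B) / (2 * B).
pose g k : R := 2 * B * (k%:R / n.+1%:R) - B.
pose q := (bernstein n.+1 (f \o g)) \Po ((2 * B)^-1 *: ('X + B%:P)).
exists q => x xB.
have tx : 0 <= t x <= 1.
  move: xB; rewrite ler_norml => /andP[h1 h2].
  have B2 : 0 < 2 * B by rewrite mulr_gt0.
  by rewrite /t ler_pdivlMr// ler_pdivrMr//; apply/andP; split; lra.
have qx : q.[x] = (bernstein n.+1 (f \o g)).[t x].
  rewrite /q horner_comp; congr (_.[_]).
  by rewrite hornerZ hornerD hornerX hornerC /t mulrC.
have xt : x = 2 * B * t x - B by rewrite /t; field; rewrite gt_eqF.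
pose w k : R := eps / 2 + C / n.+1%:R ^+ 2 * (k%:R - n.+1%:R * t x) ^+ 2.
have key k : (k <= n.+1)%N -> `|f x - f (g k)| <= w k.
  move=> kn; rewrite /w.
  have n0 : 0 < n.+1%:R :> R by [].
  have [xg|xg] := ltP `|x - g k| d.
    apply: le_trans (Hd x (g k) _ xg) _; first by rewrite /= in_itv/= -ler_norml.
    by rewrite lerDl mulr_ge0 ?sqr_ge0// divr_ge0 ?exprn_ge0// ltW.
  have gB : `|g k| <= B.
    have k1 : (k%:R / n.+1%:R : R) <= 1 by rewrite ler_pdivrMr// mul1r ler_nat.
    have k0 : 0 <= (k%:R / n.+1%:R : R) by rewrite divr_ge0.
    rewrite /g ler_norml; move: (k%:R / n.+1%:R) k0 k1 => z z0 z1.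
    have := mulr_ge0 (ltW B0) z0; have := ler_wpM2l (ltW B0) z1.
    by move=> h1 h2; apply/andP; split; lra.
  apply: (@le_trans _ _ (2 * M)).
    apply: le_trans (ler_normB _ _) _; have := HM x xB; have := HM _ gB; lra.
  apply: (@le_trans _ _ (2 * M * ((x - g k) ^+ 2 / d ^+ 2))).
    rewrite ler_peMr ?mulr_ge0 ?(ltW M0)// ler_pdivlMr ?exprn_gt0// mul1r.
    rewrite -(real_normK (num_real (x - g k))); apply: lerXn2r => //.
    by rewrite nnegrE ltW.
  have -> : 2 * M * ((x - g k) ^+ 2 / d ^+ 2) =
     C / n.+1%:R ^+ 2 * (k%:R - n.+1%:R * t x) ^+ 2.
    rewrite {1}xt /g /C; field.
    by rewrite !gt_eqF.
  by rewrite lerDr ltW.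
have bb : `|f x - q.[x]| <= (bernstein n.+1 w).[t x].
  rewrite qx -{1}(bernstein_cst n.+1 (f x) (t x)) ler_norml.
  have E1 := bernsteinD n.+1 (fun=> f x) (fun k => -1 * (f \o g) k) (t x).
  rewrite bernsteinZ mulN1r in E1; rewrite -E1; apply/andP; split.
    have E2 := bernsteinZ n.+1 (-1) w (t x); rewrite mulN1r in E2.
    rewrite -E2; apply: bernstein_le => // k kn.
    by have := key k kn; rewrite ler_norml /= => /andP[]; lra.
  apply: bernstein_le => // k kn.
  by have := key k kn; rewrite ler_norml /= => /andP[]; lra.
apply: le_trans bb _.
rewrite (bernsteinD n.+1 (fun=> eps / 2)) bernstein_cst bernsteinZ bernstein_variance.
rewrite subrr expr0n addr0 [leRHS]splitr lerD2l; apply: le_trans nC.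
have -> : C / n.+1%:R ^+ 2 * (n.+1%:R * t x * (1 - t x)) =
   C / n.+1%:R * (t x * (1 - t x)).
  have n0 : n.+1%:R != 0 :> R by rewrite pnatr_eq0.
  by move: n0; move: (n.+1%:R : R) (t x) => m s m0; field.
rewrite ler_piMr//; first by apply: divr_ge0 => //; exact: ltW.
case/andP: tx => t0 t1; apply: mulr_ile1 => //; first by rewrite subr_ge0.
by rewrite gerBl.
Qed.

End Weierstrass.

(** * Integrals over segments and the semicircle law *)
Section IntervalIntegral.
Context {R : realType}.
Implicit Types (f g : R -> R) (a b : R).
Local Notation mu := (@lebesgue_measure R).

Definition ival f a b : R := (\int[mu]_(x in `[a, b]) f x)%R.

Lemma ival_integrable f a b : {within `[a, b], continuous f} ->
  mu.-integrable `[a, b]%classic (EFin \o f).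
Proof. by apply: continuous_compact_integrable; exact: segment_compact. Qed.

Lemma ival_eq f g a b : (forall x, a <= x <= b -> f x = g x) -> ival f a b = ival g a b.
Proof.
move=> fg; apply: eq_Rintegral => x; rewrite inE/= in_itv/= => xab.
exact: fg.
Qed.

Lemma ivalD f g a b : {within `[a, b], continuous f} ->
  {within `[a, b], continuous g} ->
  ival (fun x => f x + g x) a b = ival f a b + ival g a b.
Proof. by move=> cf cg; rewrite /ival RintegralD//; exact: ival_integrable. Qed.

Lemma ivalZ (c : R) f a b : {within `[a, b], continuous f} ->
  ival (fun x => c * f x) a b = c * ival f a b.
Proof. by move=> cf; rewrite /ival RintegralZl//; exact: ival_integrable. Qed.

Lemma ival_le f g a b : {within `[a, b], continuous f} ->
  {within `[a, b], continuous g} ->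
  (forall x, a <= x <= b -> f x <= g x) -> ival f a b <= ival g a b.
Proof.
move=> cf cg fg; apply: le_Rintegral;
  [by []|exact: ival_integrable|exact: ival_integrable|].
by move=> x; rewrite /= in_itv/=; exact: fg.
Qed.

Lemma ival_cst (c : R) a b : a <= b -> ival (fun=> c) a b = c * (b - a).
Proof.
move=> ab; rewrite /ival Rintegral_cst//; congr (_ * _).
have := @lebesgue_measure_itv R `[a, b]; rewrite /= lte_fin => ->.
by move: ab; rewrite le_eqVlt => /predU1P[->|->]; rewrite ?ltxx ?subrr.
Qed.

Lemma ival_near f g a b (eps : R) : a <= b -> {within `[a, b], continuous f} ->
  {within `[a, b], continuous g} ->
  (forall x, a <= x <= b -> `|f x - g x| <= eps) ->
  `|ival f a b - ival g a b| <= eps * (b - a).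
Proof.
move=> ab cf cg fg; have ce : {within `[a, b], continuous (fun=> eps : R)}.
  by apply: continuous_subspaceT => x; exact: cvg_cst.
rewrite ler_norml lerBlDr lerBrDl -ival_cst// -!ivalD//.
have cN : {within `[a, b], continuous (fun=> - eps : R)}.
  by apply: continuous_subspaceT => x; exact: cvg_cst.
rewrite {1}ival_cst// -mulNr -ival_cst// -ivalD//.
apply/andP; split; apply: ival_le.
- by move=> x; apply: cvgD; [exact: cg|exact: cN].
- by [].
- by move=> x /fg; rewrite ler_norml => /andP[]; lra.
- by [].
- by move=> x; apply: cvgD; [exact: ce|exact: cg].
- by move=> x /fg; rewrite ler_norml => /andP[]; lra.
Qed.

Lemma ival_FTC f (F : R -> R) a b : a < b -> continuous f ->
  (forall x : R, is_derive x (1 : R) F (f x)) -> ival f a b = F b - F a.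
Proof.
move=> ab cf dF; rewrite /ival /Rintegral.
have cF : continuous F.
  by move=> x; apply: differentiable_continuous; apply/derivable1_diffP; have [] := dF x.
rewrite (continuous_FTC2 (F := F) ab)//.
- exact: continuous_subspaceT.
- split=> [x _||].
  + by have [] := dF x.
  + by apply: cvg_at_right_filter; exact: cF.
  + by apply: cvg_at_left_filter; exact: cF.
- by move=> x _; rewrite derive1E derive_val.
Qed.

End IntervalIntegral.

Section Semicircle.
Context {R : realType}.
Implicit Types (h : R -> R).

(** The integral against the semicircle law on [[-2, 2]], in the angular variable;
    this spares the singularities of the density at the ends. *)
Definition semicircle h : R :=
  2 / pi * ival (fun x => h (2 * cos x) * sin x ^+ 2) 0 pi.

Let cpi (f : R -> R) : continuous f -> {within `[(0:R), pi], continuous (fun x => f (2 * cos x) * sin x ^+ 2)}.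
Proof.
move=> cf; apply: continuous_subspaceT => x; apply: cvgM.
  apply: (continuous_comp (f := fun x : R => 2 * cos x)); last exact: cf.
  by apply: cvgM; [exact: cvg_cst|exact: continuous_cos].
apply: (continuous_comp (f := sin) (g := fun z : R => z ^+ 2)).
  exact: continuous_sin.
exact: exprn_continuous.
Qed.

Let pi0 : 0 < pi :> R. Proof. exact: pi_gt0. Qed.

Lemma semicircleD (f g : R -> R) : continuous f -> continuous g ->
  semicircle (fun x => f x + g x) = semicircle f + semicircle g.
Proof.
move=> cf cg; rewrite /semicircle -mulrDr -ivalD; [|exact: cpi..].
by congr (_ * _); apply: ival_eq => x _; rewrite mulrDl.
Qed.

Lemma semicircleZ (c : R) (f : R -> R) : continuous f ->
  semicircle (fun x => c * f x) = c * semicircle f.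
Proof.
move=> cf; rewrite /semicircle [RHS]mulrCA -(ivalZ _ (cpi cf)).
by congr (_ * _); apply: ival_eq => x _; rewrite mulrA.
Qed.

Lemma semicircle_near (f g : R -> R) (eps : R) : continuous f -> continuous g -> 0 <= eps ->
  (forall y, -2 <= y <= 2 -> `|f y - g y| <= eps) ->
  `|semicircle f - semicircle g| <= 2 * eps.
Proof.
move=> cf cg e0 fg; rewrite /semicircle -mulrBr normrM ger0_norm; last first.
  by rewrite divr_ge0 ?ltW.
have := ival_near (ltW pi0) (cpi cf) (cpi cg) (eps := eps).
rewrite subr0 => /(_ _)H.
apply: (@le_trans _ _ (2 / pi * (eps * pi))).
  apply: ler_wpM2l; first by rewrite divr_ge0 ?ltW.
  apply: H => x _; rewrite -mulrBl normrM.
  have s1 : `|sin x ^+ 2| <= 1.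
    by rewrite normrX expr_le1// ler_norml sin_geN1 sin_le1.
  rewrite -[leRHS]mulr1; apply: ler_pM => //; apply: fg.
  by have := cos_geN1 x; have := cos_le1 x; move=> *; apply/andP; split; lra.
have pne : pi != 0 :> R by rewrite gt_eqF.
have -> : 2 / pi * (eps * pi) = 2 * eps :> R by move: (pi : R) pne => P P0; field.
by [].
Qed.

Lemma chebU_sin m (x : R) :
  (chebU m).[2 * cos x] * sin x = sin (m.+1%:R * x).
Proof.
elim/chebU_ind: m => [||m h0 h1].
- by rewrite hornerC !mul1r.
- rewrite hornerX (_ : 2 * x = x + x); first by rewrite sinD; ring.
  by rewrite mulr_natl mulr2n.
rewrite chebUS hornerD hornerN hornerM hornerX mulrBl -mulrA h0 h1.
have -> : m.+3%:R * x = m.+2%:R * x + x.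
  by rewrite -[m.+3%:R]natr1 mulrDl mul1r.
have -> : m.+1%:R * x = m.+2%:R * x - x.
  by rewrite -[m.+2%:R]natr1 mulrDl mul1r addrK.
by rewrite !sinD sinN cosN; ring.
Qed.

(** Since [U_m(2 cos x) sin x = sin ((m + 1) x)], this is the orthogonality of
    sines, by an explicit primitive. *)
Lemma semicircle_chebU m : semicircle (fun y => (chebU m).[y]) = (m == 0%N)%:R.
Proof.
have E (x : R) : (chebU m).[2 * cos x] * sin x ^+ 2 = 1 / 2 * (cos (m%:R * x) - cos (m.+2%:R * x)).
  rewrite expr2 mulrA chebU_sin.
  have -> : m%:R * x = m.+1%:R * x - x.
    by rewrite -[m.+1%:R]natr1 mulrDl mul1r addrK.
  have -> : m.+2%:R * x = m.+1%:R * x + x.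
    by rewrite -[m.+2%:R]natr1 mulrDl mul1r.
  by rewrite !cosD sinN cosN; field.
have sinpi (k : nat) : sin (k%:R * pi) = 0 :> R.
  elim: k => [|k IH]; first by rewrite mul0r sin0.
  by rewrite -natr1 mulrDl mul1r sinD IH sinpi mulr0 mul0r addr0.
have ccos (k : R) : continuous (fun x : R => cos (k * x)).
  move=> x; apply: (continuous_comp (f := fun x : R => k * x)); last exact: continuous_cos.
  by apply: cvgM; [exact: cvg_cst|exact: cvg_id].
have dsin (k : R) : k != 0 -> forall x : R, is_derive x (1 : R) (fun x : R => sin (k * x) / k) (cos (k * x)).
  move=> k0 x.
  have d1 : is_derive x (1 : R) (fun x : R => k * x) k.
    by have := is_deriveZ k (is_derive_id x (1 : R)); rewrite /GRing.scale/= mulr1.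
  have d2 := is_derive1_comp (f := sin) (is_derive_sin (k * x)) d1.
  have d3 : is_derive x (1 : R) (fun x : R => k^-1 * sin (k * x)) (k^-1 * (cos (k * x) * k)).
    by exact: (is_deriveZ k^-1 d2).
  have -> : cos (k * x) = k^-1 * (cos (k * x) * k) by field.
  by have -> : (fun x : R => sin (k * x) / k) = (fun x : R => k^-1 * sin (k * x))
    by apply/funext => z; rewrite mulrC.
have m2 : (m.+2%:R : R) != 0 by rewrite pnatr_eq0.
have I2 : ival (fun x : R => cos (m.+2%:R * x)) 0 pi = 0.
  by rewrite (ival_FTC pi0 (ccos _) (dsin _ m2)) sinpi mulr0 sin0 !mul0r subrr.
have I1 : ival (fun x : R => cos (m%:R * x)) 0 pi = (m == 0%N)%:R * pi.
  have [->|m0] := eqVneq m 0%N.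
    rewrite (ival_eq (g := fun=> 1)) ?ival_cst ?subr0 ?ltW//.
    by move=> x _; rewrite mul0r cos0.
  have m1 : (m%:R : R) != 0 by rewrite pnatr_eq0.
  by rewrite (ival_FTC pi0 (ccos _) (dsin _ m1)) sinpi mulr0 sin0 !mul0r subrr.
rewrite /semicircle (ival_eq (g := fun x => 1 / 2 * (cos (m%:R * x) + -1 * cos (m.+2%:R * x)))).
  have c1 (k : R) : {within `[(0:R), pi], continuous (fun x : R => cos (k * x))}.
    by apply: continuous_subspaceT; exact: ccos.
  have c2 : {within `[(0:R), pi], continuous (fun x : R => -1 * cos (m.+2%:R * x))}.
    apply: continuous_subspaceT => x; apply: cvgM; [exact: cvg_cst|exact: ccos].
  rewrite ivalZ; last by move=> x; apply: cvgD; [exact: c1|exact: c2].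
  rewrite ivalD// ivalZ// I1 I2.
  have pne : pi != 0 :> R by rewrite gt_eqF.
  by move: (pi : R) pne => P P0; field.
by move=> x _; rewrite E mulN1r.
Qed.

End Semicircle.

Section Substitution.
Context {R : realType}.
Implicit Types (F f G : R -> R) (a b : R).

Lemma is_derive_continuous F f (x : R) : is_derive x (1 : R) F (f x) -> {for x, continuous F}.
Proof.
by move=> [dF _]; apply: differentiable_continuous; apply/derivable1_diffP.
Qed.

Lemma MVT_on F f a b x y : (forall x, a <= x <= b -> is_derive x (1 : R) F (f x)) ->
  a <= x -> x < y -> y <= b -> exists2 c, x < c < y & F y - F x = f c * (y - x).
Proof.
move=> dF ax xy yb.
have cF : {within `[x, y], continuous F}.
  apply: continuous_in_subspaceT => z; rewrite inE/= in_itv/= => /andP[xz zy].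
  by apply: (is_derive_continuous (f := f)); apply: dF; rewrite (le_trans ax)//= (le_trans zy).
have [|c] := @MVT _ F f x y xy _ cF.
  move=> z; rewrite in_itv/= => /andP[xz zy]; apply: dF.
  by rewrite (le_trans ax (ltW xz))//= (le_trans (ltW zy)).
by rewrite in_itv/= => xcy E; exists c.
Qed.

Let substitution_hyps F f a b : a < b ->
  (forall x, a <= x <= b -> is_derive x (1 : R) F (f x)) ->
  (forall x, a <= x <= b -> {for x, continuous f}) ->
  [/\ {in `]a, b[, continuous F^`()%classic},
      cvg (F^`()%classic x @[x --> a^'+]),
      cvg (F^`()%classic x @[x --> b^'-]) &
      derivable_oo_LRcontinuous F a b].
Proof.
move=> ab dF cf.
have dE x : a <= x <= b -> F^`()%classic x = f x.
  by move=> /dF dFx; rewrite derive1E derive_val.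
have aI : a <= a <= b by rewrite lexx ltW.
have bI : a <= b <= b by rewrite lexx ltW.
split.
- move=> x; rewrite in_itv/= => /andP[ax xb].
  rewrite /continuous_at dE ?(ltW ax) ?(ltW xb)//.
  apply: cvg_trans (cf x _); last by rewrite ?(ltW ax) ?(ltW xb).
  apply: near_eq_cvg; near=> z; apply/esym/dE.
  suff : z \in `]a, b[ by rewrite in_itv/= => /andP[/ltW -> /ltW ->].
  by near: z; apply: near_in_itvoo; rewrite in_itv/= ax.
- apply/cvg_ex; exists (f a).
  have : f x @[x --> a^'+] --> f a by apply: cvg_at_right_filter; exact: cf.
  apply: cvg_trans; apply: near_eq_cvg; near=> z; apply/esym/dE.
  by apply/andP; split; apply/ltW; near: z; [exact: nbhs_right_gt|exact: nbhs_right_lt].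
- apply/cvg_ex; exists (f b).
  have : f x @[x --> b^'-] --> f b by apply: cvg_at_left_filter; exact: cf.
  apply: cvg_trans; apply: near_eq_cvg; near=> z; apply/esym/dE.
  by apply/andP; split; apply/ltW; near: z; [exact: nbhs_left_gt|exact: nbhs_left_lt].
- split=> [x||].
  + by rewrite in_itv/= => /andP[ax xb]; have [] := dF x ltac:(by rewrite (ltW ax) (ltW xb)).
  + by apply: cvg_at_right_filter; apply: (is_derive_continuous (f := f)); exact: dF.
  + by apply: cvg_at_left_filter; apply: (is_derive_continuous (f := f)); exact: dF.
Unshelve. all: by end_near. Qed.

Lemma ival_subst_incr F f G a b : a < b ->
  (forall x, a <= x <= b -> is_derive x (1 : R) F (f x)) ->
  (forall x, a <= x <= b -> {for x, continuous f}) ->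
  (forall x, a <= x <= b -> 0 < f x) -> continuous G ->
  F a < F b /\ ival G (F a) (F b) = ival (fun x => G (F x) * f x) a b.
Proof.
move=> ab dF cf f0 cG; have [h1 h2 h3 h4] := substitution_hyps ab dF cf.
have inc : {in `[a, b] &, {homo F : x y / x < y}}.
  move=> x y; rewrite !in_itv/= => /andP[ax xb] /andP[ay yb] xy.
  have [c /andP[xc cy] E] := MVT_on dF ax xy yb.
  rewrite -subr_gt0 E mulr_gt0 ?subr_gt0// f0// (le_trans ax (ltW xc))/=.
  exact: le_trans (ltW cy) yb.
split; first by apply: inc => //; rewrite in_itv/= lexx ltW.
rewrite /ival /Rintegral (integration_by_substitution_increasing (ltW ab) inc h1 h2 h3 h4).
  congr fine; apply: eq_integral => x; rewrite inE/= in_itv/= => xab.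
  rewrite /= !fctE; congr (_ * _)%:E.
  by rewrite derive1E; have := dF x xab => dFx; rewrite derive_val.
exact: continuous_subspaceT.
Qed.

Lemma ival_subst_decr F f G a b : a < b ->
  (forall x, a <= x <= b -> is_derive x (1 : R) F (f x)) ->
  (forall x, a <= x <= b -> {for x, continuous f}) ->
  (forall x, a <= x <= b -> f x < 0) -> continuous G ->
  F b < F a /\ ival G (F b) (F a) = ival (fun x => G (F x) * - f x) a b.
Proof.
move=> ab dF cf f0 cG; have [h1 h2 h3 h4] := substitution_hyps ab dF cf.
have dec : {in `[a, b] &, {homo F : x y /~ x < y}}.
  move=> x y; rewrite !in_itv/= => /andP[ax xb] /andP[ay yb] xy.
  have [c /andP[xc cy] E] := MVT_on dF ay xy xb.
  rewrite -subr_lt0 E nmulr_rlt0 ?subr_gt0// f0// (le_trans ay (ltW xc))/=.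
  exact: le_trans (ltW cy) xb.
split; first by apply: dec => //; rewrite in_itv/= lexx ltW.
rewrite /ival /Rintegral (integration_by_substitution_decreasing (ltW ab) dec h1 h2 h3 h4).
  congr fine; apply: eq_integral => x; rewrite inE/= in_itv/= => xab.
  rewrite /= !fctE; congr (_ * - _)%:E.
  by rewrite derive1E; have := dF x xab => dFx; rewrite derive_val.
exact: continuous_subspaceT.
Qed.

Lemma ival_support G a b c d : c <= a -> b <= d ->
  (forall x, c <= x <= d -> ~~ (a <= x <= b) -> G x = 0) -> ival G c d = ival G a b.
Proof.
move=> ca bd G0; rewrite /ival.
have -> : `[a, b]%classic = `[c, d]%classic `&` `[a, b]%classic.
  apply/seteqP; split=> x /=; rewrite !in_itv/=; last by case.
  by move=> /andP[ax xb]; split; apply/andP; split => //; [exact: le_trans ax|exact: le_trans bd].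
rewrite Rintegral_mkcondr; apply: eq_Rintegral => x; rewrite inE/= in_itv/= => xcd.
rewrite /patch; case: ifPn => //; rewrite notin_setE/= in_itv/= => /negP xab.
exact: G0.
Qed.

End Substitution.

Section DiscriminantInverse.
Context {R : realType}.
Variables (D : {poly R}) (s t : R).
Hypothesis st : s < t.
Hypothesis dD : forall x, s <= x <= t -> D^`().[x] != 0.

Let derD x : s <= x <= t -> is_derive x (1 : R) (horner D) (D^`().[x]).
Proof. by move=> _; exact: is_derive_poly. Qed.

Lemma deriv_lower_bound : exists2 d : R, 0 < d &
  forall x, s <= x <= t -> d <= `|D^`().[x]|.
Proof.
have c : {within `[s, t], continuous (fun x => `|D^`().[x]|)}.
  apply: continuous_subspaceT => x.
  by apply: (continuous_comp (f := horner D^`())); [exact: continuous_horner|exact: norm_continuous].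
have [c0 c0st Hc] := EVT_min (ltW st) c.
exists `|D^`().[c0]|; first by rewrite normr_gt0 dD//; move: c0st; rewrite in_itv.
by move=> x xst; apply: Hc; rewrite in_itv.
Qed.

Lemma deriv_sign : (forall x, s <= x <= t -> 0 < D^`().[x]) \/
  (forall x, s <= x <= t -> D^`().[x] < 0).
Proof.
have sI : s <= s <= t by rewrite lexx ltW.
have H (x : R) : s <= x <= t -> D^`().[s] * D^`().[x] < 0 -> False.
  move=> /andP[sx xt] neg.
  have mm : Num.min D^`().[s] D^`().[x] <= 0 <= Num.max D^`().[s] D^`().[x].
    rewrite ge_min le_max.
    have [h|h] := leP D^`().[s] 0; have [h'|h'] := leP D^`().[x] 0.
    - by have hh := mulr_le0 h h'; rewrite leNgt neg in hh.
    - by rewrite (ltW h') orbT.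
    - by rewrite (ltW h).
    - by have hh := mulr_gt0 h h'; rewrite ltNge (ltW neg) in hh.
  have cD : {within `[s, x], continuous (horner D^`())}.
    by apply: continuous_subspaceT; exact: continuous_horner.
  have [c] := IVT sx cD mm; rewrite in_itv/= => /andP[sc cx] E.
  by have := dD (x := c); rewrite E eqxx sc (le_trans cx xt) => /(_ isT).
have : D^`().[s] != 0 by exact: dD.
rewrite neq_lt => /orP[neg|pos]; [right|left] => x xI.
- have := dD xI; rewrite neq_lt => /orP[//|h]; exfalso; apply: (H x xI).
  by rewrite nmulr_rlt0.
- have := dD xI; rewrite neq_lt => /orP[h|//]; exfalso; apply: (H x xI).
  by rewrite pmulr_rlt0.
Qed.

Lemma discr_expanding : exists2 d : R, 0 < d &
  forall x y, s <= x <= t -> s <= y <= t -> d * `|x - y| <= `|D.[x] - D.[y]|.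
Proof.
have [d d0 Hd] := deriv_lower_bound; exists d => //.
have H x y : s <= x -> x < y -> y <= t -> d * `|y - x| <= `|D.[y] - D.[x]|.
  move=> sx xy yt; have [c /andP[xc cy] ->] := MVT_on derD sx xy yt.
  rewrite normrM; apply: ler_wpM2r => //; apply: Hd.
  by rewrite (le_trans sx (ltW xc))/= (le_trans (ltW cy)).
move=> x y /andP[sx xt] /andP[sy yt]; have [xy|yx|->] := ltgtP x y.
- by rewrite distrC [leRHS]distrC; exact: H.
- exact: H.
- by rewrite !subrr normr0 mulr0.
Qed.

(** The continuous inverse of [D] on [[s, t]], extended by constants; outside the
    image of [D] it takes an end value, where the test functions vanish. *)
Lemma discr_inverse : exists r : R -> R,
  [/\ continuous r, forall y, s <= r y <= t,
      forall x, s <= x <= t -> r D.[x] = x &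
      forall y, [\/ D.[r y] = y, r y = s | r y = t]].
Proof.
have [d d0 Hd] := discr_expanding.
pose m := Num.min D.[s] D.[t]; pose M := Num.max D.[s] D.[t].
pose cl y := Num.max m (Num.min y M).
have mM : m <= M by rewrite ge_min le_max lexx.
have cl_in y : m <= cl y <= M.
  by rewrite /cl le_max lexx/= ge_max mM/= ge_min lexx orbT.
have ex y : exists x, s <= x <= t /\ D.[x] = cl y.
  have cD : {within `[s, t], continuous (horner D)}.
    by apply: continuous_subspaceT; exact: continuous_horner.
  by have [x] := IVT (ltW st) cD (cl_in y); rewrite in_itv/= => xst E; exists x.
have [r Hr] := choice ex.
have rI y : s <= r y <= t by have [] := Hr y.
have rD y : D.[r y] = cl y by have [] := Hr y.
have inj x y : s <= x <= t -> s <= y <= t -> D.[x] = D.[y] -> x = y.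
  move=> xI yI E; have := Hd x y xI yI; rewrite E subrr normr0.
  rewrite pmulr_rle0// => h; apply/eqP; rewrite -subr_eq0 -normr_eq0.
  by rewrite eq_le h normr_ge0.
have clid x : s <= x <= t -> cl D.[x] = D.[x].
  move=> xI.
  suff : m <= D.[x] <= M by move=> /andP[h1 h2]; rewrite /cl (min_l h2) (max_r h1).
  have mono (u v : R) : s <= u -> u <= v -> v <= t ->
      (forall z, s <= z <= t -> 0 < D^`().[z]) -> D.[u] <= D.[v].
    move=> su; rewrite le_eqVlt => /predU1P[->//|uv] vt pos.
    have [c /andP[uc cv] E] := MVT_on derD su uv vt.
    rewrite -subr_ge0 E mulr_ge0 ?subr_ge0 ?(ltW uv)// ltW// pos//.
    by rewrite (le_trans su (ltW uc))/= (le_trans (ltW cv)).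
  have monoN (u v : R) : s <= u -> u <= v -> v <= t ->
      (forall z, s <= z <= t -> D^`().[z] < 0) -> D.[v] <= D.[u].
    move=> su; rewrite le_eqVlt => /predU1P[->//|uv] vt neg.
    have [c /andP[uc cv] E] := MVT_on derD su uv vt.
    rewrite -subr_le0 E mulr_le0_ge0 ?subr_ge0 ?(ltW uv)// ltW// neg//.
    by rewrite (le_trans su (ltW uc))/= (le_trans (ltW cv)).
  rewrite /m /M ge_min le_max; move/andP: xI => [sx xt].
  case: deriv_sign => H.
    by rewrite (mono s x) ?(mono x t) ?orbT.
  by rewrite (monoN x t) ?(monoN s x) ?orbT.
have clL x y : `|cl x - cl y| <= `|x - y|.
  have mn (u v w : R) : `|Num.min u w - Num.min v w| <= `|u - v|.
    have A := ler_norm (u - v); have B := ler_norm (- (u - v)); rewrite normrN in B.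
    rewrite /Num.min; case: ltP => h1; case: ltP => h2;
    by rewrite ler_norml; apply/andP; split; lra.
  have mx (u v w : R) : `|Num.max w u - Num.max w v| <= `|u - v|.
    have A := ler_norm (u - v); have B := ler_norm (- (u - v)); rewrite normrN in B.
    rewrite /Num.max; case: ltP => h1; case: ltP => h2;
    by rewrite ler_norml; apply/andP; split; lra.
  exact: le_trans (mx _ _ _) (mn _ _ _).
exists r; split=> //.
- move=> y; apply/cvgrPdist_le => e e0; near=> z.
  rewrite -(ler_pM2l d0); apply: le_trans (Hd _ _ (rI _) (rI _)) _.
  rewrite !rD; apply: le_trans (clL _ _) _.
  near: z; have de : 0 < d * e by exact: mulr_gt0.
  by exists (d * e) => //= z; rewrite /= => /ltW.
- by move=> x xI; apply: inj => //; rewrite rD clid.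
- move=> y; have sI : s <= s <= t by rewrite lexx ltW.
  have tI : s <= t <= t by rewrite lexx ltW.
  have : [\/ cl y = y, cl y = D.[s] | cl y = D.[t]].
    rewrite /cl /M /m; rewrite /Num.max /Num.min.
    by repeat (case: ifP => _); constructor.
  case=> E; [constructor 1|constructor 2|constructor 3].
  + by rewrite rD.
  + by apply: inj => //; rewrite rD.
  + by apply: inj => //; rewrite rD.
Unshelve. all: by end_near. Qed.

End DiscriminantInverse.

(** * Local law for eventually periodic coefficients *)
Section DividedDifference.
Context {R : realType}.
Implicit Types (D : {poly R}).

(** The coefficients in [x] of the divided difference
    [(D(x) - D(xi)) / (x - xi)]. *)
Definition dquot D n k : {poly R} :=
  \sum_(j < n.+1 | (k < j)%N) D`_j *: 'X^(j - k.+1).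

Lemma dquot_poly D n (xi : R) : (size D <= n.+1)%N ->
  ('X - xi%:P) * (\sum_(k < n) (dquot D n k).[xi] *: 'X^k) = D - D.[xi]%:P.
Proof.
move=> sD.
have DE : D = \sum_(j < n.+1) D`_j *: 'X^j.
  rewrite -poly_def; apply/polyP => i; rewrite coef_poly; case: ltnP => // ni.
  by rewrite nth_default// (leq_trans sD).
have Dxi : D.[xi] = \sum_(j < n.+1) D`_j * xi ^+ j by exact: horner_coef_wide.
rewrite [in RHS]Dxi {2}DE rmorph_sum -sumrB/=.
have -> : \sum_(k < n) (dquot D n k).[xi] *: 'X^k =
    \sum_(j < n.+1) D`_j *: \sum_(k < j) (xi%:P ^+ (j.-1 - k) * 'X^k) :> {poly R}.
  transitivity (\sum_(k < n) \sum_(j < n.+1 | (k < j)%N)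
     D`_j *: (xi%:P ^+ (j.-1 - k) * 'X^k) : {poly R}).
    apply: eq_bigr => k _; rewrite horner_sum scaler_suml; apply: eq_bigr => j kj.
    rewrite hornerZ hornerXn -scalerA -polyC_exp mul_polyC; congr (_ *: (_ ^+ _ *: _)).
    by rewrite subnS predn_sub.
  rewrite (exchange_big_dep xpredT)//=; apply: eq_bigr => j _.
  rewrite scaler_sumr (big_ord_widen n (fun k => D`_j *: (xi%:P ^+ (j.-1 - k) * 'X^k)))//.
  by rewrite -ltnS.
rewrite mulr_sumr; apply: eq_bigr => j _.
have := subrXX (xi%:P) ('X : {poly R}) j => E.
rewrite -scalerAr -(opprB xi%:P) mulNr -E opprB scalerBr; congr (_ - _).
by rewrite polyCM -mul_polyC polyC_exp.
Qed.

Lemma dquotE D n (x xi : R) : (size D <= n.+1)%N ->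
  (x - xi) * (\sum_(k < n) x ^+ k * (dquot D n k).[xi]) = D.[x] - D.[xi].
Proof.
move=> sD; have := congr1 (horner^~ x) (dquot_poly xi sD).
rewrite /= hornerM hornerXsubC horner_sum hornerD hornerN !hornerC => <-.
by congr (_ * _); apply: eq_bigr => k _; rewrite hornerZ hornerXn mulrC.
Qed.

Lemma dquot_diag D n (x : R) : (size D <= n.+1)%N ->
  \sum_(k < n) x ^+ k * (dquot D n k).[x] = D^`().[x].
Proof.
move=> sD; have := congr1 (fun q : {poly R} => q^`().[x]) (dquot_poly x sD).
rewrite /= derivM derivXsubC mul1r hornerD hornerM hornerXsubC subrr mul0r addr0.
rewrite derivB derivC subr0 horner_sum => <-.
by apply: eq_bigr => k _; rewrite hornerZ hornerXn mulrC.
Qed.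

Lemma dquot_top D n : dquot D n.+1 n = (D`_n.+1)%:P.
Proof.
rewrite /dquot (big_pred1 ord_max) ?subnn ?expr0 ?alg_polyC// => j /=.
rewrite -val_eqE /=; have := ltn_ord j; rewrite ltnS => jn.
by rewrite eqn_leq jn.
Qed.

End DividedDifference.

Section LocalDecomposition.
Context {R : realType}.
Variables (D : {poly R}) (n : nat) (s t : R) (r : R -> R).
Hypothesis sD : (size D <= n.+1)%N.
Hypothesis st : s < t.
Hypothesis dD : forall x, s <= x <= t -> D^`().[x] != 0.
Hypotheses (rc : continuous r) (rI : forall y, s <= r y <= t)
  (rK : forall x, s <= x <= t -> r D.[x] = x)
  (rP : forall y, [\/ D.[r y] = y, r y = s | r y = t]).
Variable F : R -> R.
Hypothesis Fc : continuous F.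
Hypothesis F0 : forall x, ~~ (s < x < t) -> F x = 0.

(** Coefficients for writing a test function as a combination of [1, x, ...,
    x ^ (n - 1)] over the functions of [D(x)]. *)
Definition fiber_coef k (y : R) : R := F (r y) * (dquot D n k).[r y] / D^`().[r y].

Lemma fiber_coef_continuous k : continuous (fiber_coef k).
Proof.
move=> y; apply: cvgM; first apply: cvgM.
- by apply: (continuous_comp (f := r)); [exact: rc|exact: Fc].
- by apply: (continuous_comp (f := r)); [exact: rc|exact: continuous_horner].
apply: cvgV; first exact: dD.
by apply: (continuous_comp (f := r)); [exact: rc|exact: continuous_horner].
Qed.

(** Lagrange interpolation on the fibre of [D] through [x]: for [D(xi) = D(x)] the
    divided difference vanishes unless [x = xi], where it is the derivative. The
    only point of the fibre at which the function may be nonzero is [xi = r (D x)]. *)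
Lemma fiber_decomposition x : F x = \sum_(k < n) x ^+ k * fiber_coef k D.[x].
Proof.
rewrite /fiber_coef; set xi := r D.[x].
have -> : \sum_(k < n) x ^+ k * (F xi * (dquot D n k).[xi] / D^`().[xi]) =
    F xi / D^`().[xi] * \sum_(k < n) x ^+ k * (dquot D n k).[xi].
  by rewrite mulr_sumr; apply: eq_bigr => k _; ring.
have [xI|xI] := boolP (s <= x <= t).
  have xiE : xi = x by exact: rK.
  by rewrite xiE dquot_diag// divfK// dD.
rewrite F0; last by apply: contraNN xI => /andP[/ltW -> /ltW ->].
have xix : x - xi != 0.
  by rewrite subr_eq0; apply: contraNneq xI => ->; exact: rI.
case: (rP D.[x]) => E.
- have := dquotE x xi sD; rewrite E subrr => /eqP; rewrite mulf_eq0 (negPf xix)/= => /eqP ->.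
  by rewrite mulr0.
- by rewrite /xi E F0 ?mul0r// ltxx.
- by rewrite /xi E F0 ?mul0r// ltxx andbF.
Qed.

Hypothesis ell : forall x, s <= x <= t -> D.[x] ^+ 2 < 4.

Let half x : s <= x <= t -> -1 < D.[x] / 2 < 1.
Proof.
move=> /ell h.
have : `|D.[x]| < 2.
  by rewrite -(ltr_pXn2r (n := 2)) ?nnegrE// real_normK ?num_real//; lra.
by rewrite ltr_norml => /andP[h1 h2]; apply/andP; split; lra.
Qed.

Let theta x := acos (D.[x] / 2).
Let theta' x := - (D^`().[x] / 2) / Num.sqrt (1 - (D.[x] / 2) ^+ 2).

Let one_minus x : s <= x <= t -> 0 < 1 - (D.[x] / 2) ^+ 2.
Proof. by move=> /ell h; rewrite exprMn; lra. Qed.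

Let dtheta x : s <= x <= t -> is_derive x (1 : R) theta (theta' x).
Proof.
move=> xI.
have d1 : is_derive x (1 : R) (fun x => D.[x] / 2) (D^`().[x] / 2).
  have := is_deriveZ (2^-1 : R) (is_derive_poly D x).
  rewrite /GRing.scale/= mulrC => H.
  by rewrite (_ : (fun x => D.[x] / 2) = (2^-1 \*: horner D))//; apply/funext => z;
    rewrite mulrC.
have := is_derive1_comp (f := acos) (g := fun x : R => D.[x] / 2) (is_derive1_acos (half xI)) d1.
by rewrite (_ : theta' x = - (Num.sqrt (1 - (D.[x] / 2) ^+ 2))^-1 * (D^`().[x] / 2))// /theta' !mulNr mulrC.
Qed.

Let ctheta' x : s <= x <= t -> {for x, continuous theta'}.
Proof.
move=> xI; rewrite /theta'; apply: cvgM.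
  by apply: cvgN; apply: cvgM; [exact: continuous_horner|exact: cvg_cst].
apply: cvgV; first by rewrite gt_eqF// sqrtr_gt0 one_minus.
apply: (continuous_comp (f := fun x => 1 - (D.[x] / 2) ^+ 2)); last exact: sqrt_continuous.
apply: cvgB; first exact: cvg_cst.
apply: (continuous_comp (f := fun x => D.[x] / 2) (g := fun z => z ^+ 2)); last exact: exprn_continuous.
by apply: cvgM; [exact: continuous_horner|exact: cvg_cst].
Qed.

Let G (u : R) := F (r (2 * cos u)) / D^`().[r (2 * cos u)] * sin u ^+ 2.

Let cG : continuous G.
Proof.
have c1 : continuous (fun u : R => r (2 * cos u)).
  move=> u; apply: (continuous_comp (f := fun u : R => 2 * cos u)); last exact: rc.
  by apply: cvgM; [exact: cvg_cst|exact: continuous_cos].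
move=> u; apply: cvgM; first apply: cvgM.
- by apply: (continuous_comp (f := fun u => r (2 * cos u))); [exact: c1|exact: Fc].
- apply: cvgV; first exact: dD.
  by apply: (continuous_comp (f := fun u => r (2 * cos u))); [exact: c1|exact: continuous_horner].
apply: (continuous_comp (f := sin) (g := fun z : R => z ^+ 2)).
  exact: continuous_sin.
exact: exprn_continuous.
Qed.

Let theta_pi x : s <= x <= t -> 0 <= theta x <= pi.
Proof.
by move=> /half/andP[h1 h2]; rewrite /theta acos_ge0 ?acos_lepi// ?(ltW h1) ?(ltW h2).
Qed.

Let G_theta x : s <= x <= t -> G (theta x) = F x / D^`().[x] * (1 - (D.[x] / 2) ^+ 2).
Proof.
move=> xI; have /andP[h1 h2] := half xI.
have hI : -1 <= D.[x] / 2 <= 1 by rewrite !ltW.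
rewrite /G /theta acosK ?in_itv//= sin_acos// sqr_sqrtr; last exact/ltW/one_minus.
by have -> : 2 * (D.[x] / 2) = D.[x]; [by field|rewrite rK].
Qed.

Let G_support lo hi : (forall x, s <= x <= t -> lo <= theta x <= hi) ->
  forall u, 0 <= u <= pi -> ~~ (lo <= u <= hi) -> G u = 0.
Proof.
move=> H u u0pi uout; rewrite /G; case: (rP (2 * cos u)) => E.
- exfalso; move/negP: uout; apply.
  have := H _ (rI (2 * cos u)); rewrite /theta E.
  by rewrite [2 * _]mulrC mulfK// cosK// in_itv.
- by rewrite E F0 ?mul0r// ltxx.
- by rewrite E F0 ?mul0r// ltxx andbF.
Qed.

Let sq4 x : s <= x <= t ->
  Num.sqrt (4 - D.[x] ^+ 2) = 2 * Num.sqrt (1 - (D.[x] / 2) ^+ 2).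
Proof.
move=> xI; have -> : 4 - D.[x] ^+ 2 = 2 ^+ 2 * (1 - (D.[x] / 2) ^+ 2) by field.
by rewrite sqrtrM ?sqr_ge0// sqrtr_sqr ger0_norm.
Qed.

Let dens_theta x : s <= x <= t ->
  G (theta x) * theta' x = - (1 / 4) * (F x * Num.sqrt (4 - D.[x] ^+ 2)).
Proof.
move=> xI; rewrite G_theta// sq4// /theta'.
have m0 := one_minus xI.
have sp : Num.sqrt (1 - (D.[x] / 2) ^+ 2) != 0 by rewrite gt_eqF// sqrtr_gt0.
rewrite -{1}(sqr_sqrtr (ltW m0)); have := dD xI; move: sp.
by move: (Num.sqrt _) (D^`().[x]) => w e w0 e0; field; rewrite w0 e0.
Qed.

Let dens_cont : {within `[s, t], continuous (fun x => F x * Num.sqrt (4 - D.[x] ^+ 2))}.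
Proof.
apply: continuous_subspaceT => x; apply: cvgM; first exact: Fc.
apply: (continuous_comp (f := fun x => 4 - D.[x] ^+ 2)); last exact: sqrt_continuous.
apply: cvgB; first exact: cvg_cst.
apply: (continuous_comp (f := horner D) (g := fun z => z ^+ 2)); last exact: exprn_continuous.
exact: continuous_horner.
Qed.

(** The substitution [D(x) = 2 cos theta]. *)
Lemma semicircle_fiber sigma :
  (forall x, s <= x <= t -> Num.sg D^`().[x] = sigma) ->
  semicircle (fun y => F (r y) / D^`().[r y]) =
  sigma / (2 * pi) * ival (fun x => F x * Num.sqrt (4 - D.[x] ^+ 2)) s t.
Proof.
move=> sgD; have pne : pi != 0 :> R by rewrite gt_eqF// pi_gt0.
suff E : ival G 0 pi =
    sigma / 4 * ival (fun x => F x * Num.sqrt (4 - D.[x] ^+ 2)) s t.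
  rewrite /semicircle -[ival _ 0 pi]/(ival G 0 pi) E.
  by move: (pi : R) pne => P P0; field.
have sI : s <= s <= t by rewrite lexx ltW.
have tI : s <= t <= t by rewrite lexx ltW.
have /andP[ts0 tspi] := theta_pi sI; have /andP[tt0 ttpi] := theta_pi tI.
case: (deriv_sign st dD) => H.
  rewrite -(sgD s sI) (gtr0_sg (H s sI)).
  have th0 x : s <= x <= t -> theta' x < 0.
    move=> xI; rewrite /theta' mulNr oppr_lt0 divr_gt0//.
      by rewrite divr_gt0// H.
    by rewrite sqrtr_gt0 one_minus.
  have [lt E] := ival_subst_decr st dtheta ctheta' th0 cG.
  have mono x : s <= x <= t -> theta t <= theta x <= theta s.
    move=> /andP[sx xt]; apply/andP; split.
    - move: xt; rewrite le_eqVlt => /predU1P[->//|xt].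
      have [c /andP[xc ct] E'] := MVT_on dtheta sx xt (lexx t).
      rewrite -subr_le0 E' nmulr_rle0 ?subr_ge0 ?(ltW xt)// th0//.
      by rewrite (ltW ct) (le_trans sx (ltW xc)).
    - move: sx; rewrite le_eqVlt => /predU1P[->//|sx].
      have [c /andP[sc cx] E'] := MVT_on dtheta (lexx s) sx xt.
      rewrite -subr_le0 E' nmulr_rle0 ?subr_ge0 ?(ltW sx)// th0//.
      by rewrite (ltW sc) (le_trans (ltW cx) xt).
  rewrite (ival_support (a := theta t) (b := theta s))//; last exact: G_support.
  rewrite E -(ivalZ _ dens_cont).
  by apply: ival_eq => x xI; rewrite mulrN dens_theta//; ring.
rewrite -(sgD s sI) (ltr0_sg (H s sI)).
have th0 x : s <= x <= t -> 0 < theta' x.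
  move=> xI; rewrite /theta' divr_gt0//.
    by rewrite oppr_gt0 pmulr_llt0// H.
  by rewrite sqrtr_gt0 one_minus.
have [lt E] := ival_subst_incr st dtheta ctheta' th0 cG.
have mono x : s <= x <= t -> theta s <= theta x <= theta t.
  move=> /andP[sx xt]; apply/andP; split.
  - move: sx; rewrite le_eqVlt => /predU1P[->//|sx].
    have [c /andP[sc cx] E'] := MVT_on dtheta (lexx s) sx xt.
    rewrite -subr_ge0 E' pmulr_rge0 ?subr_ge0 ?(ltW sx)// th0//.
    by rewrite (ltW sc) (le_trans (ltW cx) xt).
  - move: xt; rewrite le_eqVlt => /predU1P[->//|xt].
    have [c /andP[xc ct] E'] := MVT_on dtheta sx xt (lexx t).
    rewrite -subr_ge0 E' pmulr_rge0 ?subr_ge0 ?(ltW xt)// th0//.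
    by rewrite (ltW ct) (le_trans sx (ltW xc)).
rewrite (ival_support (a := theta s) (b := theta t))//; last exact: G_support.
rewrite E -(ivalZ _ dens_cont).
by apply: ival_eq => x xI; rewrite dens_theta//; ring.
Qed.

End LocalDecomposition.

Section LocalLaw.
Context {R : realType}.
Variables a b : nat -> R.
Hypothesis a_gt0 : forall n, 0 < a n.
Local Notation p := (orth_poly a b).
Local Notation quad := (quad b a_gt0).
Variables l N : nat.
Hypothesis N_gt0 : (0 < N)%N.
Hypothesis a_per : forall j, (l <= j)%N -> a (j + N)%N = a j.
Hypothesis b_per : forall j, (l < j)%N -> b (j + N)%N = b j.
Variable B : R.
Hypotheses (aB : forall n, a n <= B) (bB : forall n, `|b n| <= B).
Local Notation D := (disc_poly a b l N).
Local Notation T := (turan_poly a b l N).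

Lemma semicircle_sum n (c : nat -> R) :
  semicircle (fun y => (\sum_(k < n) c k *: chebU k).[y]) =
  \sum_(k < n) c k * (k == 0%N :> nat)%:R.
Proof.
have cc (q : {poly R}) : continuous (fun y => q.[y]) by exact: continuous_horner.
elim: n => [|n IH].
  rewrite !big_ord0 -[RHS](mul0r (semicircle (fun=> 0))) -semicircleZ; last exact: cst_continuous.
  by congr semicircle; apply/funext => y; rewrite horner0 mulr0.
rewrite [RHS]big_ord_recr/= -IH -semicircle_chebU -semicircleZ; last exact: cc.
rewrite -semicircleD; [|exact: cc|]; last first.
  by move=> y; apply: cvgM; [exact: cvg_cst|exact: cc].
by congr semicircle; apply/funext => y; rewrite big_ord_recr hornerD hornerZ.
Qed.

(** Expansion in Chebyshev polynomials: [quad_chebU] says that [x ^ j h(D) T] is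
    integrated like [h] against the semicircle law if [j = N - 1], and to zero
    otherwise. *)
Lemma quad_disc_poly j (h : {poly R}) : (j < N)%N -> exists M0, forall M, (M0 <= M)%N ->
  quad M (fun x => x ^+ j * h.[D.[x]] * T.[x]) =
  (j == N.-1)%:R * (\prod_(i < N) a (l + i)%N) * semicircle (horner h).
Proof.
move=> jN; have [c hc] := chebU_expand (leqnn (size h)).
exists (l.+2 + size h * N)%N => M hM.
rewrite {2}hc semicircle_sum.
transitivity (quad M (fun x => \sum_(k < size h)
    c k * (x ^+ j * (chebU k).[D.[x]] * T.[x]))).
  apply: quad_eq => x _; rewrite {1}hc horner_sum mulr_sumr mulr_suml.
  by apply: eq_bigr => k _; rewrite hornerZ; ring.
rewrite quad_sum mulr_sumr; apply: eq_bigr => k _.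
rewrite quadZ (quad_chebU a_gt0 N_gt0 a_per b_per)//.
  by rewrite andbC; case: (j == _); case: (_ == _); rewrite /= ?(mul0r, mulr0)//; ring.
have : (k.+1 * N <= size h * N)%N by rewrite leq_mul2r ltn_ord orbT.
by move: hM; move: (k.+1 * N)%N (size h * N)%N => u v; lia.
Qed.

Lemma disc_poly_lead : (size D <= N.+1)%N /\
  D`_N * \prod_(i < N) a (l + i)%N = 1.
Proof.
have [_ h00] := size_entry_col0 a b l.+1 N.
have [_ h11 e11] := size_entry_col1 a b l.+1 N.
have h00' : (size (entry a b l.+1 N 0%R 0%R) <= N)%N.
  by apply: leq_trans h00 _; rewrite geq_max N_gt0 leqnn.
split.
  apply: leq_trans (size_polyD _ _) _; rewrite geq_max h11 andbT.
  exact: leqW.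
rewrite /disc_poly coefD (nth_default 0 h00') add0r e11.
have -> : \prod_(i < N) a (l + i)%N = \prod_(i < N) a (l.+1 + i)%N.
  have [N' NE] : exists N', N = N'.+1 by exists N.-1; rewrite prednK.
  rewrite NE big_ord_recl big_ord_recr /= addn0 mulrC; congr (_ * _).
    by apply: eq_bigr => i _; rewrite /bump /= addnA addn1.
  by rewrite -(a_per (leqnn l)) NE addnS.
by rewrite -big_split/= big1// => i _; rewrite mulVf// gt_eqF.
Qed.

Lemma quad_near M F G (c : R) : (0 < M)%N ->
  (forall x, x \in nodes b a_gt0 M -> `|F x - G x| <= c) ->
  `|quad M F - quad M G| <= c.
Proof.
move=> M0 H; have q1 := quad_one b a_gt0 M0.
have qc (e : R) : quad M (fun=> e) = e.
  by rewrite -[RHS]mulr1 -q1 -quadZ; apply: quad_eq => x _; rewrite mulr1.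
have le1 : quad M F <= quad M (fun x => G x + c).
  by apply: quad_le => x /H; rewrite ler_norml => /andP[]; lra.
have le2 : quad M G <= quad M (fun x => F x + c).
  by apply: quad_le => x /H; rewrite ler_norml => /andP[]; lra.
by move: le1 le2; rewrite !quadD !qc ler_norml => ? ?; apply/andP; split; lra.
Qed.

Variables s t : R.
Hypothesis st : s < t.
Hypothesis ell : forall x, s <= x <= t -> D.[x] ^+ 2 < 4.

Let E := entry a b l.+1 N.

Let ellE x : s <= x <= t ->
  ((E 0 0).[x] - (E 1 1).[x]) ^+ 2 + 4 * (E 0 1).[x] * (E 1 0).[x] < 0.
Proof.
move=> /ell; rewrite /disc_poly -/E hornerD.
have := congr1 (horner^~ x) (per_det b a_gt0 a_per); rewrite -/E.
rewrite /= !(hornerD, hornerN, hornerM, hornerC).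
move: (E 0 0).[x] (E 0 1).[x] (E 1 0).[x] (E 1 1).[x] => e00 e01 e10 e11 det h.
have -> : (e00 - e11) ^+ 2 + 4 * e01 * e10 =
  (e00 + e11) ^+ 2 - 4 * (e00 * e11 - e01 * e10) by ring.
by rewrite det; lra.
Qed.

Lemma disc_turan_sign x : s <= x <= t -> 0 < D^`().[x] * T.[x].
Proof.
move=> xI; have h1 := disc_deriv_sign a_gt0 N_gt0 (ltn0Sn l) (ellE xI)
  (per_det b a_gt0 a_per).
have h2 := turan_sign a_gt0 (ellE xI).
rewrite -/E -/D in h1 h2.
have := mulr_gt0 h1 h2; set e := (E 0 1).[x].
rewrite -[(E 0 0 + E 1 1)^`()]/(D^`()).
have -> : e * D^`().[x] * (e * T.[x]) = e ^+ 2 * (D^`().[x] * T.[x]) by ring.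
rewrite pmulr_rgt0// lt_neqAle sqr_ge0 andbT eq_sym sqrf_eq0.
by apply: contraTneq h1; rewrite /e => ->; rewrite mul0r ltxx.
Qed.

(** Divide [F] by [T], decompose the quotient over the fibres of [D], and
    approximate the coefficients by polynomials uniformly on the range of [D] over
    the nodes. Of the [N] coefficients only the last contributes in the limit,
    and there [fiber_coef] reduces to the leading coefficient of [D]. *)
Lemma local_law F : continuous F -> (forall x, ~~ (s < x < t) -> F x = 0) ->
  forall eps : R, 0 < eps -> exists M0, forall M, (M0 <= M)%N ->
  `|quad M F - 1 / (2 * pi) *
     ival (fun x => F x * (Num.sqrt (4 - D.[x] ^+ 2) / `|T.[x]|)) s t| <= eps.
Proof.
move=> Fc F0 eps eps0.
have DT := disc_turan_sign.
have T0 x : s <= x <= t -> T.[x] != 0.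
  by move=> /DT; apply: contraTneq => ->; rewrite mulr0 ltxx.
have dD x : s <= x <= t -> D^`().[x] != 0.
  by move=> /DT; apply: contraTneq => ->; rewrite mul0r ltxx.
have [sD lead] := disc_poly_lead.
pose F1 x := F x / T.[x].
have F1c : continuous F1.
  move=> x; have [xI|xI] := boolP (s <= x <= t).
    by apply: cvgM; [exact: Fc|apply: cvgV; [exact: T0|exact: continuous_horner]].
  have F1x : F1 x = 0.
    by rewrite /F1 F0 ?mul0r//; apply: contraNN xI => /andP[/ltW -> /ltW ->].
  rewrite /continuous_at F1x.
  have O : open (~` `[s, t]%classic) by apply: closed_openC; exact: itv_closed.
  have nO : nbhs x (~` `[s, t]%classic).
    by apply: open_nbhs_nbhs; split => //=; rewrite in_itv/=; exact/negP.
  apply: cvg_near_cst; apply: filterS nO => z /= /negP; rewrite in_itv/= => zI.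
  by rewrite /F1 F0 ?mul0r//; apply: contraNN zI => /andP[/ltW -> /ltW ->].
have F10 x : ~~ (s < x < t) -> F1 x = 0 by move=> xI; rewrite /F1 (F0 x xI) mul0r.
have F1T x : F x = F1 x * T.[x].
  have [xI|xI] := boolP (s <= x <= t); first by rewrite /F1 divfK// T0.
  have F00 : F x = 0 by rewrite F0//; apply: contraNN xI => /andP[/ltW -> /ltW ->].
  by rewrite /F1 F00 !mul0r.
have [r [rc rI rK rP]] := discr_inverse st dD.
pose h k := fiber_coef D N r F1 k.
have hc k : continuous (h k) by exact: (fiber_coef_continuous (s := s) (t := t)).
have hF x : F1 x = \sum_(k < N) x ^+ k * h k D.[x].
  exact: (fiber_decomposition (s := s) (t := t)).
have [sigma sg] : exists sigma, forall x, s <= x <= t -> Num.sg D^`().[x] = sigma.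
  case: (deriv_sign st dD) => H; [exists 1|exists (-1)] => x /H.
    exact: gtr0_sg.
  exact: ltr0_sg.
pose A := \prod_(i < N) a (l + i)%N.
have A0 : 0 < A by apply: prodr_gt0.
have B0 : 0 < B by exact: lt_le_trans (a_gt0 0) (aB 0%N).
have [C1 C10 HC1] := poly_bounded D (- (3 * B)) (3 * B).
have Cex (k : 'I_N) : exists C : R, 0 <= C /\ forall x, - (3 * B) <= x <= 3 * B ->
    `|('X^k * T).[x]| <= C.
  by have [C ? ?] := poly_bounded ('X^k * T) (- (3 * B)) (3 * B); exists C.
have [C HC] := choice Cex.
pose S := \sum_k C k + 2 * A.
have SC : 0 <= \sum_k C k by apply: sumr_ge0 => k _; have [] := HC k.
have S0 : 0 < S by rewrite /S ltr_wpDl// mulr_gt0.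
pose eta := eps / S; have eta0 : 0 < eta by rewrite divr_gt0.
have C12 : 0 < C1 + 2 by rewrite ltr_wpDl.
have qex (k : 'I_N) : exists q : {poly R}, forall y, `|y| <= C1 + 2 -> `|h k y - q.[y]| <= eta.
  exact: weierstrass_approximation.
have [q Hq] := choice qex.
have Mex (k : 'I_N) : exists M0, forall M, (M0 <= M)%N ->
  quad M (fun x => x ^+ k * (q k).[D.[x]] * T.[x]) =
  (k == N.-1 :> nat)%:R * A * semicircle (horner (q k)).
  exact: quad_disc_poly.
have [M0 HM0] := choice Mex.
exists (\max_k M0 k).+1 => M hM.
have M_gt0 : (0 < M)%N by exact: leq_trans hM.
pose Q x := \sum_(k < N) x ^+ k * (q k).[D.[x]] * T.[x].
have step1 : `|quad M F - quad M Q| <= eta * \sum_k C k.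
  apply: quad_near => // x xM.
  have xB : - (3 * B) <= x <= 3 * B.
    by rewrite -ler_norml; exact: (node_bound aB bB xM).
  rewrite F1T hF mulr_suml -sumrB mulr_sumr.
  apply: le_trans (ler_norm_sum _ _ _) _; apply: ler_sum => k _.
  have -> : x ^+ k * h k D.[x] * T.[x] - x ^+ k * (q k).[D.[x]] * T.[x] =
     (h k D.[x] - (q k).[D.[x]]) * ('X^k * T).[x].
    by rewrite hornerM hornerXn; ring.
  rewrite normrM; apply: ler_pM => //; last by have [_] := HC k; exact.
  by apply: Hq; apply: le_trans (HC1 _ xB) _; rewrite lerDl.
have [N' NE] : exists N', N = N'.+1 by exists N.-1; rewrite prednK.
have N'N : (N' < N)%N by rewrite NE.
pose k0 : 'I_N := Ordinal N'N.
have step2 : quad M Q = A * semicircle (horner (q k0)).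
  rewrite /Q quad_sum (bigD1 k0)// big1.
    have kE : (k0 : nat) = N.-1 by exact: esym (congr1 predn NE).
    rewrite /= addr0 -/(nat_of_ord k0) (HM0 k0) ?kE ?eqxx ?mul1r//.
    by apply: leq_trans (ltnW hM); exact: leq_bigmax.
  move=> k /= kk0; rewrite HM0.
    suff -> : (k == N.-1 :> nat) = false by rewrite !mul0r.
    by apply/negP => /eqP kE; move/negP: kk0; apply; apply/eqP/val_inj; exact: etrans kE (congr1 predn NE).
  by apply: leq_trans (ltnW hM); exact: leq_bigmax.
have step3 : `|A * semicircle (horner (q k0)) - A * semicircle (h k0)| <= A * (2 * eta).
  rewrite -mulrBr normrM (gtr0_norm A0); apply: ler_wpM2l; first exact: ltW.
  apply: semicircle_near; [exact: continuous_horner|exact: hc|exact: ltW|].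
  move=> y y2; rewrite distrC; apply: Hq.
  by apply: (@le_trans _ _ 2); [rewrite ler_norml|rewrite lerDr].
have step4 : A * semicircle (h k0) = 1 / (2 * pi) *
     ival (fun x => F x * (Num.sqrt (4 - D.[x] ^+ 2) / `|T.[x]|)) s t.
  have hE : h k0 = (fun y => D`_N * (F1 (r y) / D^`().[r y])).
    by apply/funext => y; rewrite /h /fiber_coef /= {1 2}NE dquot_top hornerC -NE; ring.
  rewrite hE semicircleZ; last first.
    move=> y; apply: cvgM.
      by apply: (continuous_comp (f := r)); [exact: rc|exact: F1c].
    apply: cvgV; first exact: dD.
    by apply: (continuous_comp (f := r)); [exact: rc|exact: continuous_horner].
  rewrite mulrA [A * _]mulrC lead mul1r.
  rewrite (semicircle_fiber st dD rc rI rK rP F1c F10 ell sg).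
  rewrite !mul1r [sigma / _]mulrC -mulrA; congr (_ * _).
  rewrite -ivalZ.
    apply: ival_eq => x xI; rewrite -(sg x xI) /F1.
    have tx := T0 x xI; have dt := DT x xI.
    have -> : Num.sg D^`().[x] = T.[x] / `|T.[x]|.
      have [T_neg|T_pos|T_0] := ltgtP T.[x] 0; last by move: tx; rewrite T_0 eqxx.
        by move: dt; rewrite nmulr_lgt0// => /ltr0_sg ->; rewrite ltr0_norm// invrN mulrN divff.
      by move: dt; rewrite pmulr_lgt0// => /gtr0_sg ->; rewrite gtr0_norm// divff.
    have nt : `|T.[x]| != 0 by rewrite normr_eq0.
    by field; rewrite nt tx.
  apply: continuous_subspaceT => x; apply: cvgM; first exact: F1c.
  apply: (continuous_comp (f := fun x => 4 - D.[x] ^+ 2)); last exact: sqrt_continuous.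
  apply: cvgB; first exact: cvg_cst.
  apply: (continuous_comp (f := horner D) (g := fun z => z ^+ 2)); last exact: exprn_continuous.
  exact: continuous_horner.
rewrite -step4 -(subrKA (quad M Q)); apply: le_trans (ler_normD _ _) _.
rewrite -step2 in step3; apply: le_trans (lerD step1 step3) _.
have -> : eta * \sum_k C k + A * (2 * eta) = eta * S by rewrite /S; ring.
by rewrite /eta divfK// gt_eqF.
Qed.

End LocalLaw.

(** * Convergence of the Turan determinants *)
Section UniformLimits.
Context {R : realType}.
Implicit Types (f g : nat -> R -> R) (K : set R).

Lemma ucvg_continuous f (l : R -> R) : (forall n, continuous (f n)) ->
  ucvg setT f l -> continuous l.
Proof.
move=> fc fl x; apply/cvgrPdist_le => eps eps0.
have e3 : 0 < eps / 3 by rewrite divr_gt0.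
have [n H] := fl _ e3.
have /cvgrPdist_le/(_ _ e3) := fc n x.
apply: filterS => y; have := H n x (leqnn _) I; have := H n y (leqnn _) I.
by rewrite !ler_norml => /andP[? ?] /andP[? ?] /andP[? ?]; apply/andP; split; lra.
Qed.

Lemma ucvg_ext K f g (l l' : R -> R) : (forall n x, K x -> f n x = g n x) ->
  (forall x, K x -> l x = l' x) -> ucvg K f l -> ucvg K g l'.
Proof.
move=> fg ll fl eps /fl[n0 H]; exists n0 => n x nn Kx.
by rewrite -fg// -ll//; exact: H.
Qed.

Lemma ucvg_shift K f (l : R -> R) k : ucvg K f l -> ucvg K (fun n => f (n + k)%N) l.
Proof.
by move=> fl eps /fl[n0 H]; exists n0 => n x nn; apply: H; exact: leq_trans (leq_addr _ _).
Qed.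

Lemma ucvg_unshift K f (l : R -> R) k : ucvg K (fun n => f (n + k)%N) l -> ucvg K f l.
Proof.
move=> fl eps /fl[n0 H]; exists (n0 + k)%N => n x nk Kx.
have kn : (k <= n)%N by apply: leq_trans nk; exact: leq_addl.
by have := H (n - k)%N x; rewrite subnK//; apply => //; rewrite leq_subRL// addnC.
Qed.

Lemma ucvgM K f g (l l' : R -> R) (M : R) :
  (forall x, K x -> `|l x| <= M /\ `|l' x| <= M) ->
  ucvg K f l -> ucvg K g l' -> ucvg K (fun n x => f n x * g n x) (fun x => l x * l' x).
Proof.
move=> lM fl gl eps eps0.
pose B := `|M| + 1; have B0 : 0 < B by rewrite ltr_wpDl.
pose e := Num.min 1 (eps / (2 * B)).
have e0 : 0 < e by rewrite lt_min ltr01 divr_gt0// mulr_gt0.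
have [n1 H1] := fl _ e0; have [n2 H2] := gl _ e0.
exists (maxn n1 n2) => n x; rewrite geq_max => /andP[nn1 nn2] Kx.
have := H1 n x nn1 Kx; have := H2 n x nn2 Kx; rewrite !le_min.
move=> /andP[g1 g2] /andP[_ f2]; have [lx lx'] := lM x Kx.
have MB : M <= B - 1 by rewrite /B addrK ler_norm.
have gB : `|g n x| <= B.
  rewrite -(subrK (l' x) (g n x)); apply: le_trans (ler_normD _ _) _; lra.
have -> : f n x * g n x - l x * l' x = (f n x - l x) * g n x + l x * (g n x - l' x) by ring.
apply: le_trans (ler_normD _ _) _; rewrite !normrM.
have := ler_pM (normr_ge0 _) (normr_ge0 _) f2 gB.
have := ler_pM (normr_ge0 _) (normr_ge0 _) lx g2.
have eB : eps / (2 * B) * B = eps / 2 by field; rewrite gt_eqF.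
have : M * (eps / (2 * B)) <= B * (eps / (2 * B)).
  by apply: ler_wpM2r; [rewrite divr_ge0 ?mulr_ge0 ?ltW|lra].
by rewrite [B * _]mulrC eB; lra.
Qed.

Lemma ucvg_norm K f (l : R -> R) : ucvg K f l ->
  ucvg K (fun n x => `|f n x|) (fun x => `|l x|).
Proof.
move=> fl eps /fl[n0 H]; exists n0 => n x nn Kx.
by apply: le_trans (H n x nn Kx); exact: ler_dist_dist.
Qed.

Lemma ucvg_sqrt K f (l : R -> R) (k : R) : 0 < k ->
  (forall x, K x -> k <= l x) -> ucvg K f l ->
  ucvg K (fun n x => Num.sqrt (f n x)) (fun x => Num.sqrt (l x)).
Proof.
move=> k0 kl fl eps eps0.
have sk0 : 0 < Num.sqrt k by rewrite sqrtr_gt0.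
have e0 : 0 < Num.min k (eps * Num.sqrt k) by rewrite lt_min k0 mulr_gt0.
have [n0 H] := fl _ e0; exists n0 => n x nn Kx.
have := H n x nn Kx; rewrite le_min => /andP[h1 h2].
have kx := kl x Kx; have lx0 : 0 <= l x by lra.
have fx0 : 0 <= f n x by move: h1; rewrite ler_norml => /andP[]; lra.
have sl : Num.sqrt k <= Num.sqrt (l x) by rewrite ler_sqrt// (le_trans _ kx)// ltW.
have s0 : Num.sqrt k <= Num.sqrt (f n x) + Num.sqrt (l x).
  by rewrite (le_trans sl)// lerDr sqrtr_ge0.
have E : f n x - l x =
  (Num.sqrt (f n x) - Num.sqrt (l x)) * (Num.sqrt (f n x) + Num.sqrt (l x)).
  by rewrite -subr_sqr !sqr_sqrtr.
rewrite -(ler_pM2r sk0); apply: le_trans h2.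
rewrite E normrM; apply: ler_wpM2l => //.
by apply: le_trans s0 (ler_norm _).
Qed.

Definition clamp (s t x : R) : R := Num.max s (Num.min x t).

Lemma clamp_in s t x : s <= t -> s <= clamp s t x <= t.
Proof.
rewrite /clamp => st; case: (leP x t) => ?; [case: (leP s x)|case: (leP s t)] => ?;
  by apply/andP; split; lra.
Qed.

Lemma clamp_id s t x : s <= x <= t -> clamp s t x = x.
Proof. by move=> /andP[? ?]; rewrite /clamp (min_idPl _)// (max_idPr _). Qed.

Lemma clamp_near s t x (e : R) : s <= t -> 0 <= e -> s - e <= x <= t + e ->
  `|clamp s t x - x| <= e.
Proof.
rewrite /clamp => st e0 /andP[? ?]; rewrite ler_norml.
case: (leP x t) => ?; [case: (leP s x)|case: (leP s t)] => ?;
  by apply/andP; split; lra.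
Qed.

Lemma clamp_continuous s t : continuous (clamp s t).
Proof.
move=> x; apply: (@continuous_max R R (fun=> s) (fun x => Num.min x t)).
  exact: cvg_cst.
by apply: (@continuous_min R R id (fun=> t)); [exact: cvg_id|exact: cvg_cst].
Qed.

Lemma negative_near_segment (h : {poly R}) c d : c < d ->
  (forall x, c <= x <= d -> h.[x] < 0) ->
  exists eta k : R, [/\ 0 < eta, 0 < k &
    forall x, c - eta <= x <= d + eta -> h.[x] <= - k].
Proof.
move=> cd hneg; have hc : continuous (horner h) by exact: continuous_horner.
have [z zI hz] : exists2 z, z \in `[c, d] & forall t, t \in `[c, d] -> h.[t] <= h.[z].
  by apply: EVT_max; [exact: ltW|exact: continuous_subspaceT].
have z0 : h.[z] < 0 by apply: hneg; move: zI; rewrite in_itv.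
pose k := - h.[z] / 2; have k0 : 0 < k by rewrite divr_gt0// oppr_gt0.
have [eta eta0 He] := uniform_continuity (@segment_compact R c d) hc k0.
exists (eta / 2), k; split; [by rewrite divr_gt0|by []|].
move=> x xI; pose y := clamp c d x.
have yI : c <= y <= d by exact: clamp_in (ltW cd).
have yx : `|y - x| < eta.
  have e0 : 0 <= eta / 2 by rewrite divr_ge0 ?ltW.
  apply: le_lt_trans (clamp_near (ltW cd) e0 xI) _.
  by rewrite ltr_pdivrMr// ltr_pMr// ltr1n.
have : h.[y] <= h.[z] by apply: hz; rewrite in_itv.
have := He y x; rewrite /= in_itv/= => /(_ yI yx); rewrite ler_norml /k => /andP[]; lra.
Qed.

End UniformLimits.

Section TuranLimit.
Context {R : realType}.
Variables (a b : nat -> R) (N r i : nat) (c d : R).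
Local Notation p := (orth_poly a b).
Local Notation L := (fun n => (n.+1 * N + i)%N).

(** The index starts at the second block, [n.+1 * N + i], so that the predecessor
    of the starting index is meaningful for [i = 0]. *)
Definition block_discr n : {poly R} :=
  let E := entry a b (n.+1 * N + i) N in
  (E 0 0 + E 1 1) ^+ 2 - 4%:P * (E 0 0 * E 1 1 - E 0 1 * E 1 0).

Lemma block_discrE n x : discr (step_mx a b N (n.+1 * N + i) x) = (block_discr n).[x].
Proof.
rewrite /discr /block_discr /mxtrace big_ord2 (expand_det_row _ 0) big_ord2.
have XE := step_mxE a b N (n.+1 * N + i) x.
move: (step_mx _ _ _ _ _) XE => X XE; rewrite /cofactor !det_mx11 !mxE.
have -> : lift 0 0 = 1 :> 'I_2 by exact: val_inj.
have -> : lift 1 0 = 0 :> 'I_2 by exact: val_inj.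
rewrite !XE /= expr0 expr1 mul1r mulN1r mulrN.
by rewrite !(hornerD, hornerN, hornerM, hornerC, horner_exp).
Qed.

Lemma size_block_discr n : (size (block_discr n) <= (2 * N).+1)%N.
Proof.
have s s1 t1 s2 t2 : (size (entry a b (L n) N s1 t1 * entry a b (L n) N s2 t2)%R <= (2 * N).+1)%N.
  apply: leq_trans (size_polyMleq _ _) _.
  have := size_entry a b (L n) N s1 t1; have := size_entry a b (L n) N s2 t2.
  by move: (size _) (size _) => u v; lia.
have sD (q1 q2 : {poly R}) : (size q1 <= (2 * N).+1)%N -> (size q2 <= (2 * N).+1)%N ->
    (size (q1 + q2)%R <= (2 * N).+1)%N.
  by move=> h1 h2; apply: leq_trans (size_polyD _ _) _; rewrite geq_max h1 h2.
rewrite /block_discr expr2 mulrDl mul_polyC; apply: (sD).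
  by rewrite !mulrDr; apply: (sD); apply: (sD); exact: s.
rewrite size_polyN; apply: leq_trans (size_scale_leq _ _) _.
by apply: sD; rewrite ?size_polyN; exact: s.
Qed.

Hypothesis cd : c < d.

Lemma discr_limit : `[c, d] `<=` Lambda a b N i ->
  exists h : {poly R}, (forall x, c <= x <= d -> h.[x] = discr_lim a b N i x /\ h.[x] < 0) /\
  forall c' d', ucvg `[c', d']%classic (fun n x => (block_discr n).[x]) (horner h).
Proof.
move=> KL.
have cv x : c <= x <= d -> (fun n => (block_discr n).[x]) @ \oo --> discr_lim a b N i x.
  move=> xI; have [|+ _] := KL x; first by rewrite /= in_itv.
  move=> cvx; rewrite (_ : (fun n => _) = (fun n => discr (step_mx a b N (n.+1 * N + i) x))).
    by have := cvg_shiftS (fun n => discr (step_mx a b N (n * N + i) x)); move=> ->; exact: cvx.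
  by apply/funext => n; rewrite block_discrE.
have [h Hh] := poly_pointwise_ucvg cd size_block_discr (fun x xI => cvgP _ (cv x xI)).
exists h; split=> // x xI.
have hx : h.[x] = discr_lim a b N i x.
  apply: (cvg_unique _ _ (cv x xI)) => //; apply/cvgrPdist_le => eps eps0.
  have [n0 H] := Hh c d _ eps0; exists n0 => // n /= nn.
  by rewrite distrC; apply: H; rewrite //= in_itv.
by split=> //; rewrite hx; have [|_] := KL x; first by rewrite /= in_itv.
Qed.

Hypotheses (a_gt0 : forall n, 0 < a n) (N_gt0 : (0 < N)%N) (r_gt0 : (0 < r)%N).
Hypothesis a_lim : (fun n : nat => a (n.+1 * N + i).-1 / a (n * N + i).-1) @ \oo
               --> (1 : R).
Hypothesis X_D : Dclass r `[c, d]%classic (fun n : nat => step_mx a b N (n * N + i)).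

Definition turan n x : R := a (L n + N).-1 *
  `|(p (L n)).[x] * (p (L n + N).-1).[x] - (p (L n).-1).[x] * (p (L n + N)%N).[x]|.

(** The Turan determinant is the energy of the orbit of [(p_(L-1), p_L)] under the
    block transfer matrices, with weights [a_(L-1)], times the square root of the
    discriminant and a ratio of coefficients tending to [1]. As a uniform limit the
    modulus of the energy is continuous, hence bounded away from zero. *)
Lemma turan_limit (h : {poly R}) (k c' d' : R) : 0 < k -> c' <= d' ->
  ucvg `[c', d']%classic (fun n x => (block_discr n).[x]) (horner h) ->
  (forall x, c' <= x <= d' -> h.[x] <= - k) ->
  exists (g : R -> R) (m : R), [/\ 0 < m, continuous g, forall x, m <= g x &
    ucvg `[c', d']%classic turan g].
Proof.
move=> k0 cd' hlim hk; set K := `[c', d']%classic in hlim *.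
have Kin x : K x = (c' <= x <= d') :> Prop by rewrite /K /= in_itv.
pose e s t n x := (entry a b (L n) N s t).[x].
have reg s t : regular r K 0 r (e s t) by exact: (Dclass_regular _ _ _ _ r_gt0 cd X_D).
have [M M0 HM] := order_ge_bounded (regular_order (reg 0 1)).
have discE n x : discr2 (e 0 0 n x) (e 0 1 n x) (e 1 0 n x) (e 1 1 n x) = (block_discr n).[x].
  rewrite /discr2 /block_discr !(hornerD, hornerN, hornerM, hornerC, horner_exp) /e.
  by ring.
have [n0 Hn0] := hlim _ (divr_gt0 k0 (ltr0n _ 2)).
have disc_le n x : (n0 <= n)%N -> K x -> (block_discr n).[x] <= - (k / 2).
  move=> nn Kx; have := Hn0 n x nn Kx; have := hk x; rewrite -Kin => /(_ Kx).
  by rewrite ler_norml => ? /andP[]; lra.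
pose al n := a (L n).-1.
have al0 n : 0 < al n by exact: a_gt0.
have Lpos n : (0 < L n)%N by rewrite mulSn -addnA addn_gt0 N_gt0.
have LS n : (L n + N)%N = L n.+1 by rewrite /= [in RHS]mulSn; lia.
pose en n x := energy (e 0 0 n x) (e 0 1 n x) (e 1 0 n x) (e 1 1 n x)
    (p (L n).-1).[x] (p (L n)).[x] (al n).
have : nonzero_ulimit K en.
  apply: (@nonzero_ulimit_shift _ _ _ n0).
  (* A negative discriminant and a bounded entry above the diagonal keep the
     entry below the diagonal away from zero. *)
  pose k1 := Num.min (k / (8 * M)) (Num.sqrt (k / 2)).
  apply: (@elliptic_energy_converges _ r K r_gt0 _ _ _ _
     (fun n x => (p (L (n + n0)%N).-1).[x]) (fun n x => (p (L (n + n0)%N)).[x])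
     (fun n x => al (n + n0)%N) k1).
  - by split; exact: (regular_shift _ (reg _ _)).
  - by rewrite lt_min divr_gt0 ?mulr_gt0//= sqrtr_gt0 divr_gt0.
  - move=> n x Kx; have dl := disc_le (n + n0)%N x (leq_addl _ _) Kx.
    split; last first.
      rewrite discE ge_min; apply/orP; right; rewrite ler_sqrt; lra.
    rewrite ge_min; apply/orP; left.
    move: dl; rewrite -discE /discr2; move: (HM (n + n0)%N x Kx).
    move: (e 0 0 _ x) (e 0 1 _ x) (e 1 0 _ x) (e 1 1 _ x) => e1 e2 e3 e4 b2 dl.
    have : k / 2 <= 4 * (`|e2| * `|e3|).
      have := ler_norm (- (e2 * e3)); rewrite normrN normrM; have := sqr_ge0 (e4 - e1); nra.
    have : `|e2| * `|e3| <= M * `|e3| by apply: ler_wpM2r.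
    move=> z2 z1; rewrite ler_pdivrMr ?mulr_gt0//.
    rewrite (_ : `|e3| * (8 * M) = 8 * (M * `|e3|)); last by ring.
    lra.
  - split.
    + move=> n x Kx; rewrite addSn -LS.
      have := @transport_orth_poly _ a b (L (n + n0)%N) N (Lpos _).
      by rewrite transport_lin => -[<- _]; rewrite !hornerE.
    + move=> n x Kx; rewrite addSn -LS.
      have := @transport_orth_poly _ a b (L (n + n0)%N) N (Lpos _).
      by rewrite transport_lin => -[_ <-]; rewrite !hornerE.
    + move=> n x Kx.
      have := congr1 (horner^~ x) (entry_det b (n := L (n + n0)%N) N (Lpos _) (fun k => lt0r_neq0 (a_gt0 k))).
      rewrite /= !(hornerD, hornerN, hornerM, hornerC) /e => ->.
      by rewrite addSn /al -LS mulrC divfK// gt_eqF.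
    + move=> n x Kx; split; first by rewrite gt_eqF.
      have [Ln LnE] : exists m, L (n + n0)%N = m.+1 by exists (L (n + n0)%N).-1; rewrite prednK.
      by rewrite LnE; exact: orth_poly_no_common_root.
    + move=> n; have [B1 _ HB1] := poly_bounded (p (L (n + n0)%N).-1) c' d'.
      have [B2 _ HB2] := poly_bounded (p (L (n + n0)%N)) c' d'.
      exists (Num.max `|al (n + n0)%N| (Num.max B1 B2)) => x; rewrite Kin => Kx.
      by rewrite !le_max HB1// HB2// lexx !orbT.
move=> [G [MG [Glim G0]]].
have [B B0 HB] := poly_bounded h c' d'.
have ratio : (fun n => al n.+1 / al n) @ \oo --> (1 : R).
  have := cvg_shiftS (fun n => a (n.+1 * N + i).-1 / a (n * N + i).-1).
  by move=> ->; exact: a_lim.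
have ratiou : ucvg K (fun n _ => al n.+1 / al n) (fun=> 1).
  move=> eps eps0; have /cvgrPdist_le/(_ _ eps0)[n1 _ H] := ratio.
  by exists n1 => n x nn _; rewrite distrC; exact: H.
have sqrtu : ucvg K (fun n x => Num.sqrt (- (block_discr n).[x])) (fun x => Num.sqrt (- h.[x])).
  apply: (ucvg_sqrt (f := fun n x => - (block_discr n).[x]) (l := fun x => - h.[x]) k0).
    by move=> x; rewrite Kin => /hk; lra.
  move=> eps /hlim[n1 H]; exists n1 => n x nn Kx.
  by rewrite -opprD normrN; exact: H.
have turE n x : (n0 <= n)%N -> K x ->
    al n.+1 / al n * (Num.sqrt (- (block_discr n).[x]) * `|en n x|) = turan n x.
  move=> nn Kx; have dl := disc_le n x nn Kx.
  have s0 : 0 < Num.sqrt (- (block_discr n).[x]) by rewrite sqrtr_gt0; lra.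
  rewrite /en /energy discE /turan normrM normfV (gtr0_norm s0).
  rewrite [X in `|X|](_ : _ = al n * - ((p (L n)).[x] * (p (L n + N).-1).[x] - (p (L n).-1).[x] * (p (L n + N)%N).[x])).
    rewrite normrM normrN (gtr0_norm (al0 n)) LS /al.
    by field; rewrite !gt_eqF.
  have := @transport_orth_poly _ a b (L n) N (Lpos _).
  rewrite transport_lin => -[<- <-]; rewrite !(hornerD, hornerM) /e /=.
  move: (p _) (p _) (entry _ _ _ _ _ _) (entry _ _ _ _ _ _) (entry _ _ _ _ _ _)
    (entry _ _ _ _ _ _) => q1 q2 q3 q4 q5 q6.
  by ring.
have gl : ucvg K turan (fun x => Num.sqrt (- h.[x]) * `|G x|).
  apply: (@ucvg_unshift _ K _ _ n0).
  apply: (ucvg_ext (f := fun n x => al (n + n0).+1 / al (n + n0)%N * (Num.sqrt (- (block_discr (n + n0)%N).[x]) * `|en (n + n0)%N x|)) (l := fun x => 1 * (Num.sqrt (- h.[x]) * `|G x|))).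
  - by move=> n x Kx; apply: turE => //; exact: leq_addl.
  - by move=> x _; rewrite mul1r.
  have bs x : K x -> `|Num.sqrt (- h.[x])| <= Num.sqrt B.
    rewrite Kin => Kx; rewrite ger0_norm ?sqrtr_ge0// ler_wsqrtr//.
    by have := HB x Kx; rewrite ler_norml => /andP[]; lra.
  have bg x : K x -> `| (`|G x|) | <= `|MG|.
    by move=> /G0[_ h1]; rewrite normr_id; apply: le_trans h1 (ler_norm _).
  apply: (ucvgM (M := Num.max 1 (Num.sqrt B * `|MG|))).
  - move=> x Kx; rewrite normr1 !le_max lexx; split => //; apply/orP; right.
    by rewrite normrM; apply: ler_pM => //; [exact: bs|exact: bg].
  - exact: (@ucvg_shift _ K (fun n _ => al n.+1 / al n) _ n0).
  apply: (@ucvg_shift _ K (fun n x => Num.sqrt (- (block_discr n).[x]) * `|en n x|) _ n0).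
  apply: (ucvgM (M := Num.max (Num.sqrt B) `|MG|)) => //.
  - by move=> x Kx; rewrite !le_max bs// bg// orbT.
  - exact: ucvg_norm.
pose cl := clamp c' d'.
have clc : continuous cl by exact: clamp_continuous.
have clK x : K (cl x) by rewrite Kin; exact: clamp_in.
have clid x : K x -> cl x = x by rewrite Kin; exact: clamp_id.
pose g x := Num.sqrt (- h.[cl x]) * `|G (cl x)|.
have gc : continuous g.
  apply: (@ucvg_continuous _ (fun n x => turan n (cl x))).
    move=> n x; apply: cvgM; first exact: cvg_cst.
    apply: cvg_norm; apply: cvgB; apply: cvgM;
      by apply: (continuous_comp (f := cl)); [exact: clc|exact: continuous_horner].
  move=> eps /gl[n1 H]; exists n1 => n x nn _; exact: H.
have [z zI Hz] : exists2 z, z \in `[c', d'] & forall t, t \in `[c', d'] -> g z <= g t.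
  by apply: EVT_min => //; exact: continuous_subspaceT.
exists g, (g z); split=> //.
- rewrite /g mulr_gt0//; last by rewrite normr_gt0; have [] := G0 _ (clK z).
  by rewrite sqrtr_gt0; have := hk (cl z); rewrite -Kin => /(_ (clK z)); lra.
- move=> x; have -> : g x = g (cl x) by rewrite /g (clid (cl x)).
  by apply: Hz; have := clK x; rewrite Kin in_itv.
- by apply: ucvg_ext gl => // x Kx; rewrite /g clid.
Qed.

End TuranLimit.

(** * A measure from an ultralimit of positive functionals *)
Section Ultralimit.
Context {R : realType} {I : Type} (U : set_system I) {UU : UltraFilter U}.

(** Ultrafilters replace the selection of a convergent subsequence: all bounded
    functionals converge simultaneously. *)
Lemma ultralimit_exists (u : I -> R) (B : R) : (forall i, `|u i| <= B) ->
  exists l : R, u i @[i --> U] --> l.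
Proof.
move=> uB; have PU : ProperFilter U by exact: ultra_proper.
have segm : (u @ U) `[(- B), B]%classic.
  apply: (@filterS _ U _ setT); last exact: filterT.
  by move=> i _; rewrite /= in_itv/= -ler_norml uB.
have [l [_ cl]] := @segment_compact R (- B) B (u @ U) (fmap_proper_filter u PU) segm.
exists l => V Vl; have [//|UV] := in_ultra_setVsetC (u @^-1` V) UU.
by have [y [/= nVy Vy]] := cl (~` V) V UV Vl.
Qed.

Lemma ultralimit_le (u v : I -> R) (l m : R) : (forall i, u i <= v i) ->
  u i @[i --> U] --> l -> v i @[i --> U] --> m -> l <= m.
Proof.
move=> uv ul vm; have PU : ProperFilter U by exact: ultra_proper.
apply/ler_addgt0Pr => e e0; have e2 : 0 < e / 2 by rewrite divr_gt0.
have /cvgrPdist_le/(_ _ e2) U1 := ul; have /cvgrPdist_le/(_ _ e2) U2 := vm.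
have [i [/=]] := filter_ex (filterI U1 U2); have := uv i.
by rewrite !ler_norml => ? /andP[? ?] /andP[? ?]; lra.
Qed.

Lemma ultralimit_unique (u : I -> R) (l m : R) :
  u i @[i --> U] --> l -> u i @[i --> U] --> m -> l = m.
Proof.
by move=> ul um; apply/eqP; rewrite eq_le (ultralimit_le _ ul um) ?(ultralimit_le _ um ul).
Qed.

End Ultralimit.

Section Trapezoid.
Context {R : realType}.
Implicit Types (s t e x : R).

(** The trapezoidal function equal to [1] on [[s, t]] and to [0] outside
    [[s - e, t + e]]. *)
Definition trap s t e x : R := clamp 0 1 (Num.min (x - s + e) (t + e - x) / e).

Lemma trap_continuous s t e : continuous (trap s t e).
Proof.
move=> x; apply: (continuous_comp (f := fun x => Num.min (x - s + e) (t + e - x) / e)).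
  apply: cvgM; last exact: cvg_cst.
  apply: (@continuous_min R R (fun x => x - s + e) (fun x => t + e - x)).
    by apply: cvgD; [apply: cvgB; [exact: cvg_id|exact: cvg_cst]|exact: cvg_cst].
  by apply: cvgB; [exact: cvg_cst|exact: cvg_id].
exact: clamp_continuous.
Qed.

Lemma trap_in s t e x : 0 <= trap s t e x <= 1.
Proof. by apply: clamp_in; exact: ler01. Qed.

Lemma trap1 s t e x : 0 < e -> s <= x <= t -> trap s t e x = 1.
Proof.
move=> e0 /andP[sx xt]; apply/eqP; rewrite eq_le; have /andP[_ ->] := trap_in s t e x.
rewrite /trap /clamp le_max; apply/orP; right.
by rewrite le_min lexx andbT ler_pdivlMr// mul1r le_min; apply/andP; split; lra.
Qed.

Lemma trap0 s t e x : 0 < e -> ~~ (s - e < x < t + e) -> trap s t e x = 0.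
Proof.
move=> e0; rewrite negb_and -!leNgt => xst.
apply/eqP; rewrite eq_le; have /andP[-> _] := trap_in s t e x; rewrite andbT.
rewrite /trap /clamp ge_max lexx/= ge_min; apply/orP; left.
rewrite pmulr_lle0 ?invr_gt0// ge_min.
by case/orP: xst => h; apply/orP; [left|right]; lra.
Qed.

End Trapezoid.

Section Expectation.
Context {R : realType} (nu : probability (measurableTypeR R) R).
Implicit Types (f g : R -> R).

Definition ig f : Prop := nu.-integrable setT (EFin \o f).
Definition mean f : R := \int[nu]_x f x.

Lemma ig_bounded f (B : R) : measurable_fun setT f -> (forall x, `|f x| <= B) -> ig f.
Proof.
move=> mf fB; apply: measurable_bounded_integrable => //.
  by apply: le_lt_trans (probability_le1 nu (@measurableT _ _)) _; exact: ltry.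
exists B; split; first exact: num_real.
by move=> y By x _ /=; apply: le_trans (fB x) (ltW By).
Qed.

Lemma ig_le f g : measurable_fun setT f -> (forall x, `|f x| <= g x) -> ig g -> ig f.
Proof.
move=> mf fg; apply: le_integrable => //; first exact/measurable_EFinP.
by move=> x _ /=; rewrite lee_fin; apply: le_trans (fg x) (ler_norm _).
Qed.

Lemma igD f g : ig f -> ig g -> ig (fun x => f x + g x).
Proof. exact: integrableD. Qed.

Lemma igZ (c : R) f : ig f -> ig (fun x => c * f x).
Proof. exact: integrableZl. Qed.

Lemma igB f g : ig f -> ig g -> ig (fun x => f x - g x).
Proof. exact: integrableB. Qed.

Lemma meanD f g : ig f -> ig g -> mean (fun x => f x + g x) = mean f + mean g.
Proof. exact: RintegralD. Qed.

Lemma meanB f g : ig f -> ig g -> mean (fun x => f x - g x) = mean f - mean g.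
Proof. exact: RintegralB. Qed.

Lemma meanZ (c : R) f : ig f -> mean (fun x => c * f x) = c * mean f.
Proof. exact: RintegralZl. Qed.

Lemma mean_le f g : ig f -> ig g -> (forall x, f x <= g x) -> mean f <= mean g.
Proof. by move=> If Ig fg; apply: le_Rintegral. Qed.

Lemma mean_near f g (w : R -> R) : ig f -> ig g -> ig w ->
  (forall x, `|f x - g x| <= w x) -> `|mean f - mean g| <= mean w.
Proof.
move=> If Ig Iw fg; have Id := igB If Ig.
rewrite -meanB// ler_norml -mulN1r -meanZ//.
by apply/andP; split; apply: mean_le => //; [exact: igZ|move=> x|move=> x];
  have := fg x; rewrite ler_norml ?mulN1r => /andP[].
Qed.

Lemma ig_cst (c : R) : ig (fun=> c).
Proof. exact: finite_measure_integrable_cst. Qed.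

Lemma mean_cst (c : R) : mean (fun=> c) = c.
Proof.
rewrite /mean Rintegral_cst//.
have nu1 : nu setT = 1%E by exact: probability_setT.
by rewrite -[RHS]mulr1; congr (_ * _); exact: (congr1 fine nu1).
Qed.

Lemma mean_indic (A : set R) : measurable (A : set (measurableTypeR R)) ->
  mean (\1_A) = fine (nu A).
Proof. by move=> mA; rewrite /mean /Rintegral integral_indic// setIT. Qed.

Lemma ig_indic (A : set R) : measurable (A : set (measurableTypeR R)) -> ig (\1_A).
Proof.
move=> mA; apply: (ig_bounded (B := 1)); first exact: measurable_indic.
by move=> x; rewrite indicE; case: (x \in A); rewrite ?normr1 ?normr0.
Qed.

Lemma mean_EFin f : ig f -> (\int[nu]_x (f x)%:E)%E = (mean f)%:E.
Proof. by move=> If; rewrite /mean /Rintegral fineK//; exact: integrable_fin_num. Qed.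

End Expectation.

Section StepApproximation.
Context {R : realType}.

Definition step (t x : R) : R := (x <= t)%R%:R.

Definition step_sum (f t : nat -> R) (m : nat) (x : R) : R :=
  \sum_(j < m) f j.+1 * (step (t j.+1) x - step (t j) x).

Lemma step_sumS f t m x : step_sum f t m.+1 x =
  step_sum f t m x + f m.+1 * (step (t m.+1) x - step (t m) x).
Proof. by rewrite /step_sum big_ord_recr. Qed.

Lemma step_sum_near (f : R -> R) (t : nat -> R) (eps : R) m : (forall j, t j <= t j.+1) ->
  (forall j x, (j < m)%N -> t j < x <= t j.+1 -> `|f x - f (t j.+1)| <= eps) ->
  forall x, (t 0%N < x <= t m -> `|f x - step_sum (f \o t) t m x| <= eps) /\
            (~~ (t 0%N < x <= t m) -> step_sum (f \o t) t m x = 0).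
Proof.
move=> tS; elim: m => [|m IH] H x.
  by split; [move=> /andP[/lt_le_trans/[apply]]; rewrite ltxx|rewrite /step_sum big_ord0].
have [h1 h2] := IH (fun j x jm => H j x (ltnW jm)) x.
have t0m : t 0%N <= t m.
  by elim: (m) => [//|k]; move=> h; exact: le_trans h (tS k).
rewrite step_sumS /step; have tm := tS m.
case: (leP x (t m)) => xm.
  have xS : x <= t m.+1 by exact: le_trans tm.
  by rewrite xS /= subrr mulr0 addr0 andbT; move: h1 h2; rewrite xm andbT.
case: (leP x (t m.+1)) => xS.
  have x0 : t 0%N < x by exact: le_lt_trans xm.
  rewrite x0 /= h2; last by rewrite negb_and -!leNgt -ltNge xm orbT.
  by rewrite add0r subr0 mulr1; split => // _; apply: H => //; rewrite xm.
rewrite andbF; split => // _; rewrite subrr mulr0 addr0; apply: h2.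
by rewrite negb_and -ltNge xm orbT.
Qed.

(** Abel summation moves the differences to [f], where they are small; the sum of
    [G j - F j] is at most the telescoping sum of [F j.+1 - F j]. *)
Lemma abel_squeeze (f F G : nat -> R) (eps : R) m : 0 <= eps ->
  f 0%N = 0 -> f m = 0 ->
  (forall j, (j < m)%N -> `|f j.+1 - f j| <= eps) ->
  (forall j, F j <= G j) -> (forall j, G j <= F j.+1) ->
  `|\sum_(j < m) f j.+1 * (G j.+1 - G j) - \sum_(j < m) f j.+1 * (F j.+1 - F j)|
  <= eps * (F m - F 0%N).
Proof.
move=> eps0 f0 fm fS FG GF.
have abel (H : nat -> R) n : \sum_(j < n) f j.+1 * (H j.+1 - H j) =
    f n * H n - f 0%N * H 0%N - \sum_(j < n) (f j.+1 - f j) * H j.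
  elim: n => [|n IH]; first by rewrite !big_ord0; ring.
  by rewrite !big_ord_recr/= IH; ring.
rewrite !abel f0 fm !mul0r !subr0 !sub0r opprK -sumrN -big_split/=.
have -> : F m - F 0%N = \sum_(j < m) (F j.+1 - F j).
  by rewrite -(big_mkord xpredT (fun j => F j.+1 - F j)) telescope_sumr.
rewrite mulr_sumr; apply: le_trans (ler_norm_sum _ _ _) _; apply: ler_sum => j _.
have -> : - ((f j.+1 - f j) * G j) + (f j.+1 - f j) * F j =
  (f j.+1 - f j) * (F j - G j) by ring.
rewrite normrM; apply: ler_pM => //; first exact: fS.
by rewrite ler_norml; have := FG j; have := GF j; move=> ? ?; apply/andP; split; lra.
Qed.

End StepApproximation.

Section LimitMeasure.
Context {R : realType} {I : Type} (U : set_system I) {UU : UltraFilter U}.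
Variable Q : I -> (R -> R) -> R.
Hypothesis QD : forall i F G, Q i (fun x => F x + G x) = Q i F + Q i G.
Hypothesis QZ : forall i c F, Q i (fun x => c * F x) = c * Q i F.
Hypothesis Q_le : forall i F G, (forall x, F x <= G x) -> Q i F <= Q i G.
Hypothesis Q1 : forall i, Q i (fun=> 1) = 1.
Variable Lam : {poly R} -> R.
Hypothesis QLam : forall q : {poly R}, Q i (horner q) @[i --> U] --> Lam q.
Local Arguments QLam : clear implicits.

Let PU : ProperFilter U. Proof. exact: ultra_proper. Qed.

Let Qc i (c : R) : Q i (fun=> c) = c.
Proof. by rewrite -[RHS]mulr1 -(Q1 i) -QZ; congr Q; apply/funext => x; rewrite mulr1. Qed.

Let QB i F G : Q i (fun x => F x - G x) = Q i F - Q i G.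
Proof.
rewrite -mulN1r -QZ -QD; congr Q; apply/funext => x; by rewrite mulN1r.
Qed.

Let Q_bound i F (B : R) : (forall x, `|F x| <= B) -> `|Q i F| <= B.
Proof.
move=> FB; rewrite ler_norml -[leLHS](Qc i (- B)) -[X in _ && (_ <= X)](Qc i B).
by apply/andP; split; apply: Q_le => x;
  have := FB x; rewrite ler_norml => /andP[].
Qed.

Let Q_near i F G (W : R -> R) : (forall x, `|F x - G x| <= W x) ->
  `|Q i F - Q i G| <= Q i W.
Proof.
move=> FG; rewrite -QB ler_norml -mulN1r -QZ.
by apply/andP; split; apply: Q_le => x; have := FG x; rewrite ler_norml ?mulN1r => /andP[].
Qed.

Let step01 (t x : R) : 0 <= step t x <= 1.
Proof. by rewrite /step; case: (x <= t); rewrite /= ?lexx ler01. Qed.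

Let raw_ex (t : R) : exists l : R, Q i (step t) @[i --> U] --> l.
Proof.
apply: (ultralimit_exists (B := 1)) => i; apply: Q_bound => x.
by rewrite /step; case: (x <= t); rewrite ?normr1 ?normr0 ?ler01.
Qed.

(** The limit of the distribution functions; right continuity may fail, and is
    restored by [cdf_reg]. *)
Definition raw_cdf t : R := projT1 (cid (raw_ex t)).
Local Notation F := raw_cdf.

Lemma raw_cdfP t : Q i (step t) @[i --> U] --> F t.
Proof. by rewrite /F; case: cid. Qed.
Local Arguments raw_cdfP : clear implicits.

Lemma raw_cdf_le s t : s <= t -> F s <= F t.
Proof.
move=> st; apply: (ultralimit_le _ (raw_cdfP s) (raw_cdfP t)) => i.
apply: Q_le => x; rewrite /step ler_nat; case: (leP x s) => // xs.
by rewrite (le_trans xs st).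
Qed.

Lemma raw_cdf01 t : 0 <= F t <= 1.
Proof.
apply/andP; split.
  apply: (ultralimit_le (u := fun=> 0) _ (cvg_cst _) (raw_cdfP t)) => i.
  by rewrite -(Qc i 0); apply: Q_le => x; have /andP[] := step01 t x.
apply: (ultralimit_le (v := fun=> 1) _ (raw_cdfP t) (cvg_cst _)) => i.
by rewrite -(Qc i 1); apply: Q_le => x; have /andP[] := step01 t x.
Qed.

Definition cdf_reg t : R := inf [set F s | s in [set s | t < s]].
Local Notation G := cdf_reg.

Let inf_hyp t : has_inf [set F s | s in [set s | t < s]].
Proof.
split; first by exists (F (t + 1)), (t + 1) => //=; rewrite ltrDl.
by exists 0 => _ [s _ <-]; have /andP[] := raw_cdf01 s.
Qed.

Lemma cdf_reg_ge t : F t <= G t.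
Proof.
apply: lb_le_inf; first by case: (inf_hyp t).
by move=> _ [s /= ts <-]; apply: raw_cdf_le; exact: ltW.
Qed.

Lemma cdf_reg_le s t : s < t -> G s <= F t.
Proof. by move=> st; apply: ge_inf; [case: (inf_hyp s)|exists t]. Qed.

Lemma cdf_reg_homo : nondecreasing G.
Proof.
move=> s t; rewrite le_eqVlt => /predU1P[->//|st].
by apply: le_trans (cdf_reg_le st) _; exact: cdf_reg_ge.
Qed.

Lemma cdf_reg01 t : 0 <= G t <= 1.
Proof.
have t1 : t < t + 1 by rewrite ltrDl.
have /andP[h1 _] := raw_cdf01 t; have /andP[_ h2] := raw_cdf01 (t + 1).
by rewrite (le_trans h1 (cdf_reg_ge t)) (le_trans (cdf_reg_le t1) h2).
Qed.

Lemma cdf_reg_right_continuous : right_continuous G.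
Proof.
move=> t; apply/cvgrPdist_le => eps eps0.
have [_ [s /= ts <-] Fs] := inf_adherent eps0 (inf_hyp t).
have : \forall z \near t^'+, t < z < s.
  by near=> z; apply/andP; split; near: z; [exact: nbhs_right_gt|exact: nbhs_right_lt].
apply: filterS => z /andP[tz zs].
have := cdf_reg_homo (ltW tz); have := cdf_reg_le zs; rewrite -/(G t) in Fs.
by rewrite ler_norml => ? ?; apply/andP; split; lra.
Unshelve. all: by end_near. Qed.

Let c2 := Lam 'X^2.

Let c20 : 0 <= c2.
Proof.
apply: (ultralimit_le (u := fun=> 0) _ (cvg_cst _) (QLam 'X^2)) => i.
by rewrite -(Qc i 0); apply: Q_le => x; rewrite hornerXn sqr_ge0.
Qed.

(* Chebyshev's inequality: the second moments make the sequence tight. *)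
Let raw_tail A : 0 < A -> F (- A) <= c2 / A ^+ 2 /\ 1 - F A <= c2 / A ^+ 2.
Proof.
move=> A0; have A20 : 0 < A ^+ 2 by rewrite exprn_gt0.
have lim : (A ^+ 2)^-1 * Q i (horner 'X^2) @[i --> U] --> c2 / A ^+ 2.
  by rewrite mulrC; apply: cvgM; [exact: cvg_cst|exact: QLam].
have cheb (x : R) : A <= `|x| -> 1 <= (A ^+ 2)^-1 * ('X^2 : {poly R}).[x].
  move=> Ax; rewrite mulrC hornerXn ler_pdivlMr// mul1r -[leRHS]real_normK ?num_real//.
  by apply: lerXn2r; rewrite ?nnegrE// ltW.
have cheb0 (x : R) : 0 <= (A ^+ 2)^-1 * ('X^2 : {poly R}).[x].
  by rewrite mulr_ge0 ?invr_ge0 ?(ltW A20)// hornerXn sqr_ge0.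
split.
  apply: (ultralimit_le _ (raw_cdfP (- A)) lim) => i; rewrite -QZ.
  apply: Q_le => x; rewrite /step; case: (leP x (- A)) => // xA; apply: cheb.
  by rewrite lerNr in xA; apply: le_trans xA _; rewrite -normrN ler_norm.
have lim1 : 1 - Q i (step A) @[i --> U] --> 1 - F A.
  by apply: cvgB; [exact: cvg_cst|exact: raw_cdfP].
apply: (ultralimit_le _ lim1 lim) => i; rewrite -QZ -(Q1 i) -QB.
apply: Q_le => x; rewrite /step; case: (leP x A) => xA; first by rewrite subrr.
by rewrite subr0; apply: cheb; apply: le_trans (ltW xA) (ler_norm _).
Qed.

Let tail_small (eps : R) : 0 < eps -> exists2 A : R, 0 < A & c2 / A ^+ 2 <= eps.
Proof.
move=> eps0; pose A := 1 + c2 / eps; have q0 : 0 <= c2 / eps by rewrite divr_ge0// ltW.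
have A1 : 1 <= A by rewrite lerDl.
have A0 : 0 < A by apply: lt_le_trans A1.
exists A => //; rewrite ler_pdivrMr ?exprn_gt0// mulrC -ler_pdivrMr// expr2.
apply: (@le_trans _ _ A); first by rewrite /A lerDr.
by rewrite ler_peMl// ltW.
Qed.

Lemma cdf_reg_cvgNy : G @ -oo --> (0 : R).
Proof.
apply/cvgrPdist_le => eps /tail_small[A A0 HA].
near=> z; have zA : z < - A by near: z; apply: nbhs_ninfty_lt; exact: num_real.
have [tl _] := raw_tail A0; have /andP[g0 _] := cdf_reg01 z.
rewrite sub0r normrN ger0_norm//; apply: le_trans HA; apply: le_trans tl.
exact: cdf_reg_le.
Unshelve. all: by end_near. Qed.

Lemma cdf_reg_cvgy : G @ +oo --> (1 : R).
Proof.
apply/cvgrPdist_le => eps /tail_small[A A0 HA].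
near=> z; have zA : A < z by near: z; apply: nbhs_pinfty_gt; exact: num_real.
have [_ tl] := raw_tail A0; have /andP[_ g1] := cdf_reg01 z.
rewrite ger0_norm ?subr_ge0//; apply: le_trans HA; apply: le_trans tl.
rewrite lerD2l lerN2; apply: le_trans (cdf_reg_ge A) _.
exact/cdf_reg_homo/ltW.
Unshelve. all: by end_near. Qed.

HB.instance Definition _ :=
  isCumulative.Build R _ R cdf_reg cdf_reg_homo cdf_reg_right_continuous.
HB.instance Definition _ :=
  isCumulativeBounded.Build R 0 1 cdf_reg cdf_reg_cvgNy cdf_reg_cvgy.

Definition limit_measure : probability (measurableTypeR R) R :=
  lebesgue_stieltjes_measure cdf_reg.
Local Notation nu := limit_measure.

Lemma limit_measure_ray t : nu `]-oo, t]%classic = (G t)%:E.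
Proof.
have := cdf_lebesgue_stieltjes_id cdf_reg t.
by rewrite /cdf /distribution /pushforward preimage_id.
Qed.

Let mean_step t : mean nu (step t) = G t.
Proof.
have -> : step t = \1_(`]-oo, t]%classic) :> (R -> R).
  by apply/funext => x; rewrite indicE /step mem_setE/= in_itv.
by rewrite mean_indic// limit_measure_ray.
Qed.

Let ig_step t : ig nu (step t).
Proof.
have -> : step t = \1_(`]-oo, t]%classic) :> (R -> R).
  by apply/funext => x; rewrite indicE /step mem_setE/= in_itv.
exact: ig_indic.
Qed.

Let ig_continuous f (B : R) : continuous f -> (forall x, `|f x| <= B) -> ig nu f.
Proof. by move=> fc; apply: ig_bounded; exact: continuous_measurable_fun. Qed.

Let Q_step_sum i f t m : Q i (step_sum f t m) =
  \sum_(j < m) f j.+1 * (Q i (step (t j.+1)) - Q i (step (t j))).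
Proof.
elim: m => [|m IH].
  by rewrite big_ord0 -(Qc i 0); congr Q; apply/funext => x; rewrite /step_sum big_ord0.
rewrite big_ord_recr/= -IH -QB -QZ -QD; congr Q; apply/funext => x.
by rewrite step_sumS.
Qed.

Let mean_step_sum f t m : ig nu (step_sum f t m) /\ mean nu (step_sum f t m) =
  \sum_(j < m) f j.+1 * (G (t j.+1) - G (t j)).
Proof.
elim: m => [|m [IH1 IH2]].
  have -> : step_sum f t 0 = (fun=> 0) by apply/funext => x; rewrite /step_sum big_ord0.
  by rewrite big_ord0 mean_cst; split => //; exact: ig_cst.
have -> : step_sum f t m.+1 = (fun x => step_sum f t m x +
    f m.+1 * (step (t m.+1) x - step (t m) x)).
  by apply/funext => x; rewrite step_sumS.
have id : ig nu (fun x => f m.+1 * (step (t m.+1) x - step (t m) x)).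
  by apply: igZ; apply: igB; exact: ig_step.
split; first exact: igD.
rewrite big_ord_recr/= -IH2 meanD// meanZ; last by apply: igB; exact: ig_step.
by rewrite meanB ?mean_step//; exact: ig_step.
Qed.

Let lim_step_sum f t m : Q i (step_sum f t m) @[i --> U] -->
  \sum_(j < m) f j.+1 * (F (t j.+1) - F (t j)).
Proof.
rewrite (_ : (fun i => _) = fun i => \sum_(j < m) f j.+1 * (Q i (step (t j.+1)) - Q i (step (t j)))).
  elim: m => [|m IH].
    rewrite big_ord0 (_ : (fun i => _) = fun=> 0); first exact: cvg_cst.
    by apply/funext => i; rewrite big_ord0.
  rewrite big_ord_recr/= (_ : (fun i => _) = fun i =>
    \sum_(j < m) f j.+1 * (Q i (step (t j.+1)) - Q i (step (t j))) +
    f m.+1 * (Q i (step (t m.+1)) - Q i (step (t m)))).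
    apply: cvgD => //; apply: cvgM; first exact: cvg_cst.
    by apply: cvgB; exact: raw_cdfP.
  by apply/funext => i; rewrite big_ord_recr.
by apply/funext => i; exact: Q_step_sum.
Qed.

(** Approximate by a step function. Its ultralimit is a sum of increments of
    [raw_cdf], its integral one of increments of [cdf_reg]; as each function is
    squeezed by the other one at neighbouring points, [abel_squeeze] compares the
    two sums. *)
Lemma limit_measure_test (f : R -> R) (A : R) : 0 < A -> continuous f ->
  (forall x : R, ~~ (- A < x < A) -> f x = 0) -> Q i f @[i --> U] --> mean nu f.
Proof.
move=> A0 fc f0.
have [B B0 HB] : exists2 B : R, 0 <= B & forall x, `|f x| <= B.
  have AA : - A <= A by rewrite ge0_cp// ltW.
  have [z _ Hz] := @EVT_max R (fun x => `|f x|) (- A) A AA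
    (continuous_subspaceT (fun x => cvg_norm (fc x))).
  exists `|f z| => // x; have [xA|xA] := boolP (- A < x < A); last first.
    by rewrite (f0 x xA) normr0.
  by apply: Hz; rewrite in_itv/=; case/andP: xA => /ltW -> /ltW ->.
have igf : ig nu f by exact: ig_continuous HB.
have [l ql] : exists l : R, Q i f @[i --> U] --> l.
  by apply: (ultralimit_exists (B := B)) => i; apply: Q_bound.
suff -> : mean nu f = l by [].
apply/eqP; rewrite -subr_eq0 -normr_le0; apply/ler_addgt0Pr => e e0; rewrite add0r.
pose eps := e / 3; have eps0 : 0 < eps by rewrite divr_gt0.
have [d d0 Hd] := uniform_continuity (@segment_compact R (- A) A) fc eps0.
pose m := (Num.truncn (2 * A / d)).+1.
have m0 : (0 : R) < m%:R by rewrite ltr0n.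
have md : 2 * A / m%:R < d.
  by rewrite ltr_pdivrMr// [d * _]mulrC -ltr_pdivrMr//; exact: truncnS_gt.
pose w := 2 * A / m%:R; have w0 : 0 < w by rewrite divr_gt0// mulr_gt0.
pose t (j : nat) := - A + j%:R * w.
have tS j : t j.+1 = t j + w by rewrite /t -natr1; ring.
have t0 : t 0%N = - A by rewrite /t mul0r addr0.
have tm : t m = A by rewrite /t /w; field; rewrite gt_eqF.
have tle j : t j <= t j.+1 by rewrite tS lerDl ltW.
have tlt j : t j < t j.+1 by rewrite tS ltrDl.
have tmono j : (j <= m)%N -> - A <= t j <= A.
  move=> jm; rewrite /t lerDl mulr_ge0 ?(ltW w0)//=.
  rewrite -[leRHS]tm /t lerD2l ler_wpM2r ?(ltW w0)//.
  by rewrite ler_nat.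
have near j x : (j < m)%N -> t j <= x <= t j.+1 -> `|f (t j.+1) - f x| <= eps.
  move=> jm /andP[x1 x2]; apply: Hd; first by rewrite /= in_itv/= tmono.
  by apply: le_lt_trans md; rewrite -/w ler_norml; move: x1 x2; rewrite tS => ? ?; apply/andP; split; lra.
have SN x : `|f x - step_sum (f \o t) t m x| <= eps.
  have [|h1 h2] := @step_sum_near _ f t eps m tle _ x.
    by move=> j y jm /andP[y1 y2]; rewrite distrC; apply: near => //; rewrite (ltW y1) y2.
  have [xI|xI] := boolP (t 0%N < x <= t m); first exact: h1.
  rewrite h2// f0 ?subr0 ?normr0 ?(ltW eps0)//.
  by apply: contraNN xI; rewrite t0 tm => /andP[-> /ltW ->].
pose S := step_sum (f \o t) t m.
have [igS mS] := mean_step_sum (f \o t) t m.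
have e1 : `|mean nu f - mean nu S| <= eps.
  by rewrite -[leRHS](mean_cst nu eps); apply: mean_near => //; exact: ig_cst.
have lS := @lim_step_sum (f \o t) t m; set s := \sum_(j < m) _ in lS.
have e2 : `|l - s| <= eps.
  have ld : `|Q i f - Q i S| @[i --> U] --> `|l - s| by apply: cvg_norm; apply: cvgB.
  apply: (ultralimit_le (v := fun=> eps) _ ld (cvg_cst _)) => i.
  by rewrite -(Qc i eps); apply: Q_near; exact: SN.
have e3 : `|mean nu S - s| <= eps.
  rewrite mS; apply: (@le_trans _ _ (eps * (F (t m) - F (t 0%N)))).
    apply: (@abel_squeeze _ (f \o t) (F \o t) (G \o t)) => //=.
    - exact: ltW.
    - by rewrite t0 f0// negb_and ltxx.
    - by rewrite tm f0// negb_and ltxx orbT.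
    - by move=> j jm; apply: near => //; rewrite lexx tle.
    - by move=> j; exact: cdf_reg_ge.
    - by move=> j; exact: cdf_reg_le.
  rewrite -[leRHS]mulr1; apply: ler_wpM2l; first exact: ltW.
  by have /andP[_ ?] := raw_cdf01 (t m); have /andP[? _] := raw_cdf01 (t 0%N); lra.
move: e1 e2 e3; rewrite !ler_norml /eps => /andP[? ?] /andP[? ?] /andP[? ?].
by apply/andP; split; lra.
Qed.

Let cut (A : R) : R -> R := trap (- A) A A.

Let cut_test (q : {poly R}) (A : R) : 0 < A -> 
  Q i (fun x => q.[x] * cut A x) @[i --> U] --> mean nu (fun x => q.[x] * cut A x) /\
  ig nu (fun x => q.[x] * cut A x).
Proof.
move=> A0; have c0 x : ~~ (- (2 * A) < x < 2 * A) -> q.[x] * cut A x = 0.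
  move=> xA; rewrite /cut trap0 ?mulr0//.
  by rewrite -opprD -mulr2n -mulr_natl.
have cc : continuous (fun x => q.[x] * cut A x).
  by move=> x; apply: cvgM; [exact: continuous_horner|exact: trap_continuous].
split; first by apply: limit_measure_test cc c0; rewrite mulr_gt0.
have [B _ HB] := poly_bounded q (- (2 * A)) (2 * A).
apply: (ig_continuous cc (B := `|B|)) => x.
have [xA|xA] := boolP (- (2 * A) < x < 2 * A); last by rewrite c0// normr0.
rewrite -[leRHS]mulr1 normrM; apply: ler_pM => //.
  by apply: le_trans (ler_norm _); apply: HB; case/andP: xA => /ltW -> /ltW ->.
by have /andP[? ?] := trap_in (- A) A A x; rewrite ger0_norm.
Qed.

Let cut1 (A x : R) : 0 < A -> `|x| <= A -> cut A x = 1.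
Proof. by move=> A0 xA; apply: trap1 => //; rewrite -ler_norml. Qed.

Let cut01 (A x : R) : 0 <= cut A x <= 1. Proof. exact: trap_in. Qed.

(* Integrability of even powers, by monotone convergence along the cut-offs. *)
Let ig_pos (q : {poly R}) : (forall x, 0 <= q.[x]) -> ig nu (horner q).
Proof.
move=> q0; have mq : measurable_fun setT (horner q).
  by apply: continuous_measurable_fun; exact: continuous_horner.
apply/integrableP; split; first exact/measurable_EFinP.
pose D (n : nat) : set (measurableTypeR R) := `[(- n.+1%:R : R), n.+1%:R]%classic.
have mD n : measurable (D n) by exact: measurable_itv.
have bound (n : nat) : (\int[nu]_(x in D n) `|(q.[x])%:E| <= (Lam q)%:E)%E.
  have n0 : (0 : R) < n.+1%:R by rewrite ltr0n.
  have [ql igl] := cut_test q n0.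
  apply: (@le_trans _ _ (\int[nu]_x (q.[x] * cut n.+1%:R x)%:E)%E).
    rewrite integral_mkcond; apply: ge0_le_integral => //.
    - by move=> x _; rewrite erestrict_ge0.
    - apply/(measurable_restrictT _ _).1 => //.
      by apply: measurable_funTS; apply: measurableT_comp => //; exact/measurable_EFinP.
    - by case/integrableP: igl.
    move=> x _; rewrite patchE; case: ifPn => [|_].
      rewrite inE /D /= in_itv/= => xn; rewrite cut1 ?mulr1 ?ler_norml//.
      by rewrite lee_fin ger0_norm.
    by apply: (@le_trans _ _ 0%E) => //; rewrite lee_fin mulr_ge0//; have /andP[] := cut01 n.+1%:R x.
  rewrite mean_EFin// lee_fin; apply: (ultralimit_le _ ql (QLam q)) => i.
  apply: Q_le => x; rewrite -[leRHS]mulr1; apply: ler_wpM2l => //.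
  by have /andP[] := cut01 n.+1%:R x.
have U0 : \bigcup_n D n = [set: R].
  apply/seteqP; split=> // x _; exists (Num.truncn `|x|) => //=.
  by rewrite /D /= in_itv/= -ler_norml; apply: ltW; exact: truncnS_gt.
rewrite -U0; apply: (@le_lt_trans _ _ (Lam q)%:E); last exact: ltry.
have Dmono : {homo D : m n / (m <= n)%N >-> (m <= n)%O}.
  move=> m n mn; apply/subsetPset => x; rewrite /D /= !in_itv/= -!ler_norml => h.
  by apply: le_trans h _; rewrite ler_nat ltnS.
have mf (n : nat) : measurable_fun (D n) (fun x => `|(q.[x])%:E|%E).
  by apply: measurable_funTS; apply: measurableT_comp => //; exact/measurable_EFinP.
have f0 (n : nat) x : D n x -> (0 <= `|(q.[x])%:E|)%E by [].
have cv := @ge0_nondecreasing_set_cvg_integral _ _ _ _ _ nu Dmono mD mf f0.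
apply: (@cvge_to_le _ _ _ _ _ _ _ cv); near=> n; exact: bound.
Unshelve. all: by end_near. Qed.

(* The weight q + q X^2 dominates what is cut off, up to a factor 1 / A^2. *)
Let growth (q : {poly R}) : exists w : {poly R},
  [/\ forall x, 0 <= w.[x], forall x, `|q.[x]| <= w.[x] &
      forall A x, 0 < A -> `|q.[x] - q.[x] * cut A x| <= (A ^+ 2)^-1 * w.[x]].
Proof.
pose C := \sum_(i < size q) `|q`_i|; have C0 : 0 <= C by exact: sumr_ge0.
pose v : {poly R} := C *: (1 + 'X^2 ^+ size q).
have vE x : v.[x] = C * (1 + (x ^+ 2) ^+ size q).
  by rewrite /v hornerZ hornerD hornerC horner_exp hornerXn.
have v0 x : 0 <= v.[x] by rewrite vE mulr_ge0// addr_ge0// exprn_ge0// sqr_ge0.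
have vq x : `|q.[x]| <= v.[x].
  rewrite vE horner_coef mulr_suml; apply: le_trans (ler_norm_sum _ _ _) _.
  apply: ler_sum => i _; rewrite normrM; apply: ler_wpM2l => //; rewrite normrX.
  rewrite -[x ^+ 2]real_normK ?num_real// -exprM.
  have [x1|x1] := leP `|x| 1.
    by apply: (@le_trans _ _ 1); [exact: exprn_ile1|rewrite lerDl exprn_ge0].
  apply: (@le_trans _ _ (`|x| ^+ (2 * size q))); last by rewrite lerDr ler01.
  rewrite ler_eXn2l//; have := ltn_ord i; lia.
exists (v * (1 + 'X^2)).
have wE x : (v * (1 + 'X^2)).[x] = v.[x] * (1 + x ^+ 2).
  by rewrite hornerM hornerD hornerC hornerXn.
split=> [x|x|A x A0]; rewrite wE.
- by rewrite mulr_ge0// addr_ge0// sqr_ge0.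
- by apply: le_trans (vq x) _; rewrite ler_peMr// lerDl sqr_ge0.
have A20 : 0 < A ^+ 2 by rewrite exprn_gt0.
have [xA|xA] := leP `|x| A.
  rewrite cut1// mulr1 subrr normr0 mulr_ge0 ?invr_ge0 ?(ltW A20)// mulr_ge0//.
  by rewrite addr_ge0// sqr_ge0.
have c1 : `|1 - cut A x| <= 1.
  by have /andP[? ?] := cut01 A x; rewrite ler_norml; apply/andP; split; lra.
rewrite -[X in X - _]mulr1 -mulrBr normrM mulrCA; apply: ler_pM => //.
apply: le_trans c1 _; rewrite mulrC ler_pdivlMr// mul1r -[x ^+ 2]real_normK ?num_real//.
apply: (@le_trans _ _ (`|x| ^+ 2)); last by rewrite lerDr ler01.
by apply: lerXn2r; rewrite ?nnegrE// ltW.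
Qed.

Lemma ig_poly (q : {poly R}) : ig nu (horner q).
Proof.
have [w [w0 qw _]] := growth q; apply: ig_le qw _; last exact: ig_pos.
by apply: continuous_measurable_fun; exact: continuous_horner.
Qed.

(** Truncate by trapezoids, to which [limit_measure_test] applies; the moments of
    higher degree control what is cut off, on both sides. *)
Lemma limit_measure_poly (q : {poly R}) : mean nu (horner q) = Lam q.
Proof.
have [w [w0 _ qw]] := growth q.
have igw := ig_pos w0.
have mw : 0 <= mean nu (horner w).
  by rewrite -[X in X <= _](mean_cst nu 0); apply: mean_le => //; exact: ig_cst.
have Lw : 0 <= Lam w.
  apply: (ultralimit_le (u := fun=> 0) _ (cvg_cst _) (QLam w)) => i.
  by rewrite -(Qc i 0); apply: Q_le.
pose S := mean nu (horner w) + Lam w.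
have close (A : R) : 0 < A -> `|mean nu (horner q) - Lam q| <= (A ^+ 2)^-1 * S.
  move=> A0; have [ql igl] := cut_test q A0.
  have e1 : `|mean nu (horner q) - mean nu (fun x => q.[x] * cut A x)| <=
      (A ^+ 2)^-1 * mean nu (horner w).
    rewrite -meanZ//; apply: mean_near => //; [exact: ig_poly|exact: igZ|].
    by move=> x; exact: qw.
  have e2 : `|Lam q - mean nu (fun x => q.[x] * cut A x)| <= (A ^+ 2)^-1 * Lam w.
    have l1 : `|Q i (horner q) - Q i (fun x => q.[x] * cut A x)| @[i --> U] -->
        `|Lam q - mean nu (fun x => q.[x] * cut A x)|.
      by apply: cvg_norm; apply: cvgB => //; exact: QLam.
    have l2 : (A ^+ 2)^-1 * Q i (horner w) @[i --> U] --> (A ^+ 2)^-1 * Lam w.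
      by apply: cvgM; [exact: cvg_cst|exact: QLam].
    apply: (ultralimit_le _ l1 l2) => i; rewrite -QZ; apply: Q_near => x.
    exact: qw.
  move: e1 e2; rewrite /S mulrDr; set z := mean nu (fun x => _).
  by rewrite !ler_norml => /andP[? ?] /andP[? ?]; apply/andP; split; lra.
have S0 : 0 <= S by rewrite addr_ge0.
apply/eqP; rewrite -subr_eq0 -normr_le0; apply/ler_addgt0Pr => e e0; rewrite add0r.
pose A := 1 + S / e; have A1 : 1 <= A by rewrite lerDl divr_ge0// ltW.
have A0 : 0 < A by exact: lt_le_trans A1.
apply: le_trans (close A A0) _; rewrite mulrC ler_pdivrMr ?exprn_gt0//.
rewrite mulrC -ler_pdivrMr// expr2; apply: (@le_trans _ _ A); first by rewrite lerDr.
by rewrite ler_peMl// ltW.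
Qed.

End LimitMeasure.

(** * From integrals of test functions to a density *)
Section Density.
Context {R : realType} (nu : probability (measurableTypeR R) R).
Local Notation mu := (@lebesgue_measure R).
Variables (c' c d d' : R) (rho : R -> R).
Hypotheses (c'c : c' < c) (dd' : d < d').
Hypotheses (rhoc : continuous rho) (rho0 : forall x, 0 <= rho x).
Hypothesis nu_test : forall F : R -> R, continuous F ->
  (forall x, ~~ (c' < x < d') -> F x = 0) ->
  mean nu F = ival (fun x => F x * rho x) c' d'.

Lemma trap_cvg_indic (s t e x : R) : 0 < e ->
  trap s t (e / n.+1%:R) x @[n --> \oo] --> (\1_(`[s, t]%classic) x : R).
Proof.
move=> e0; have en n : 0 < e / n.+1%:R by rewrite divr_gt0 ?ltr0n.
rewrite indicE mem_setE/= in_itv/=; have [xst|xst] := boolP (s <= x <= t).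
  by apply: cvg_near_cst; near=> n; rewrite trap1.
have [g g0 Hg] : exists2 g : R, 0 < g & (x <= s - g) || (t + g <= x).
  move: xst; rewrite negb_and -!ltNge => /orP[xs|tx].
    by exists (s - x); rewrite ?subr_gt0//; apply/orP; left; lra.
  by exists (x - t); rewrite ?subr_gt0//; apply/orP; right; lra.
have eg : 0 < e / g by rewrite divr_gt0.
apply: cvg_near_cst; near=> n; rewrite trap0// negb_and -!leNgt.
have : e / n.+1%:R <= g.
  rewrite ler_pdivrMr ?ltr0n// mulrC -ler_pdivrMr//.
  apply: (@le_trans _ _ n%:R); last by rewrite ler_nat.
  by near: n; apply: nbhs_infty_ger.
by move: (e / _) => z; case/orP: Hg => ? ?; apply/orP; [left|right]; lra.
Unshelve. all: by end_near. Qed.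

(** Trapezoids decrease to the indicator of the segment; dominated convergence on
    both sides. *)
Lemma density_segment s t : c' < s -> t < d' -> s <= t ->
  nu `[s, t]%classic = (\int[mu]_(x in `[s, t]) (rho x)%:E)%E.
Proof.
move=> cs td st; pose e := Num.min (s - c') (d' - t).
have e0 : 0 < e by rewrite lt_min !subr_gt0 cs.
have es : c' <= s - e by have : e <= s - c' by [rewrite /e ge_min lexx]; lra.
have et : t + e <= d' by have : e <= d' - t by [rewrite /e ge_min lexx orbT]; lra.
pose T n := trap s t (e / n.+1%:R).
have en n : 0 < e / n.+1%:R by rewrite divr_gt0 ?ltr0n.
have ene n : e / n.+1%:R <= e.
  by rewrite ler_pdivrMr ?ltr0n// ler_peMr ?(ltW e0)// ler1n.
have Tc n : continuous (T n) by exact: trap_continuous.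
have T01 n x : 0 <= T n x <= 1 by exact: trap_in.
have T1 n x : `|T n x| <= 1 by have /andP[? ?] := T01 n x; rewrite ger0_norm.
have Tig n : ig nu (T n).
  by apply: ig_bounded (T1 n); exact: continuous_measurable_fun.
have T0 n x : ~~ (c' < x < d') -> T n x = 0.
  move=> xcd; apply: trap0 => //; apply: contraNN xcd; move: (ene n).
  by move: (e / _) => z ? /andP[? ?]; apply/andP; split; lra.
have lim1 : (mean nu (T n))%:E @[n --> \oo] --> nu `[s, t]%classic.
  rewrite -[X in _ --> X](_ : (\int[nu]_x (\1_(`[s, t]%classic) x)%:E)%E = _); last first.
    by rewrite integral_indic// setIT.
  rewrite (_ : (fun n => _) = fun n => (\int[nu]_x (T n x)%:E)%E); last first.
    by apply/funext => n; rewrite mean_EFin.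
  apply: (@dominated_cvg _ _ _ nu setT _ (fun n x => (T n x)%:E) _ (fun=> 1%E)) => //.
  - by move=> n; apply/measurable_EFinP; exact: continuous_measurable_fun.
  - by move=> x _; apply/cvg_EFin; [near=> n|exact: trap_cvg_indic].
  - exact: (ig_cst nu 1).
  - by move=> n x _; rewrite lee_fin.
have lim2 : (ival (fun x => T n x * rho x) c' d')%:E @[n --> \oo] -->
    (\int[mu]_(x in `[s, t]) (rho x)%:E)%E.
  have Dst : `[s, t]%classic = `[c', d']%classic `&` `[s, t]%classic.
    apply/seteqP; split=> x /=; rewrite !in_itv/=; last by case.
    by move=> /andP[? ?]; split; [apply/andP; split; lra|apply/andP].
  have Trc n : {within `[c', d'], continuous (fun x => T n x * rho x)}.
    by apply: continuous_subspaceT => x; apply: cvgM; [exact: Tc|exact: rhoc].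
  rewrite (_ : (fun n => _) = fun n => (\int[mu]_(x in `[c', d']) (T n x * rho x)%:E)%E); last first.
    apply/funext => n; rewrite /ival /Rintegral fineK//.
    by apply: integrable_fin_num => //; exact: ival_integrable.
  rewrite {1}Dst integral_mkcondr.
  apply: (@dominated_cvg _ _ _ mu `[c', d']%classic _ (fun n x => (T n x * rho x)%:E) _ (EFin \o rho)) => //.
  - move=> n; apply: measurable_funTS; apply/measurable_EFinP.
    by apply: continuous_measurable_fun => x; apply: cvgM; [exact: Tc|exact: rhoc].
  - move=> x _; rewrite (_ : _ x = (\1_(`[s, t]%classic) x * rho x)%:E).
      apply/cvg_EFin; first by near=> n.
      by apply: cvgM; [exact: trap_cvg_indic|exact: cvg_cst].
    by rewrite patchE indicE; case: ifPn => _; rewrite ?mul1r ?mul0r.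
  - by apply: ival_integrable; exact: continuous_subspaceT.
  - move=> n x _; rewrite lee_fin normrM (ger0_norm (rho0 x)).
    by rewrite -[leRHS]mul1r; apply: ler_wpM2r.
move: lim1; rewrite (_ : (fun n => _) = fun n => (ival (fun x => T n x * rho x) c' d')%:E).
  by move=> lim1; exact: cvg_unique lim1 lim2.
by apply/funext => n; rewrite nu_test//; exact: T0.
Unshelve. all: by end_near. Qed.

Let D : set (measurableTypeR R) := `[c, d]%classic.
Let mD : measurable D. Proof. exact: measurable_itv. Qed.

Let weighted (E : set (measurableTypeR R)) : \bar R :=
  (\int[mu]_(x in E) ((rho \_ D) x)%:E)%E.

Let rD0 (x : R) : (0 <= ((rho \_ D) x)%:E)%E.
Proof. by rewrite lee_fin patchE; case: ifPn. Qed.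

Let mrD : measurable_fun (setT : set (measurableTypeR R)) (fun x => ((rho \_ D) x)%:E).
Proof.
apply/measurable_EFinP; apply/(measurable_restrictT _ _).1 => //.
by apply: measurable_funTS; exact: continuous_measurable_fun.
Qed.

Let weighted0 : weighted set0 = 0%E. Proof. by rewrite /weighted integral_set0. Qed.
Let weighted_ge0 E : (0 <= weighted E)%E. Proof. exact: integral_ge0. Qed.
Let weighted_add : semi_sigma_additive weighted.
Proof. exact: semi_sigma_additive_nng_induced. Qed.

HB.instance Definition _ := isMeasure.Build _ _ _ weighted
  weighted0 weighted_ge0 weighted_add.

Let weightedE E : measurable E ->
  weighted E = (\int[mu]_(x in E `&` D) (rho x)%:E)%E.
Proof.
move=> mE; rewrite integral_mkcondr; apply: eq_integral => x _.
by rewrite !patchE; case: ifPn.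
Qed.

(** The sets [[x, +oo[] form a pi-system which generates the Borel sets, and
    inside [[c, d]] they are segments. *)
Lemma density_borel (E : set (measurableTypeR R)) : measurable E -> E `<=` `[c, d]%classic ->
  nu E = (\int[mu]_(x in E) (rho x)%:E)%E.
Proof.
move=> mE ED; have EI : E `&` D = E by exact/setIidl.
have -> : nu E = mrestr nu mD E by rewrite /mrestr EI.
rewrite -{2}EI -weightedE//.
pose m1 : {measure set (measurableTypeR R) -> \bar R} := mrestr nu mD.
pose m2 : {measure set (measurableTypeR R) -> \bar R} := weighted.
pose g (n : nat) : set (measurableTypeR R) := `[(- n%:R : R), +oo[%classic.
apply: (@measure_unique _ R (measurableTypeR R) (@RGenCInfty.G R) g _ _ _ _ m1 m2) => //.
- exact: RGenCInfty.measurableE.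
- move=> _ _ [x ->] [y ->]; exists (Num.max x y); apply/seteqP; split => z /=;
    by rewrite !in_itv/= !andbT ge_max => /andP.
- by move=> n; exists (- n%:R).
- apply/seteqP; split=> // x _; exists (Num.truncn `|x|).+1 => //=.
  rewrite /g /= in_itv/= andbT lerNl; apply: le_trans (ltW (truncnS_gt _)).
  by rewrite -normrN ler_norm.
- move=> _ [x ->]; rewrite /m2 /= weightedE; last exact: measurable_itv.
  rewrite /m1 /= /mrestr.
  have -> : `[x, +oo[%classic `&` D = `[Num.max x c, d]%classic.
    apply/seteqP; split => z; rewrite /D /= !in_itv/= ge_max andbT.
      by case=> -> /andP[-> ->].
    by move=> /andP[/andP[-> ->] ->].
  have [xd|dx] := leP (Num.max x c) d.
    by apply: density_segment => //; rewrite lt_max c'c orbT.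
  by rewrite set_itv_ge ?measure0 ?integral_set0// bnd_simp -ltNge.
- move=> k; rewrite /m1 /= /mrestr.
  apply: le_lt_trans (ltry 1); apply: probability_le1.
  by apply: measurableI => //; exact: measurable_itv.
Qed.

End Density.

(** * Periodic continuation of the coefficients *)
Section PeriodicExtension.
Context {R : realType}.
Implicit Types (a b : nat -> R).

Definition periodize (l N : nat) (u : nat -> R) (j : nat) : R :=
  if (j < l)%N then u j else u (l + (j - l) %% N)%N.

Lemma periodize_lt l N u j : (0 < N)%N -> (j < l + N)%N -> periodize l N u j = u j.
Proof.
rewrite /periodize => N0 jN; case: ltnP => // lj.
by rewrite modn_small ?subnKC// ltn_subLR.
Qed.

Lemma periodize_per l N u j : (l <= j)%N -> periodize l N u (j + N) = periodize l N u j.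
Proof.
rewrite /periodize => lj; rewrite ltnNge (leq_trans lj (leq_addr _ _)) ltnNge lj /=.
by rewrite -addnBAC// modnDr.
Qed.

Lemma periodize_gt0 l N u : (forall n, 0 < u n) -> forall n, 0 < periodize l N u n.
Proof. by move=> u0 n; rewrite /periodize; case: ifP. Qed.

Lemma periodize_bounded l N u : (0 < N)%N ->
  exists B : R, forall n, `|periodize l N u n| <= B.
Proof.
move=> N0; exists (\sum_(j < l + N) `|u j|) => n.
have [j [jN ->]] : exists j, (j < l + N)%N /\ periodize l N u n = u j.
  rewrite /periodize; case: ltnP => ln; first by exists n; rewrite ltn_addr.
  by exists (l + (n - l) %% N)%N; rewrite ltn_add2l ltn_mod.
by rewrite (bigD1 (Ordinal jN))//= lerDl; apply: sumr_ge0.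
Qed.

Lemma orth_poly_eq a b a' b' k : (forall j, (j < k)%N -> a' j = a j /\ b' j = b j) ->
  forall j, (j <= k)%N -> orth_poly a' b' j = orth_poly a b j.
Proof.
move=> H; suff : forall j, ((j <= k)%N -> orth_poly a' b' j = orth_poly a b j) /\
    ((j < k)%N -> orth_poly a' b' j.+1 = orth_poly a b j.+1) by move=> + j => /(_ j)[].
elim=> [|j [IH1 IH2]]; split=> //.
  by move=> k0; have [h1 h2] := H 0%N k0; rewrite /orth_poly h1 h2.
move=> jk; rewrite !orth_polyS; have [-> ->] := H _ jk; have [-> _] := H j (ltnW jk).
by rewrite IH1 ?IH2// ltnW// ltnW.
Qed.

Variables (a b : nat -> R) (l N : nat).
Hypotheses (N_gt0 : (0 < N)%N) (a_gt0 : forall n, 0 < a n).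
Local Notation a' := (periodize l N a).
Local Notation b' := (periodize l.+1 N b).
Local Notation p := (orth_poly a b).
Local Notation p' := (orth_poly a' b').
Local Notation kappa := (a (l + N)%N / a l).

Let a'E j : (j < l + N)%N -> a' j = a j. Proof. exact: periodize_lt. Qed.
Let b'E j : (j <= l + N)%N -> b' j = b j. Proof. by move=> h; exact: periodize_lt. Qed.
Let a'lN : a' (l + N)%N = a l.
Proof. by rewrite periodize_per// a'E// -[X in (X < _)%N]addn0 ltn_add2l. Qed.

Lemma periodize_orth_poly j : (j <= l + N)%N -> p' j = p j.
Proof.
by apply: orth_poly_eq => {}j jN; rewrite a'E// b'E// ltnW.
Qed.

(** The first coefficient that changes is [a (l + N)], replaced by [a l]; its only
    effect on the first [l + N + 1] polynomials is to rescale the last one. *)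
Lemma periodize_orth_poly_last : p' (l + N).+1 = kappa *: p (l + N).+1.
Proof.
have [m mE] : exists m, (l + N)%N = m.+1.
  by exists (l + N).-1; rewrite prednK// addn_gt0 N_gt0 orbT.
have h1 := a'lN; have h2 := b'E (leqnn _); have h3 := @a'E m.
move: h1 h2 h3; rewrite mE => h1 h2 h3.
have h4 := periodize_orth_poly; rewrite mE in h4.
rewrite !orth_polyS h1 h2 h3// !h4//.
rewrite scalerA; congr (_ *: _).
by field; rewrite !gt_eqF.
Qed.

Lemma periodize_turan : turan_poly a' b' l N =
  a l *: (p l.+1 * p (l + N)%N) - a (l + N)%N *: (p l * p (l + N).+1).
Proof.
rewrite /turan_poly addSn periodize_orth_poly_last.
rewrite !periodize_orth_poly ?leq_addr//; last by rewrite -addn1 leq_add2l.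
rewrite a'E; last by rewrite -[X in (X < _)%N]addn0 ltn_add2l.
rewrite scalerBr -scalerAr scalerA; congr (_ - _ *: _).
by field; rewrite gt_eqF.
Qed.

Let transport_eq w k : (k < N)%N -> transport a' b' l.+1 w k = transport a b l.+1 w k.
Proof.
elim: k => [//|k IH] kN /=; rewrite IH ?(ltnW kN)//.
rewrite !a'E ?b'E//; rewrite ?addSn /= ?ltn_add2l -?addnS ?ltn_add2l ?leq_add2l//;
  exact: ltnW.
Qed.

Let transport_last w n : n = N -> transport a' b' l.+1 w n =
  ((transport a b l.+1 w n).1, kappa *: (transport a b l.+1 w n).2).
Proof.
case: n => [N0|k kN]; first by move: N_gt0; rewrite -N0.
have lk : (l.+1 + k = l + N)%N by rewrite addSnnS kN.
have kN' : (k < N)%N by rewrite -kN.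
rewrite /= transport_eq//= lk a'lN b'E//.
rewrite a'E ?ltn_add2l// scalerA; congr (_, _ *: _).
by field; rewrite !gt_eqF.
Qed.

Lemma periodize_disc : disc_poly a' b' l N =
  entry a b l.+1 N 0 0 + kappa *: entry a b l.+1 N 1 1.
Proof. by rewrite /disc_poly /entry !transport_last. Qed.

End PeriodicExtension.

Section PeriodicApproximation.
Context {R : realType}.

(** Complete the square in each variable. *)
Lemma definite_form_ge (b c e u w M k : R) : 0 < k -> e ^+ 2 + 4 * b * c <= - k ->
  `|b| <= M -> `|c| <= M ->
  k * (u ^+ 2 + w ^+ 2) <= 8 * M * `|c * u ^+ 2 + e * (u * w) - b * w ^+ 2|.
Proof.
move=> k0 disc bM cM; set q := c * u ^+ 2 + _ - _.
have i1 : k * w ^+ 2 <= 4 * (c * q).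
  have -> : 4 * (c * q) = (2 * c * u + e * w) ^+ 2 - (e ^+ 2 + 4 * b * c) * w ^+ 2.
    by rewrite /q; ring.
  have := sqr_ge0 (2 * c * u + e * w); have := ler_wpM2r (sqr_ge0 w) disc.
  by rewrite mulNr; move: (_ * w ^+ 2) (k * _) => ? ?; lra.
have i2 : k * u ^+ 2 <= 4 * (- b * q).
  have -> : 4 * (- b * q) = (2 * b * w - e * u) ^+ 2 - (e ^+ 2 + 4 * b * c) * u ^+ 2.
    by rewrite /q; ring.
  have := sqr_ge0 (2 * b * w - e * u); have := ler_wpM2r (sqr_ge0 u) disc.
  by rewrite mulNr; move: (_ * u ^+ 2) (k * _) => ? ?; lra.
have j (z : R) : `|z| <= M -> z * q <= M * `|q|.
  by move=> zM; apply: le_trans (ler_norm _) _; rewrite normrM; apply: ler_wpM2r.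
have := j c cM; have := j (- b); rewrite normrN => /(_ bM).
rewrite [k * (_ + _)]mulrDr -[8 * M * _]mulrA; move: i1 i2.
by move: (k * _) (k * _) (- b * q) (c * q) (M * _) => ? ? ? ? ?; lra.
Qed.

Lemma ucvgV (K : set R) (f : nat -> R -> R) (l : R -> R) (m : R) : 0 < m ->
  (forall x, K x -> m <= l x) -> ucvg K f l ->
  ucvg K (fun n x => (f n x)^-1) (fun x => (l x)^-1).
Proof.
move=> m0 ml fl eps eps0.
have e0 : 0 < Num.min (m / 2) (eps * (m / 2 * m)).
  by rewrite lt_min divr_gt0//= mulr_gt0// mulr_gt0// divr_gt0.
have [n0 H] := fl _ e0; exists n0 => n x nn Kx.
have := H n x nn Kx; rewrite le_min => /andP[h1 h2]; have mx := ml x Kx.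
have fx : m / 2 <= f n x by move: h1; rewrite ler_norml => /andP[]; lra.
have m2 : 0 < m / 2 by rewrite divr_gt0.
have fx0 : 0 < f n x by exact: lt_le_trans fx.
have lx0 : 0 < l x by exact: lt_le_trans mx.
have -> : (f n x)^-1 - (l x)^-1 = (l x - f n x) / (f n x * l x).
  by field; rewrite !gt_eqF.
rewrite normrM normfV distrC (gtr0_norm (mulr_gt0 fx0 lx0)) ler_pdivrMr ?mulr_gt0//.
apply: le_trans h2 _; apply: ler_wpM2l; first exact: ltW.
by apply: ler_pM => //; exact: ltW.
Qed.

Variables (a b : nat -> R) (N i : nat) (c' d' : R).
Hypotheses (a_gt0 : forall n, 0 < a n) (N_gt0 : (0 < N)%N).
Local Notation p := (orth_poly a b).
Local Notation L := (fun n => (n.+1 * N + i)%N).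
Let K : set R := `[c', d']%classic.
Variables (h : {poly R}) (g : R -> R) (M k B m : R).
Hypothesis a_ratio : (fun n : nat => a (L n.+1).-1 / a (L n).-1) @ \oo --> (1 : R).
Hypothesis M_gt0 : 0 < M.
Hypothesis entry_le : forall s t n x, K x -> `|(entry a b (L n) N s t).[x]| <= M.
Hypotheses (k_gt0 : 0 < k) (h_le : forall x, K x -> h.[x] <= - k).
Hypothesis discr_h : ucvg K (fun n x => (block_discr a b N i n).[x]) (horner h).
Hypotheses (m_gt0 : 0 < m) (g_ge : forall x, m <= g x) (g_le : forall x, K x -> g x <= B).
Hypothesis turan_g : ucvg K (turan a b N i) g.

Definition per_a n := periodize (L n).-1 N a.
Definition per_b n := periodize (L n).-1.+1 N b.
Definition per_disc n := disc_poly (per_a n) (per_b n) (L n).-1 N.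
Definition per_turan n := turan_poly (per_a n) (per_b n) (L n).-1 N.

Let Lpos n : (0 < L n)%N. Proof. by rewrite /= mulSn -addnA addn_gt0 N_gt0. Qed.
Let LP n : (L n).-1.+1 = L n. Proof. exact: prednK. Qed.
Let LN n : ((L n).-1 + N)%N = (L n.+1).-1.
Proof. by rewrite /= [in RHS]mulSn; have := Lpos n; rewrite /=; lia. Qed.
Let LN' n : (L n + N)%N = L n.+1.
Proof. by rewrite /= [in RHS]mulSn; lia. Qed.

Let al n := a (L n).-1.
Let kap n := al n.+1 / al n.
Let al0 n : 0 < al n. Proof. exact: a_gt0. Qed.
Let kap0 n : 0 < kap n. Proof. exact: divr_gt0. Qed.

Let near_limits (eps : R) : 0 < eps -> exists n0, forall n, (n0 <= n)%N ->
  [/\ `|kap n - 1| <= eps, 1 / 2 <= kap n <= 2,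
   forall x, K x -> (block_discr a b N i n).[x] <= - (k / 2) &
   forall x, K x -> turan a b N i n x <= B + 1].
Proof.
move=> eps0; have e0 : 0 < Num.min eps (1 / 2) by rewrite lt_min eps0 divr_gt0.
have /cvgrPdist_le/(_ _ e0)[n1 _ H1] := a_ratio.
have [n2 H2] := discr_h (divr_gt0 k_gt0 (ltr0n _ 2)).
have [n3 H3] := turan_g (@ltr01 R).
exists (maxn n1 (maxn n2 n3)) => n; rewrite !geq_max => /and3P[n1n n2n n3n].
have := H1 n n1n; rewrite /= -[a _ / a _]/(kap n) distrC le_min => /andP[h1 h2]; split=> //.
- by move: h2; rewrite ler_norml => /andP[? ?]; apply/andP; split; lra.
- move=> x Kx; have := H2 n x n2n Kx; have := h_le Kx.
  by rewrite ler_norml => ? /andP[]; lra.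
- move=> x Kx; have := H3 n x n3n Kx; have := g_le Kx.
  by rewrite ler_norml => ? /andP[]; lra.
Qed.

Let Q n x := (p (L n)).[x] * (p (L n + N).-1).[x] - (p (L n).-1).[x] * (p (L n + N)%N).[x].

Let transportE n x :
  (p (L n + N).-1).[x] = (entry a b (L n) N 0 0).[x] * (p (L n).-1).[x] +
    (entry a b (L n) N 0 1).[x] * (p (L n)).[x] /\
  (p (L n + N)%N).[x] = (entry a b (L n) N 1 0).[x] * (p (L n).-1).[x] +
    (entry a b (L n) N 1 1).[x] * (p (L n)).[x].
Proof.
have := @transport_orth_poly _ a b (L n) N (Lpos _).
by rewrite transport_lin => -[<- <-]; rewrite !(hornerD, hornerM).
Qed.

(* The definite form controls the norm of the orbit, hence all products of its
   entries. *)
Let product_bounded n x : K x -> 1 / 2 <= kap n -> (block_discr a b N i n).[x] <= - (k / 2) ->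
  turan a b N i n x <= B + 1 ->
  al n * `|(p (L n)).[x] * (p (L n + N).-1).[x]| <= 64 * M ^+ 2 / k * (B + 1).
Proof.
move=> Kx kn dn tn; have [y1 y2] := transportE n x.
set u := (p (L n).-1).[x] in y1 y2; set w := (p (L n)).[x] in y1 y2 *.
set e00 := (entry _ _ _ _ 0 0).[x] in y1; set e01 := (entry _ _ _ _ 0 1).[x] in y1.
set e10 := (entry _ _ _ _ 1 0).[x] in y2; set e11 := (entry _ _ _ _ 1 1).[x] in y2.
have b00 : `|e00| <= M by exact: entry_le.
have b01 : `|e01| <= M by exact: entry_le.
have b10 : `|e10| <= M by exact: entry_le.
have QE : Q n x = - (e10 * u ^+ 2 + (e11 - e00) * (u * w) - e01 * w ^+ 2).
  by rewrite /Q y1 y2 -/u -/w; ring.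
have dE : (block_discr a b N i n).[x] = (e11 - e00) ^+ 2 + 4 * e01 * e10.
  rewrite /block_discr !(hornerD, hornerN, hornerM, hornerC, horner_exp).
  by rewrite -/e00 -/e01 -/e10 -/e11; ring.
have k2 : 0 < k / 2 by rewrite divr_gt0.
rewrite dE in dn; have := definite_form_ge u w k2 dn b01 b10.
rewrite -normrN -QE => qf.
have tE : turan a b N i n x = al n.+1 * `|Q n x|.
  by rewrite /turan /Q /al LN'.
have s1 : al n * `|Q n x| <= 2 * (B + 1).
  apply: le_trans (_ : 2 * turan a b N i n x <= _); last exact: ler_wpM2l.
  rewrite tE mulrA; apply: ler_wpM2r => //.
  have : 1 / 2 * al n <= kap n * al n by apply: ler_wpM2r => //; exact: ltW.
  by rewrite /kap divfK ?gt_eqF//; lra.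
have s2 : `|w * (p (L n + N).-1).[x]| <= 2 * M * (u ^+ 2 + w ^+ 2).
  rewrite y1 mulrDr; apply: le_trans (ler_normD _ _) _; rewrite !normrM.
  have t1 : `|w| * (`|e00| * `|u|) <= M * (u ^+ 2 + w ^+ 2).
    rewrite mulrCA; apply: ler_pM => //.
    rewrite -[u ^+ 2]real_normK ?num_real// -[w ^+ 2]real_normK ?num_real//.
    by have := sqr_ge0 (`|u| - `|w|); have := sqr_ge0 (`|u| + `|w|); nra.
  have t2 : `|w| * (`|e01| * `|w|) <= M * (u ^+ 2 + w ^+ 2).
    rewrite mulrCA; apply: ler_pM => //.
    by rewrite -expr2 real_normK ?num_real// lerDr sqr_ge0.
  by apply: le_trans (lerD t1 t2) _; rewrite -mulr2n -[2 * M * _]mulrA mulr_natl.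
have a0 := al0 n.
rewrite -(ler_pM2l k_gt0).
have -> : k * (64 * M ^+ 2 / k * (B + 1)) = 32 * M ^+ 2 * (2 * (B + 1)).
  by field; rewrite gt_eqF.
apply: (@le_trans _ _ (32 * M ^+ 2 * (al n * `|Q n x|))); last first.
  by apply: ler_wpM2l => //; rewrite mulr_ge0// sqr_ge0.
have M2 : 0 <= 4 * M by rewrite mulr_ge0// ltW.
rewrite mulrCA [32 * _ * _]mulrCA; apply: ler_wpM2l; first exact: ltW.
apply: (@le_trans _ _ (k * (2 * M * (u ^+ 2 + w ^+ 2)))).
  by apply: ler_wpM2l => //; exact: ltW.
have := ler_wpM2l M2 qf; have -> : 4 * M * (k / 2 * (u ^+ 2 + w ^+ 2)) = k * (2 * M * (u ^+ 2 + w ^+ 2)) by field.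
by have -> : 4 * M * (8 * M * `|Q n x|) = 32 * M ^+ 2 * `|Q n x| by ring.
Qed.

(** The two determinants differ by [(kappa - 1) a_(L-1) p_L p_(L+N-1)], where the
    product is bounded and [kappa], the ratio of consecutive [a_(L-1)], tends
    to [1]. *)
Lemma per_turan_limit : ucvg K (fun n x => `|(per_turan n).[x]|) g.
Proof.
move=> eps eps0; pose C := 64 * M ^+ 2 / k * (B + 1) + 1.
have e2 : 0 < eps / 2 by rewrite divr_gt0.
have [n1 H1] := turan_g e2.
have C0 : 0 < `|C| + 1 by rewrite ltr_wpDl.
have [n2 H2] := near_limits (divr_gt0 e2 C0).
exists (maxn n1 n2) => n x; rewrite geq_max => /andP[n1n n2n] Kx.
have [k1 /andP[k2 _] dn tn] := H2 n n2n.
have pb := product_bounded Kx k2 (dn x Kx) (tn x Kx).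
have t1 := H1 n x n1n Kx.
have tE : turan a b N i n x = `|al n.+1 * Q n x|.
  by rewrite normrM (gtr0_norm (al0 _)) /turan /Q /al LN'.
have pE : (per_turan n).[x] = al n.+1 * Q n x - (kap n - 1) * (al n * ((p (L n)).[x] * (p (L n + N).-1).[x])).
  rewrite /per_turan periodize_turan// !LP !LN -/(al n) -/(al n.+1).
  rewrite (_ : (L n.+1).-1.+1 = L n.+1) ?prednK ?Lpos// /Q LN' /kap.
  rewrite hornerD hornerN !hornerZ !hornerM.
  move: (p _).[x] (p _).[x] (p _).[x] (p _).[x] (al n.+1) (al0 n) => q1 q2 q3 q4 z.
  by move: (al n) => y y0; field; rewrite gt_eqF.
have close : `| `|(per_turan n).[x]| - turan a b N i n x| <= eps / 2.
  rewrite tE; apply: le_trans (ler_dist_dist _ _) _.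
  rewrite pE addrAC subrr add0r normrN normrM.
  apply: le_trans (_ : eps / 2 / (`|C| + 1) * (`|C| + 1) <= _); last by rewrite divfK// gt_eqF.
  apply: ler_pM => //; rewrite normrM (gtr0_norm (al0 n)); apply: le_trans pb _.
  by have := ler_norm C; rewrite /C; lra.
move: t1 close; rewrite !ler_norml => /andP[? ?] /andP[? ?].
by apply/andP; split; lra.
Qed.

(** The transfer matrix of the continuation has its second row multiplied by
    [kappa], and determinant [1] instead of [1 / kappa]. *)
Lemma per_disc_limit : ucvg K (fun n x => 4 - (per_disc n).[x] ^+ 2) (fun x => - h.[x]).
Proof.
move=> eps eps0; have e2 : 0 < eps / 2 by rewrite divr_gt0.
pose C := 8 + 5 * M ^+ 2; have C0 : 0 < C by rewrite ltr_wpDr// mulr_ge0// sqr_ge0.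
have [n1 H1] := discr_h e2; have [n2 H2] := near_limits (divr_gt0 e2 C0).
exists (maxn n1 n2) => n x; rewrite geq_max => /andP[n1n n2n] Kx.
have [k1 k2 _ _] := H2 n n2n; have d1 := H1 n x n1n Kx.
set e00 := (entry a b (L n) N 0 0).[x]; set e11 := (entry a b (L n) N 1 1).[x].
have b00 : `|e00| <= M by exact: entry_le.
have b11 : `|e11| <= M by exact: entry_le.
have DE : (per_disc n).[x] = e00 + kap n * e11.
  by rewrite /per_disc periodize_disc// LP LN hornerD hornerZ.
have bE : (block_discr a b N i n).[x] = (e00 + e11) ^+ 2 - 4 / kap n.
  rewrite /block_discr entry_det//; last by move=> j; rewrite gt_eqF.
  rewrite !(hornerD, hornerN, hornerM, hornerC, horner_exp) -/e00 -/e11 LN'.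
  by congr (_ - _ * _); rewrite /kap invf_div.
have dE : 4 - (per_disc n).[x] ^+ 2 + (block_discr a b N i n).[x] =
    (kap n - 1) * (4 / kap n - e11 * (2 * e00 + (kap n + 1) * e11)).
  by rewrite DE bE; field; rewrite gt_eqF.
have close : `|4 - (per_disc n).[x] ^+ 2 + (block_discr a b N i n).[x]| <= eps / 2.
  rewrite dE normrM; apply: le_trans (_ : eps / 2 / C * C <= _); last by rewrite divfK// gt_eqF.
  apply: ler_pM => //; case/andP: k2 => k2 k3.
  have i1 : `|4 / kap n| <= 8.
    by rewrite gtr0_norm ?divr_gt0// ler_pdivrMr//; lra.
  have i2 : `|e11 * (2 * e00 + (kap n + 1) * e11)| <= M * (5 * M).
    rewrite normrM; apply: ler_pM => //; apply: le_trans (ler_normD _ _) _.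
    rewrite !normrM (gtr0_norm (ltr0n R 2)) (gtr0_norm (addr_gt0 (kap0 n) ltr01)).
    have := ler_wpM2l (ler0n R 2) b00.
    have : (kap n + 1) * `|e11| <= 3 * M by apply: ler_pM => //; lra.
    by lra.
  apply: le_trans (ler_normB _ _) _; rewrite /C expr2; move: i1 i2; lra.
move: d1 close; rewrite !ler_norml => /andP[? ?] /andP[? ?].
by apply/andP; split; lra.
Qed.

Lemma per_a_gt0 n : forall j, 0 < per_a n j.
Proof. exact: periodize_gt0. Qed.

Definition density x : R := Num.sqrt (- h.[x]) / (2 * pi * g x).

Lemma density_continuous : continuous g -> continuous density.
Proof.
move=> gc x; apply: cvgM.
  apply: (continuous_comp (f := fun x => - h.[x])); last exact: sqrt_continuous.
  by apply: cvgN; exact: continuous_horner.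
apply: cvgV; last by apply: cvgM; [exact: cvg_cst|exact: gc].
by rewrite !mulf_neq0// ?gt_eqF ?pi_gt0// (lt_le_trans m_gt0).
Qed.

(** [local_law] for each continuation, with densities that converge uniformly. *)
Lemma per_local_limit (F : R -> R) : c' < d' -> continuous g -> continuous F ->
  (forall x, ~~ (c' < x < d') -> F x = 0) -> forall eps : R, 0 < eps ->
  exists n0, forall n, (n0 <= n)%N -> exists M0, forall M', (M0 <= M')%N ->
  `|quad (per_b n) (per_a_gt0 n) M' F - ival (fun x => F x * density x) c' d'| <= eps.
Proof.
move=> cd gc Fc F0 eps eps0.
have Kin x : K x = (c' <= x <= d') :> Prop by rewrite /K /= in_itv.
have [W W0 HW] : exists2 W : R, 0 < W & forall x, K x -> `|F x| <= W.
  have [z _ Hz] := @EVT_max R (fun x => `|F x|) c' d' (ltW cd)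
    (continuous_subspaceT (fun x => cvg_norm (Fc x))).
  exists (`|F z| + 1); first by rewrite ltr_wpDl.
  by move=> x Kx; apply: le_trans (Hz x Kx) _; rewrite lerDl.
pose f n x := Num.sqrt (4 - (per_disc n).[x] ^+ 2) / `|(per_turan n).[x]|.
pose f' x := Num.sqrt (- h.[x]) / g x.
have lim_f : ucvg K f f'.
  have [Bh Bh0 HBh] := poly_bounded h c' d'.
  apply: (ucvgM (M := Num.max (Num.sqrt Bh) m^-1)).
  - move=> x Kx; rewrite !le_max; split; apply/orP; [left|right].
      rewrite ger0_norm ?sqrtr_ge0// ler_wsqrtr//.
      by have := HBh x; rewrite -Kin => /(_ Kx); rewrite ler_norml => /andP[]; lra.
    have gx : 0 < g x by exact: lt_le_trans (g_ge x).
    by rewrite gtr0_norm ?invr_gt0// lef_pV2 ?posrE.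
  - apply: (ucvg_sqrt (f := fun n x => 4 - (per_disc n).[x] ^+ 2) (l := fun x => - h.[x]) k_gt0).
      by move=> x /h_le; lra.
    exact: per_disc_limit.
  - exact: (ucvgV m_gt0 (fun x _ => g_ge x) per_turan_limit).
have [n1 H1] := per_disc_limit (divr_gt0 k_gt0 (ltr0n _ 2)).
have [n2 H2] := per_turan_limit (divr_gt0 m_gt0 (ltr0n _ 2)).
have dc : 0 < d' - c' by rewrite subr_gt0.
have pi0 : 0 < pi :> R by exact: pi_gt0.
have e1 : 0 < eps / 2 / (W * (d' - c')) by rewrite !divr_gt0// mulr_gt0.
have [n3 H3] := lim_f _ e1.
exists (maxn n1 (maxn n2 n3)) => n; rewrite !geq_max => /and3P[n1n n2n n3n].
have ell x : c' <= x <= d' -> (per_disc n).[x] ^+ 2 < 4.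
  rewrite -Kin => Kx; have := H1 n x n1n Kx; have := h_le Kx.
  rewrite ler_norml opprK; move: (_ ^+ 2) k_gt0 => z k0 ? /andP[? _].
  lra.
have T0 x : c' <= x <= d' -> `|(per_turan n).[x]| != 0.
  rewrite -Kin => Kx; have := H2 n x n2n Kx; have := g_ge x.
  by rewrite ler_norml => ? /andP[? _]; rewrite gt_eqF//; have := m_gt0; lra.
have [B1 HB1] := periodize_bounded (L n).-1 a N_gt0.
have [B2 HB2] := periodize_bounded (L n).-1.+1 b N_gt0.
have aB j : per_a n j <= Num.max B1 B2.
  by rewrite le_max (le_trans (ler_norm _) (HB1 j)).
have bB j : `|per_b n j| <= Num.max B1 B2 by rewrite le_max HB2 orbT.
have [M0 HM0] := @local_law _ (per_a n) (per_b n) (per_a_gt0 n) (L n).-1 N N_gt0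
  (fun j => @periodize_per _ (L n).-1 N a j) (fun j => @periodize_per _ (L n).-1.+1 N b j)
  _ aB bB c' d' cd ell F Fc F0 _ (divr_gt0 eps0 (ltr0n _ 2)).
exists M0 => M' hM'; have := HM0 M' hM'.
have sqc (q : R -> R) : continuous q -> continuous (fun x => Num.sqrt (q x)).
  by move=> qc x; apply: (continuous_comp (f := q)); [exact: qc|exact: sqrt_continuous].
have cf : {within `[c', d'], continuous (fun x => F x * f n x)}.
  apply: continuous_in_subspaceT => x; rewrite inE/= in_itv/= => xI.
  apply: cvgM; first exact: Fc; apply: cvgM.
    apply: (sqc (fun x => 4 - (per_disc n).[x] ^+ 2)) => y; apply: cvgB; first exact: cvg_cst.
    apply: (continuous_comp (f := horner (per_disc n)) (g := fun z => z ^+ 2)).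
      exact: continuous_horner.
    exact: exprn_continuous.
  by apply: cvgV; [exact: T0|apply: cvg_norm; exact: continuous_horner].
have cf' : {within `[c', d'], continuous (fun x => F x * f' x)}.
  apply: continuous_subspaceT => x; apply: cvgM; first exact: Fc.
  apply: cvgM; first by apply: (sqc (fun x => - h.[x])) => y; apply: cvgN; exact: continuous_horner.
  by apply: cvgV; [rewrite gt_eqF// (lt_le_trans m_gt0)|exact: gc].
have -> : ival (fun x => F x * density x) c' d' = 1 / (2 * pi) * ival (fun x => F x * f' x) c' d'.
  rewrite -ivalZ//; apply: ival_eq => x _; rewrite /density /f'.
  rewrite mul1r [(2 * pi * g x)^-1]invfM; move: (2 * pi)^-1 (g x)^-1 => z1 z2.
  by move: (Num.sqrt _) (F x) => z3 z4; ring.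
have close : `|ival (fun x => F x * f n x) c' d' - ival (fun x => F x * f' x) c' d'| <= eps / 2.
  apply: le_trans (ival_near (eps := W * (eps / 2 / (W * (d' - c')))) (ltW cd) cf cf' _) _.
    move=> x; rewrite -Kin => Kx; rewrite -mulrBr normrM.
    by apply: ler_pM => //; [exact: HW|exact: H3].
  by rewrite le_eqVlt; apply/orP; left; apply/eqP; field; rewrite !gt_eqF.
have c1 : `|1 / (2 * pi) * ival (fun x => F x * f n x) c' d' -
    1 / (2 * pi) * ival (fun x => F x * f' x) c' d'| <= eps / 2.
  rewrite -mulrBr normrM; apply: le_trans close; rewrite -[leRHS]mul1r.
  apply: ler_wpM2r => //; rewrite gtr0_norm ?divr_gt0// ?mulr_gt0//.
  by rewrite ler_pdivrMr ?mulr_gt0// mul1r; have := pi_ge2 R; lra.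
rewrite -/(per_disc n) -/(per_turan n) -/(f n).
move: c1; rewrite !ler_norml => /andP[? ?] /andP[? ?].
by apply/andP; split; lra.
Qed.

End PeriodicApproximation.

(** * The spectral measure *)
Section IteratedLimit.
Context {R : realType}.

(** The number [M] of nodes tends to infinity before the index [n] of the block
    from which the coefficients are continued. *)
Definition iterated_filter : set_system (nat * nat) :=
  [set A | exists n0, forall n, (n0 <= n)%N -> exists M0, forall M, (M0 <= M)%N -> A (n, M)].

Lemma iterated_filter_proper : ProperFilter iterated_filter.
Proof.
apply: Build_ProperFilter_ex.
  by move=> A [n0 /(_ _ (leqnn _))[M0 /(_ _ (leqnn _)) ?]]; exists (n0, M0).
split.
- by exists 0%N => n _; exists 0%N.
- move=> A B [n1 H1] [n2 H2]; exists (maxn n1 n2) => n; rewrite geq_max => /andP[n1n n2n].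
  have [M1 H3] := H1 n n1n; have [M2 H4] := H2 n n2n.
  exists (maxn M1 M2) => M; rewrite geq_max => /andP[M1M M2M].
  by split; [exact: H3|exact: H4].
- move=> A B AB [n0 H]; exists n0 => n /H[M0 HM]; exists M0 => M /HM; exact: AB.
Qed.

Lemma iterated_limit (U : set_system (nat * nat)) (u : nat * nat -> R) (l : R) :
  Filter U -> iterated_filter `<=` U ->
  (forall eps : R, 0 < eps -> exists n0, forall n, (n0 <= n)%N ->
     exists M0, forall M, (M0 <= M)%N -> `|u (n, M) - l| <= eps) ->
  u i @[i --> U] --> l.
Proof.
move=> FU BU H; apply/cvgrPdist_le => eps eps0; apply: BU.
have [n0 H0] := H eps eps0; exists n0 => n /H0[M0 HM]; exists M0 => M /HM.
by rewrite distrC.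
Qed.

End IteratedLimit.

Section LimitMeasureExists.
Context {R : realType} {I : Type} (U : set_system I) {UU : UltraFilter U}.

Lemma limit_measure_exists (Q : I -> (R -> R) -> R) (Lam : {poly R} -> R) :
  (forall i F G, Q i (fun x => F x + G x) = Q i F + Q i G) ->
  (forall i c F, Q i (fun x => c * F x) = c * Q i F) ->
  (forall i F G, (forall x, F x <= G x) -> Q i F <= Q i G) ->
  (forall i, Q i (fun=> 1) = 1) ->
  (forall q : {poly R}, Q i (horner q) @[i --> U] --> Lam q) ->
  exists nu : probability (measurableTypeR R) R,
    (forall q : {poly R}, ig nu (horner q) /\ mean nu (horner q) = Lam q) /\
    (forall (F : R -> R) (A : R), 0 < A -> continuous F ->
       (forall x, ~~ (- A < x < A) -> F x = 0) -> Q i F @[i --> U] --> mean nu F).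
Proof.
move=> QD QZ Q_le Q1 QLam; exists (limit_measure QD QZ Q_le Q1 QLam); split.
  by move=> q; split; [exact: ig_poly|exact: limit_measure_poly].
by move=> F A A0 Fc F0; exact: (limit_measure_test A0).
Qed.

End LimitMeasureExists.

Section SpectralMeasure.
Context {R : realType}.
Variables (a b : nat -> R) (N i : nat).
Hypotheses (a_gt0 : forall n, 0 < a n) (N_gt0 : (0 < N)%N).
Local Notation p := (orth_poly a b).

Let Q (nM : nat * nat) (F : R -> R) : R :=
  quad (per_b b N i nM.1) (per_a_gt0 N i a_gt0 nM.1) nM.2.+1 F.

Let QD s F G : Q s (fun x => F x + G x) = Q s F + Q s G. Proof. exact: quadD. Qed.
Let QZ s c F : Q s (fun x => c * F x) = c * Q s F. Proof. exact: quadZ. Qed.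
Let Q_le s F G : (forall x, F x <= G x) -> Q s F <= Q s G.
Proof. by move=> FG; apply: quad_le => x _. Qed.
Let Q1 s : Q s (fun=> 1) = 1. Proof. exact: quad_one. Qed.

Let per_poly n j : (j <= n)%N -> orth_poly (per_a a N i n) (per_b b N i n) j = p j.
Proof.
move=> jn; apply: periodize_orth_poly => //; apply: leq_trans jn _.
have : (n.+1 <= n.+1 * N)%N by rewrite leq_pmulr.
by move: (n.+1 * N)%N => z; lia.
Qed.

Let Q_orth n M j k : (j <= n)%N -> (k <= n)%N -> (j <= M)%N -> (k <= M)%N ->
  Q (n, M) (horner (p j * p k)) = (j == k)%:R.
Proof.
move=> jn kn jM kM; rewrite -(quad_orth (per_b b N i n) (per_a_gt0 N i a_gt0 n) (M := M.+1) (j := j) (l := k))//.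
by apply: quad_eq => x _; rewrite !per_poly// hornerM.
Qed.

Let Lam (q : {poly R}) : R := Q (size q, size q) (horner q).

Let Q_stable (q : {poly R}) n M : (size q <= n)%N -> (size q <= M)%N -> Q (n, M) (horner q) = Lam q.
Proof.
have [c [qE _]] := poly_expand b a_gt0 (leqnn (size q)).
have key n' M' : (size q <= n')%N -> (size q <= M')%N ->
    Q (n', M') (horner q) = \sum_(j < size q) c j * (j == 0%N :> nat)%:R.
  move=> qn qM; transitivity (Q (n', M') (fun x => \sum_(j < size q) c j * (p j * p 0%N).[x])).
    congr Q; apply/funext => x; rewrite {1}qE horner_sum; apply: eq_bigr => j _.
    by rewrite hornerZ [p 0%N]/(1 : {poly R}) mulr1.
  rewrite /Q quad_sum; apply: eq_bigr => j _; rewrite quadZ; congr (_ * _).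
  have jq := ltn_ord j; apply: Q_orth => //; apply: ltnW; exact: leq_trans jq _.
by move=> qn qM; rewrite /Lam !key.
Qed.

Let Lam_orth j k : Lam (p j * p k) = (j == k)%:R.
Proof.
pose s := maxn (size (p j * p k)) (maxn j k).
rewrite -(@Q_stable _ s s) ?leq_maxl//.
by apply: Q_orth; rewrite /s !leq_max leqnn !orbT.
Qed.

(** On a polynomial the quadratures are eventually constant, because the continued
    coefficients agree with the given ones below the index [n]; hence the moments
    of the limit are those prescribed by orthonormality. *)
Lemma spectral_measure_exists : exists nu : probability (measurableTypeR R) R,
  [/\ forall q : {poly R}, ig nu (horner q),
      forall j k, mean nu (horner (p j * p k)) = (j == k)%:R &
      forall (F : R -> R) (A l : R), 0 < A -> continuous F ->
       (forall x, ~~ (- A < x < A) -> F x = 0) ->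
       (forall eps : R, 0 < eps -> exists n0, forall n, (n0 <= n)%N ->
         exists M0, forall M, (M0 <= M)%N ->
           `|quad (per_b b N i n) (per_a_gt0 N i a_gt0 n) M F - l| <= eps) ->
       mean nu F = l].
Proof.
have [U [UU BU]] := ultraFilterLemma iterated_filter_proper.
have PU : ProperFilter U by exact: ultra_proper.
have QLam (q : {poly R}) : Q i (horner q) @[i --> U] --> Lam q.
  apply: iterated_limit => // eps eps0; exists (size q) => n qn.
  by exists (size q) => M qM; rewrite Q_stable// subrr normr0 ltW.
have [nu [nu1 nu2]] := limit_measure_exists QD QZ Q_le Q1 QLam.
exists nu; split=> [q|j k|F A l A0 Fc F0 H]; first by have [] := nu1 q.
  by have [_ ->] := nu1 (p j * p k); exact: Lam_orth.
apply: (ultralimit_unique (nu2 F A A0 Fc F0)).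
apply: iterated_limit => // eps /H[n0 H0]; exists n0 => n /H0[M0 HM].
by exists M0 => M hM; apply: HM; exact: leqW.
Qed.

End SpectralMeasure.

Section Conclusion.
Context {R : realType}.

Lemma orthonormal_of_moments (nu : probability (measurableTypeR R) R) (p : nat -> {poly R}) :
  (forall q : {poly R}, ig nu (horner q)) ->
  (forall j k, mean nu (horner (p j * p k)) = (j == k)%:R) ->
  orthonormal_L2 nu p.
Proof.
move=> igq orth; split=> [n|j k].
  have mp : measurable_fun setT (horner (p n)).
    by apply: continuous_measurable_fun; exact: continuous_horner.
  apply/andP; split; first by rewrite inE.
  rewrite inE /= /finite_norm unlock /Lnorm.
  have /integrableP[_ fin] := igq (p n * p n).
  apply: poweR_lty; apply: le_lt_trans fin.
  rewrite le_eqVlt; apply/orP; left; apply/eqP; apply: eq_integral => x _ /=.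
  by rewrite powR_mulrn// expr2 hornerM normrM.
rewrite -orth -mean_EFin//; apply: eq_integral => x _.
by rewrite hornerM.
Qed.

Lemma sup_on_cvg0 (a b : nat -> R) (N i : nat) (c d c' d' : R) (g : R -> R) :
  (0 < N)%N -> (i < N)%N -> c < d -> c' <= c -> d <= d' ->
  ucvg `[c', d']%classic (turan a b N i) g ->
  (fun n : nat => sup_on `[c, d]%classic (fun x : R =>
     `| a (n + N).-1 *
          `| (orth_poly a b n).[x] * (orth_poly a b (n + N).-1).[x]
             - (orth_poly a b n.-1).[x] * (orth_poly a b (n + N)%N).[x] |
        - g x |))
  @ within [set n : nat | n = i %[mod N]] \oo --> (0 : \bar R).
Proof.
move=> N0 iN cd cc dd lim.
set f := (fun n : nat => _).
have fb (eps : R) : 0 < eps -> \forall n \near within [set n : nat | n = i %[mod N]] \oo,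
    (0 <= f n <= eps%:E)%E.
  move=> eps0; have [n0 H] := lim eps eps0.
  exists (n0.+1 * N + i)%N => // n /= nn nmod.
  have [q [qn nE]] : exists q, (n0 <= q)%N /\ n = (q.+1 * N + i)%N.
    have nE := divn_eq n N; rewrite nmod modn_small// in nE.
    have q0 : (n0.+1 <= n %/ N)%N.
      by rewrite leq_divRL//; apply: leq_trans nn; exact: leq_addr.
    by exists (n %/ N).-1; rewrite prednK ?(leq_trans _ q0)//; split => //; lia.
  apply/andP; split.
    apply: (@le_trans _ _ (`|turan a b N i q c - g c|)%:E); first by rewrite lee_fin.
    apply: ereal_sup_ubound; exists c; first by rewrite /= in_itv/= lexx ltW.
    by rewrite nE.
  apply: ge_ereal_sup => _ [x /= xI <-]; rewrite lee_fin nE; apply: H => //=.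
  by move: xI; rewrite !in_itv/= => /andP[? ?]; apply/andP; split; lra.
apply/fine_cvgP; split.
  apply: filterS (fb 1 ltr01) => n /andP[f0 f1].
  by rewrite ge0_fin_numE// (le_lt_trans f1)// ltry.
apply/cvgrPdist_le => eps /fb; apply: filterS => n /andP[f0 f1].
have ffin : f n \is a fin_num by rewrite ge0_fin_numE// (le_lt_trans f1)// ltry.
by rewrite sub0r normrN ger0_norm ?fine_ge0// -lee_fin fineK.
Qed.

End Conclusion.

Theorem theoremB (R : realType) (a b : nat -> R) (N r i : nat) (K : set R)
    (a_gt0 : forall n : nat, 0 < a n)
    (N_gt0 : (0 < N)%N) (r_gt0 : (0 < r)%N) (i_lt : (i < N)%N)
    (K_itv : compact_interval K) (K_sub : K `<=` Lambda a b N i)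
    (a_lim : (fun n : nat => a (n.+1 * N + i).-1 / a (n * N + i).-1) @ \oo
               --> (1 : R))
    (X_D : Dclass r K (fun n : nat => step_mx a b N (n * N + i))) :
  let p := orth_poly a b in
  exists g : R -> R,
    [/\ forall x : R, K x -> 0 < g x,
        (fun n : nat =>
           sup_on K (fun x : R =>
             `| a (n + N).-1 *
                  `| (p n).[x] * (p (n + N).-1).[x]
                     - (p n.-1).[x] * (p (n + N)%N).[x] |
                - g x |))
          @ within [set n : nat | n = i %[mod N]] \oo --> (0 : \bar R)
      & exists nu : probability (measurableTypeR R) R,
          orthonormal_L2 nu p /\
          abs_cont_on K nu (fun x : R =>
            Num.sqrt (- discr_lim a b N i x) / (2 * pi * g x))].
Proof.
move=> p; have [c [d [cd KE]]] := K_itv; subst K.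
have [h [hK hlim]] := discr_limit cd K_sub.
have [eta [k [eta0 k0 h_neg]]] := negative_near_segment cd (fun x xI => (hK x xI).2).
(* All estimates hold on a segment with K in its interior. *)
pose c' := c - eta; pose d' := d + eta.
have c'c : c' < c by rewrite /c' ltrBlDr ltrDl.
have dd' : d < d' by rewrite /d' ltrDl.
have cd' : c' < d' by exact: lt_trans c'c (lt_trans cd dd').
have Kin (x : R) : `[c', d']%classic x = (c' <= x <= d') :> Prop by rewrite /= in_itv.
have [g [m [m0 gc g_ge turan_g]]] :=
  turan_limit cd a_gt0 N_gt0 r_gt0 a_lim X_D k0 (ltW cd') (hlim c' d') h_neg.
have g_gt0 x : 0 < g x by exact: lt_le_trans (g_ge x).
exists g; split=> //; first exact: sup_on_cvg0 N_gt0 i_lt cd (ltW c'c) (ltW dd') turan_g.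
have [B g_le] : exists B : R, forall x, `[c', d']%classic x -> g x <= B.
  have [z _ Hz] := EVT_max (ltW cd') (continuous_subspaceT gc).
  by exists (g z) => x /Hz.
have [M [M0 entry_le]] : exists M : R, 0 < M /\ forall s t n x, `[c', d']%classic x ->
    `|(entry a b (n.+1 * N + i) N s t).[x]| <= M.
  have Mex (st : 'I_2 * 'I_2) : exists M : R, 0 < M /\ forall n x, `[c', d']%classic x ->
      `|(entry a b (n.+1 * N + i) N st.1 st.2).[x]| <= M.
    have [M M0 HM] := order_ge_bounded (regular_order
      (Dclass_regular c' d' st.1 st.2 r_gt0 cd X_D)).
    by exists M.
  have [M HM] := choice Mex; exists (\sum_st M st); split.
    rewrite (bigD1 (0, 0))//= ltr_pwDl//; first by have [] := HM (0, 0).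
    by apply: sumr_ge0 => st _; have [/ltW] := HM st.
  move=> s t n x Kx; have [_ Mst] := HM (s, t).
  apply: le_trans (Mst n x Kx) _; rewrite (bigD1 (s, t))//= lerDl.
  by apply: sumr_ge0 => st _; have [/ltW] := HM st.
have a_ratio : (fun n => a (n.+2 * N + i).-1 / a (n.+1 * N + i).-1) @ \oo --> (1 : R).
  have := cvg_shiftS (fun n => a (n.+1 * N + i).-1 / a (n * N + i).-1).
  by move=> ->; exact: a_lim.
have [nu [igq orth test]] := spectral_measure_exists b i a_gt0 N_gt0.
exists nu; split; first exact: orthonormal_of_moments.
pose rho := density h g.
have rho_c : continuous rho by exact: density_continuous m0 g_ge gc.
have rho0 x : 0 <= rho x.
  by rewrite /rho /density divr_ge0 ?sqrtr_ge0// !mulr_ge0// ?pi_ge0// ltW.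
have rhoE x : `[c, d]%classic x ->
    Num.sqrt (- discr_lim a b N i x) / (2 * pi * g x) = rho x.
  by rewrite /= in_itv/= => /hK[<- _].
have nu_rho (F : R -> R) : continuous F -> (forall x, ~~ (c' < x < d') -> F x = 0) ->
    mean nu F = ival (fun x => F x * rho x) c' d'.
  move=> Fc F0; pose A := `|c'| + `|d'| + 1.
  have A0 : 0 < A by rewrite ltr_wpDl// addr_ge0.
  apply: (test F A) => //.
    move=> x xA; apply: F0; apply: contraNN xA => /andP[cx xd].
    have := ler_norm d'; have := ler_norm (- c'); rewrite normrN => ? ?.
    have := normr_ge0 c'; have := normr_ge0 d'.
    by rewrite /A => ? ?; apply/andP; split; lra.
  exact: (per_local_limit a_gt0 N_gt0 a_ratio M0 entry_le k0 _ (hlim c' d') m0 g_ge g_le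
    turan_g cd' gc Fc F0).
have dens := density_borel c'c dd' rho_c rho0 nu_rho.
split.
- apply: (eq_measurable_fun rho); first by move=> x; rewrite inE => /rhoE ->.
  by apply: measurable_funTS; exact: continuous_measurable_fun.
- by move=> x /rhoE ->.
move=> E mE EK; rewrite dens//; apply: eq_integral => x.
by rewrite inE => /EK /rhoE ->.
Qed.
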